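(* Let $A$ be a simple unital $C^*$-algebra and let $\alpha:G\to\mathrm{Aut}(A)$ be an action of a finite group $G$ on $A$. Assume that $\alpha$ has the generalized tracial Rokhlin property. If $A$ is tracially $\mathcal{Z}$-absorbing, then the crossed product $A\rtimes_\alpha G$ is also tracially $\mathcal{Z}$-absorbing.
   Context: Cuntz subequivalence: for positive elements $a,b$ of a $C^*$-algebra $B$, $a\precsim b$ means there is a sequence $(x_n)$ in $B$ with $\lim_n\|a-x_nbx_n^*\|=0$. A completely positive contractive (c.p.c.) map $\varphi:B\to C$ has order zero if $\varphi(a)\varphi(b)=0$ whenever $a,b\in B_+$ satisfy $ab=0$. A unital $C^*$-algebra $A$ is tracially $\mathcal{Z}$-absorbing if $A\not\cong\mathbb{C}$ and for every finite set $F\subset A$, every $\varepsilon>0$, every non-zero positive $a\in A$ and every positive integer $n$ there is a c.p.c. order zero map $\varphi:M_n\to A$ such that: (1) $1-\varphi(1)\precsim a$; (2) $\|[\varphi(x),y]\|<\varepsilon$ for every $x\in M_n$ with $\|x\|=1$ and every $y\in F$. An action $\alpha:G\to\mathrm{Aut}(A)$ of a finite group $G$ on a simple unital $C^*$-algebra $A$ has the generalized tracial Rokhlin property if for every $\varepsilon>0$, every finite $F\subseteq A$ and every non-zero positive $a\in A$ there exist positive elements $\{e_g\}_{g\in G}\subseteq A$ of norm $1$ such that: (1) $e_ge_h=0$ when $g\ne h$; (2) $1-\sum_{g\in G}e_g\precsim a$; (3) $\|[e_g,y]\|<\varepsilon$ for all $g\in G$, $y\in F$; (4) $\|\alpha_g(e_h)-e_{gh}\|<\varepsilon$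 for all $g,h\in G$. *)

(* Defs.v *)
From HB Require Import structures.
From mathcomp Require Import all_boot all_order all_algebra fingroup.
From mathcomp Require Import all_classical all_reals all_analysis.
From mathcomp Require Import complex.
Import Order.TTheory GRing.Theory Num.Theory.
Import numFieldNormedType.Exports.

Set Implicit Arguments.
Unset Strict Implicit.
Unset Printing Implicit Defensive.

Local Open Scope classical_set_scope.
Local Open Scope complex_scope.
Local Open Scope ring_scope.

HB.mixin Record isStarAlgebra (R : realType) A & GRing.Algebra R[i] A := {
  star : A -> A;
  starK : involutive star;
  starD : {morph star : x y / x + y};
  starZ : forall (c : R[i]) x, star (c *: x) = Num.conj c *: star x;
  starM : forall x y, star (x * y) = star y * star x
}.

#[short(type="starAlgType")]
HB.structure Definition StarAlgebra (R : realType) :=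
  {A of GRing.Algebra R[i] A & isStarAlgebra R A}.

(* The norm is a field of the mixin: Num.NumDomain is already the declared join
   of rings and normed modules, so Hierarchy-Builder rejects an algebra that is
   also a normedModType.  cnorm x >= 0 follows from cnormD and cnormZ. *)
HB.mixin Record isCstarAlgebra (R : realType) A & StarAlgebra R A := {
  cnorm : A -> R;
  cnorm0_eq0 : forall x, cnorm x = 0 -> x = 0;
  cnormD : forall x y, cnorm (x + y) <= cnorm x + cnorm y;
  cnormZ : forall (c : R[i]) x, cnorm (c *: x) = Normc.normc c * cnorm x;
  cnormM : forall x y, cnorm (x * y) <= cnorm x * cnorm y;
  cnorm_starM : forall x, cnorm (star x * x) = cnorm x ^+ 2;
  cnorm_complete : forall x : nat -> A,
    (forall eps : R, 0 < eps -> exists N, forall m n,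
       (N <= m)%N -> (N <= n)%N -> cnorm (x m - x n) < eps) ->
    exists l, cnorm (x n - l) @[n --> \oo] --> (0 : R)
}.

(* Unital C*-algebras; [1 != 0] is part of [algType]. *)
#[short(type="cstarAlgType")]
HB.structure Definition CstarAlgebra (R : realType) :=
  {A of StarAlgebra R A & isCstarAlgebra R A}.

Section ComplexStar.
Variable R : realType.
Implicit Types x y : R[i]^o.

Let conj_starK : involutive (fun x => Num.conj x : R[i]^o).
Proof. exact: conjCK. Qed.
Let conj_starD : {morph (fun x => Num.conj x : R[i]^o) : x y / x + y}.
Proof. by move=> x y; exact: rmorphD. Qed.
Let conj_starZ (c : R[i]) x : Num.conj (c *: x) = Num.conj c *: (Num.conj x : R[i]^o).
Proof. exact: rmorphM. Qed.
Let conj_starM x y : Num.conj (x * y) = (Num.conj y * Num.conj x : R[i]^o).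
Proof. by rewrite rmorphM mulrC. Qed.

HB.instance Definition _ := isStarAlgebra.Build R R[i]^o
  conj_starK conj_starD conj_starZ conj_starM.
End ComplexStar.

Section MatrixStar.
Variables (R : realType) (n : nat).
Implicit Types x y : 'M[R[i]]_n.+1.

Definition mxadj x : 'M[R[i]]_n.+1 := (map_mx Num.conj x)^T.

Let mxadjK : involutive mxadj.
Proof. by move=> x; apply/matrixP => i j; rewrite !mxE conjCK. Qed.
Let mxadjD : {morph mxadj : x y / x + y}.
Proof. by move=> x y; apply/matrixP => i j; rewrite !mxE rmorphD. Qed.
Let mxadjZ (c : R[i]) x : mxadj (c *: x) = Num.conj c *: mxadj x.
Proof. by apply/matrixP => i j; rewrite !mxE rmorphM. Qed.
Let mxadjM x y : mxadj (x * y) = mxadj y * mxadj x.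
Proof. by rewrite /mxadj -[x * y]/(x *m y) map_mxM trmx_mul. Qed.

HB.instance Definition _ := isStarAlgebra.Build R 'M[R[i]]_n.+1
  mxadjK mxadjD mxadjZ mxadjM.
End MatrixStar.

Section StarAlgebraTheory.
Variable R : realType.
Implicit Types B D : starAlgType R.

Definition positive B (a : B) : Prop := exists b : B, a = star b * b.

Definition mxstar B k (X : 'M[B]_k) : 'M[B]_k := (map_mx (@star R B) X)^T.

(* Positivity in the C*-algebra of k x k matrices over B. *)
Definition mxpositive B k (X : 'M[B]_k) : Prop :=
  exists Y : 'M[B]_k, X = mxstar Y *m Y.

Definition star_hom B D (f : {lrmorphism B -> D}) : Prop :=
  {morph f : x / star x}.

Definition star_isomorphic B D : Prop :=
  exists2 f : {lrmorphism B -> D}, star_hom f & bijective f.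

Definition completely_positive B D (phi : {linear B -> D}) : Prop :=
  forall k (X : 'M[B]_k), mxpositive X -> mxpositive (map_mx phi X).

Definition order_zero B D (phi : {linear B -> D}) : Prop :=
  forall a b : B, positive a -> positive b -> a * b = 0 -> phi a * phi b = 0.

End StarAlgebraTheory.

Section OperatorNorm.
Variables (R : realType) (n : nat).

Definition l2norm (v : 'cV[R[i]]_n) : R :=
  Num.sqrt (\sum_(i < n) Normc.normc (v i 0) ^+ 2).

(* The C*-norm of M_n; the norm that MathComp-Analysis puts on matrices is the
   maximum of the norms of the entries. *)
Definition opnorm (x : 'M[R[i]]_n) : R :=
  sup [set l2norm (x *m v) | v in [set v : 'cV[R[i]]_n | l2norm v <= 1]].

End OperatorNorm.

Section CstarAlgebraTheory.
Variable R : realType.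
Implicit Types A B D : cstarAlgType R.

Definition norm_closed A (I : set A) : Prop :=
  forall (x : nat -> A) (l : A),
    (forall n, I (x n)) -> cnorm (x n - l) @[n --> \oo] --> (0 : R) -> I l.

Definition simple_cstar A : Prop :=
  forall I : set A,
    norm_closed I -> I 0 -> (forall x y, I x -> I y -> I (x + y)) ->
    (forall a x, I x -> I (a * x) /\ I (x * a)) ->
    I = [set 0] \/ I = setT.

Definition cuntz_sub A (a b : A) : Prop :=
  exists x : nat -> A,
    cnorm (a - x n * b * star (x n)) @[n --> \oo] --> (0 : R).

Definition cpc_order_zero A n (phi : {linear 'M[R[i]]_n.+1 -> A}) : Prop :=
  [/\ completely_positive phi,
      forall x, cnorm (phi x) <= opnorm x
    & order_zero phi].

(* The matrix size, a positive integer, is [n.+1]. *)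
Definition tracially_Z_absorbing A : Prop :=
  ~ star_isomorphic A R[i]^o /\
  forall (F : set A) (eps : R) (a : A) (n : nat),
    finite_set F -> 0 < eps -> positive a -> a != 0 ->
    exists phi : {linear 'M[R[i]]_n.+1 -> A},
      [/\ cpc_order_zero phi,
          cuntz_sub (1 - phi 1) a
        & forall x y, opnorm x = 1 -> F y ->
            cnorm (phi x * y - y * phi x) < eps].

Section Actions.
Variable G : finGroupType.

(* Each [alpha g] is invertible, with inverse [alpha g^-1]. *)
Definition is_action A (alpha : G -> {lrmorphism A -> A}) : Prop :=
  [/\ forall g, star_hom (alpha g),
      alpha 1%g =1 id
    & forall g h, alpha (g * h)%g =1 alpha g \o alpha h].

Definition gen_tracial_Rokhlin A (alpha : G -> {lrmorphism A -> A}) : Prop :=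
  forall (eps : R) (F : set A) (a : A),
    0 < eps -> finite_set F -> positive a -> a != 0 ->
    exists e : G -> A,
      (forall g, positive (e g) /\ cnorm (e g) = 1) /\
      [/\ forall g h, g != h -> e g * e h = 0,
          cuntz_sub (1 - \sum_g e g) a,
          forall g y, F y -> cnorm (e g * y - y * e g) < eps
        & forall g h, cnorm (alpha g (e h) - e (g * h)%g) < eps].

Definition unitary A (w : A) : Prop := star w * w = 1 /\ w * star w = 1.

Definition covariant_rep A (alpha : G -> {lrmorphism A -> A})
    D (pi : {lrmorphism A -> D}) (v : G -> D) : Prop :=
  [/\ star_hom pi,
      forall g, unitary (v g),
      forall g h, v (g * h)%g = v g * v h
    & forall g a, v g * pi a * star (v g) = pi (alpha g a)].

(* [B], with [iota] and [u], is the crossed product of [A] by [alpha]: the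
   C*-algebra universal for covariant representations.  As A is unital and G is
   discrete, unital representations in unital C*-algebras suffice. *)
Definition is_crossed_product A (alpha : G -> {lrmorphism A -> A})
    B (iota : {lrmorphism A -> B}) (u : G -> B) : Prop :=
  covariant_rep alpha iota u /\
  forall D (pi : {lrmorphism A -> D}) (v : G -> D),
    covariant_rep alpha pi v ->
    exists2 rho : {lrmorphism B -> D},
      [/\ star_hom rho, rho \o iota =1 pi & rho \o u =1 v]
    & forall rho' : {lrmorphism B -> D},
        [/\ star_hom rho', rho' \o iota =1 pi & rho' \o u =1 v] ->
        rho' =1 rho.

End Actions.
End CstarAlgebraTheory.

(* Main.v *)
(* The Rokhlin elements [e g] and an order zero map [phi] of [M_n] into [A] are combined into
   the row [c i = \sum_g e g * alpha g (phi (delta_mx i 0))], which is almost invariant under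
   [alpha], almost commutes with the given finite set and almost satisfies
   [star (c i) * c j = d *+ (i == j)].  A polar decomposition in the matrices over [A] replaces
   it by a nearby row [y] that satisfies this relation exactly, and then
   [x |-> \sum_(i, j) x i j *: (y i * star (y j))] is an order zero map.  Its defect at [1] is
   below the defects of the tower [e] and of [alpha g \o phi], so below any nonzero positive
   [a] of [A] that contains enough orthogonal copies of a smaller one; such copies come from
   the orthogonality of the [e g].  Finally every nonzero positive element of the crossed
   product dominates a nonzero positive [a] of [A]: by simplicity of [A] the corner at [e 1]
   does not annihilate the expectation, and it almost removes the other coefficients.  All
   C*-algebra theory is derived from the axioms without spectra: positivity of [a] means
   [cnorm (t - a) <= t] for some [t]. *)

From HB Require Import structures.
Require Import Defs.
From mathcomp Require Import all_boot all_order all_algebra fingroup.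
From mathcomp Require Import all_classical all_reals all_analysis complex.
From mathcomp Require Import ring lra.
Import Order.TTheory GRing.Theory Num.Theory.
Import numFieldNormedType.Exports.

Set Implicit Arguments.
Unset Strict Implicit.
Unset Printing Implicit Defensive.

Local Open Scope ring_scope.
Local Open Scope complex_scope.

(** * Identities in noncommutative algebras *)

(** Repairing an approximate order zero map directly would call for the stability of the relations
    of a matrix cone; a row that almost satisfies [star (c i) * c j = d *+ (i == j)] is repaired by
    one polar decomposition. The price is a square: at [1] the row produces [phi 1 * phi 1], so the
    defect is [1 - phi 1 * phi 1], which is below [1 - phi 1] because [1 + phi 1] has a square root
    commuting with [phi 1]. A Cuntz comparison tolerates no norm error, so the repaired row is
    rescaled until its defect is cut down by a fixed amount, and the cut absorbs the error. The
    crossed product is known only by its universal property, which provides no conditional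
    expectation. What is extracted from it is the density of the span of the [iota a * u g];
    compression by a Rokhlin element then isolates the coefficient at the unit of [G]. For the
    trivial group a tower has a single level and yields no orthogonal elements; that case is settled
    by an isomorphism with [A]. *)

Inductive aexpr (K : Type) :=
  | AVar of nat | AZero | AOne
  | AAdd of aexpr K & aexpr K | AOpp of aexpr K
  | AMul of aexpr K & aexpr K | AScale of K & aexpr K.

(** Written with [if] and [eqn] so that the few constants unfolded by [alg_with] decide equality of
    concrete words, while the coefficients stay symbolic for [ring]. *)
Fixpoint eqword (w v : seq nat) : bool :=
  match w, v with
  | [::], [::] => true
  | i :: w', j :: v' => if eqn i j then eqword w' v' else false
  | _, _ => false
  end.

Lemma eqwordP w v : eqword w v -> w = v.
Proof. by elim: w v => [|i w IH] [|j v] //=; case: eqnP => // -> /IH ->. Qed.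

Section AlgebraReflection.
Variables (K : comNzRingType) (A : algType K).
Implicit Types (e : aexpr K) (env : seq A) (p : seq (K * seq nat)).

Fixpoint aeval env e : A :=
  match e with
  | AVar i => nth 0 env i
  | AZero => 0
  | AOne => 1
  | AAdd e1 e2 => aeval env e1 + aeval env e2
  | AOpp e1 => - aeval env e1
  | AMul e1 e2 => aeval env e1 * aeval env e2
  | AScale c e1 => c *: aeval env e1
  end.

Fixpoint ainsert (c : K) (w : seq nat) p :=
  if p is (d, v) :: p' then
    if eqword w v then (d + c, v) :: p' else (d, v) :: ainsert c w p'
  else [:: (c, w)].

Fixpoint anorm e : seq (K * seq nat) :=
  match e with
  | AVar i => [:: (1, [:: i])]
  | AZero => [::]
  | AOne => [:: (1, [::])]
  | AAdd e1 e2 => foldr (fun m => ainsert m.1 m.2) (anorm e1) (anorm e2)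
  | AOpp e1 => [seq (- m.1, m.2) | m <- anorm e1]
  | AMul e1 e2 =>
      foldr (fun m => foldr (fun m' => ainsert (m.1 * m'.1) (m.2 ++ m'.2))^~
                             (anorm e2)) [::] (anorm e1)
  | AScale c e1 => [seq (c * m.1, m.2) | m <- anorm e1]
  end.

Fixpoint all_zero p : Prop :=
  match p with
  | [::] => True
  | (c, _) :: [::] => c = 0
  | (c, _) :: p' => c = 0 /\ all_zero p'
  end.

Let word env (w : seq nat) : A := \prod_(i <- w) nth 0 env i.
Let peval env p : A := \sum_(m <- p) m.1 *: word env m.2.

Let peval_insert env c w p :
  peval env (ainsert c w p) = c *: word env w + peval env p.
Proof.
elim: p => [|[d v] p IH] /=; first by rewrite /peval big_cons.
case: ifP => [/eqwordP ->|_]; first by rewrite /peval !big_cons /= scalerDl addrCA addrA.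
by move: IH; rewrite /peval !big_cons /= => ->; rewrite addrCA.
Qed.

Let peval_norm env e : peval env (anorm e) = aeval env e.
Proof.
elim: e => [i|||e1 IH1 e2 IH2|e IH|e1 IH1 e2 IH2|c e IH] /=.
- by rewrite /peval /word !big_seq1 scale1r.
- by rewrite /peval big_nil.
- by rewrite /peval /word big_seq1 big_nil scale1r.
- rewrite -IH2; elim: (anorm e2) => [|m p IHp] /=.
    by rewrite IH1 /peval big_nil addr0.
  by rewrite peval_insert IHp /peval big_cons addrCA.
- rewrite -IH; elim: (anorm e) => [|m p IHp] /=.
    by rewrite /peval !big_nil oppr0.
  by move: IHp; rewrite /peval !big_cons /= scaleNr opprD => ->.
- rewrite -IH1 -IH2; elim: (anorm e1) => [|m p IHp] /=.
    by rewrite /peval !big_nil mul0r.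
  rewrite [X in _ = X * _]/peval big_cons -/(peval env p) mulrDl -IHp.
  move: (foldr _ [::] p) => s.
  elim: (anorm e2) => [|m' q IHq] /=; first by rewrite [X in _ * X]/peval big_nil mulr0 add0r.
  rewrite peval_insert IHq [X in _ = _ * X + _]/peval big_cons -/(peval env q) mulrDr -addrA.
  congr (_ + _); rewrite [word _ (_ ++ _)]big_cat -scalerAl -scalerAr scalerA.
  by [].
- rewrite -IH; elim: (anorm e) => [|m p IHp] /=.
    by rewrite /peval !big_nil scaler0.
  by move: IHp; rewrite /peval !big_cons /= scalerDr scalerA => ->.
Qed.

Lemma aeval_eq env e1 e2 :
  all_zero (anorm (AAdd e1 (AOpp e2))) -> aeval env e1 = aeval env e2.
Proof.
move=> h; apply/eqP; rewrite -subr_eq0; apply/eqP.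
rewrite -[LHS]/(aeval env (AAdd e1 (AOpp e2))) -peval_norm.
elim: (anorm _) h => [_|[c w] p IH]; first by rewrite /peval big_nil.
case: p IH => [_ /= ->|m p IH [/= -> h]]; first by rewrite /peval big_seq1 scale0r.
by rewrite /peval big_cons scale0r add0r; exact: IH.
Qed.

End AlgebraReflection.

Ltac alg_index x env k :=
  lazymatch env with
  | cons x _ => k
  | cons _ ?env' => let k' := constr:(S k) in alg_index x env' k'
  end.

Ltac alg_add x env :=
  lazymatch env with
  | context [cons x _] => env
  | _ => constr:(cons x env)
  end.

Ltac alg_pow K e n :=
  lazymatch n with
  | O => constr:(AOne K)
  | S O => e
  | S ?m => let r := alg_pow K e m in constr:(AMul e r)
  end.

(** In the case of a power, [alg_pow] has no branch for an exponent that is not a numeral. Its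
    failure selects the second branch of the inner [match], which makes the whole power an atom;
    [alg_quote] decides in the same way. *)
Ltac alg_env t env :=
  lazymatch t with
  | Algebra.add ?x ?y => let env := alg_env x env in alg_env y env
  | Algebra.opp ?x => alg_env x env
  | GRing.mul ?x ?y => let env := alg_env x env in alg_env y env
  | GRing.scale _ ?x => alg_env x env
  | Algebra.natmul ?x _ => alg_env x env
  | GRing.exp ?x ?n =>
      match constr:(tt) with
      | _ => let m := eval compute in n in
             let _ := alg_pow unit (AOne unit) m in alg_env x env
      | _ => alg_add t env
      end
  | @GRing.one _ => env
  | @Algebra.zero _ => env
  | _ => alg_add t env
  end.

Ltac alg_quote K t env :=
  lazymatch t with
  | Algebra.add ?x ?y =>
      let e := alg_quote K x env in let f := alg_quote K y env in constr:(AAdd e f)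
  | Algebra.opp ?x => let e := alg_quote K x env in constr:(AOpp e)
  | GRing.mul ?x ?y =>
      let e := alg_quote K x env in let f := alg_quote K y env in constr:(AMul e f)
  | GRing.scale ?c ?x => let e := alg_quote K x env in constr:(AScale (c : K) e)
  | Algebra.natmul ?x ?n => let e := alg_quote K x env in constr:(AScale (n%:R : K) e)
  | GRing.exp ?x ?n =>
      match constr:(tt) with
      | _ => let m := eval compute in n in
             let e := alg_quote K x env in alg_pow K e m
      | _ => let i := alg_index t env O in constr:(AVar K i)
      end
  | @GRing.one _ => constr:(AOne K)
  | @Algebra.zero _ => constr:(AZero K)
  | _ => let i := alg_index t env O in constr:(AVar K i)
  end.

Ltac alg_refl :=
  first [reflexivity | cbn [aeval nth]; rewrite -?scaler_nat; reflexivity].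

(* [alg] reduces an equation in a [cstarAlgType] to equations between the
   coefficients of the noncommutative monomials, and tries [ring] on these. *)
Ltac alg_with K A :=
  lazymatch goal with
  | |- ?x = ?y =>
      let env := constr:(@nil A) in
      let env := alg_env x env in
      let env := alg_env y env in
      let e := alg_quote K x env in
      let f := alg_quote K y env in
      transitivity (@aeval K A env e); [alg_refl|];
      transitivity (@aeval K A env f); [|symmetry; alg_refl];
      apply: aeval_eq;
      cbv [anorm ainsert foldr map all_zero eqword cat fst snd eqn];
      repeat (match goal with |- _ /\ _ => split end);
      try exact: Logic.I
  end.

Ltac alg :=
  lazymatch goal with
  | |- @eq ?T _ _ =>
      let R := open_constr:(_ : realType) in
      let B := open_constr:(_ : cstarAlgType R) in
      unify T (@CstarAlgebra.sort R B);
      alg_with (complex R : comNzRingType) (@CstarAlgebra.sort R B); try ring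
  end.

(** * Norm, involution and self-adjoint elements *)

Section NormTheory.
Variables (R : realType) (A : cstarAlgType R).
Implicit Types (x y z a b : A) (r s t : R).

Lemma normcR r : Normc.normc r%:C = `|r|.
Proof. by rewrite /Normc.normc /= expr0n addr0 sqrtr_sqr. Qed.

Lemma cnormZr r x : cnorm (r%:C *: x) = `|r| * cnorm x.
Proof. by rewrite cnormZ normcR. Qed.

Lemma cnorm0 : cnorm (0 : A) = 0.
Proof. by rewrite -(scale0r 0) cnormZ Normc.normc0 mul0r. Qed.

Lemma cnormN x : cnorm (- x) = cnorm x.
Proof. by rewrite -scaleN1r (_ : -1 = (-1)%:C) ?cnormZr ?normrN1 ?mul1r // rmorphN1. Qed.

Lemma cnorm_ge0 x : 0 <= cnorm x.
Proof. by have := cnormD x (- x); rewrite subrr cnorm0 cnormN; lra. Qed.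
Hint Resolve cnorm_ge0 : core.

Lemma cnormB x y : cnorm (x - y) <= cnorm x + cnorm y.
Proof. by rewrite -(cnormN y); exact: cnormD. Qed.

Lemma cnormBC x y : cnorm (x - y) = cnorm (y - x).
Proof. by rewrite -cnormN opprB. Qed.

Lemma cnorm_eq0 x : (cnorm x == 0) = (x == 0).
Proof. by apply/eqP/eqP => [/cnorm0_eq0//|->]; exact: cnorm0. Qed.

Lemma cnorm_gt0 x : (0 < cnorm x) = (x != 0).
Proof. by rewrite lt_def cnorm_eq0 cnorm_ge0 andbT. Qed.

Lemma cnorm_sum (I : Type) (s : seq I) (P : pred I) (F : I -> A) :
  cnorm (\sum_(i <- s | P i) F i) <= \sum_(i <- s | P i) cnorm (F i).
Proof.
elim/big_rec2: _ => [|i b x _ IH]; first by rewrite cnorm0.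
by apply: le_trans (cnormD _ _) _; rewrite lerD2l.
Qed.

Lemma star0 : star 0 = 0 :> A.
Proof. by apply: (addIr (star 0)); rewrite -starD !add0r. Qed.

Lemma starN x : star (- x) = - star x.
Proof. by apply: (addIr (star x)); rewrite -starD !addNr star0. Qed.

Lemma starB x y : star (x - y) = star x - star y.
Proof. by rewrite starD starN. Qed.

Lemma star1 : star 1 = 1 :> A.
Proof.
transitivity (star (1 : A) * star (star 1)); first by rewrite starK mulr1.
by rewrite -starM mulr1 starK.
Qed.

Lemma starZr r x : star (r%:C *: x) = r%:C *: star x.
Proof. by rewrite starZ; congr (_ *: _); exact: conjc_real. Qed.

Lemma star_sum (I : Type) (s : seq I) (P : pred I) (F : I -> A) :
  star (\sum_(i <- s | P i) F i) = \sum_(i <- s | P i) star (F i).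
Proof. by elim/big_rec2: _ => [|i b x _ <-]; [exact: star0|exact: starD]. Qed.

Lemma cnorm_star x : cnorm (star x) = cnorm x.
Proof.
have h y : cnorm y <= cnorm (star y).
  have [->|y0] := eqVneq y 0; first by rewrite star0.
  by rewrite -(ler_pM2r (_ : 0 < cnorm y)) ?cnorm_gt0 // -expr2 -cnorm_starM cnormM.
by apply/eqP; rewrite eq_le -{2}[x]starK !h.
Qed.

Lemma cnorm_starMr x : cnorm (x * star x) = cnorm x ^+ 2.
Proof. by rewrite -{1}[x]starK cnorm_starM cnorm_star. Qed.

Lemma cnorm1 : cnorm (1 : A) = 1.
Proof.
have := cnorm_starM (1 : A); rewrite star1 mulr1 => /eqP.
rewrite eq_sym -subr_eq0 expr2 -[X in _ - X]mulr1 -mulrBr mulf_eq0 cnorm_eq0 oner_eq0 /=.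
by rewrite subr_eq0 => /eqP.
Qed.

Lemma cnormM_le x y r s : cnorm x <= r -> cnorm y <= s -> cnorm (x * y) <= r * s.
Proof. by move=> xr ys; apply: le_trans (cnormM _ _) _; exact: ler_pM. Qed.

Lemma cnormX n x : cnorm (x ^+ n) <= cnorm x ^+ n.
Proof.
elim: n => [|n IH]; first by rewrite !expr0 cnorm1.
by rewrite !exprS; exact: cnormM_le.
Qed.

Definition sa x := star x = x.

Lemma sa0 : sa 0. Proof. exact: star0. Qed.
Lemma sa1 : sa 1. Proof. exact: star1. Qed.
Lemma saD x y : sa x -> sa y -> sa (x + y).
Proof. by rewrite /sa starD => -> ->. Qed.
Lemma saN x : sa x -> sa (- x).
Proof. by rewrite /sa starN => ->. Qed.
Lemma saB x y : sa x -> sa y -> sa (x - y).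
Proof. by move=> hx hy; apply: saD => //; exact: saN. Qed.
Lemma saZ r x : sa x -> sa (r%:C *: x).
Proof. by rewrite /sa starZr => ->. Qed.
Lemma sa_conj x y : sa x -> sa (star y * x * y).
Proof. by rewrite /sa !starM starK mulrA => ->. Qed.
Lemma saM x y : sa x -> sa y -> GRing.comm x y -> sa (x * y).
Proof. by rewrite /sa starM => -> -> ->. Qed.
Lemma sa_sq x : sa x -> sa (x * x).
Proof. by move=> hx; exact: saM. Qed.

Lemma cnorm_sa_sq x : sa x -> cnorm (x * x) = cnorm x ^+ 2.
Proof. by rewrite -cnorm_starM => ->. Qed.

Lemma sa_expX k x : sa x -> sa (x ^+ k).
Proof.
move=> hx; elim: k => [|k IH]; first by rewrite expr0; exact: sa1.
by rewrite exprS; apply: saM => //; exact: commrX.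
Qed.

(** The C*-identity only doubles exponents. This is why the exponents of later norm computations are
    powers of two. *)
Lemma cnorm_sa_exp2 k x : sa x -> cnorm (x ^+ (2 ^ k)) = cnorm x ^+ (2 ^ k).
Proof.
move=> hx; elim: k => [|k IH]; first by rewrite !expr1.
by rewrite expnSr !exprM expr2 cnorm_sa_sq ?IH //; exact: sa_expX.
Qed.

End NormTheory.

#[global] Hint Extern 0 (is_true (0 <= cnorm _)) => exact: cnorm_ge0 : core.

(** * Sequences *)

Section Sequences.
Variables (R : realType) (A : cstarAlgType R).
Implicit Types (x y : nat -> A) (l : A).
Local Open Scope classical_set_scope.

Definition null x := cnorm (x n) @[n --> \oo] --> (0 : R).
Definition cv x l := null (fun n => x n - l).

Lemma null_le x (f : nat -> R) :
  (forall n, cnorm (x n) <= f n) -> f n @[n --> \oo] --> (0 : R) -> null x.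
Proof.
move=> h f0; apply: (@squeeze_cvgr _ _ _ _ (fun=> 0) f) => //; last exact: cvg_cst.
by apply: nearW => n; rewrite cnorm_ge0 h.
Qed.

Lemma null_near x (e : R) : null x -> 0 < e -> \forall n \near \oo, cnorm (x n) < e.
Proof.
rewrite /null => /cvgrPdist_lt/(_ e) h /h; apply: filterS => n.
by rewrite sub0r normrN ger0_norm ?cnorm_ge0.
Qed.

Lemma null_lt x (e : R) : null x -> 0 < e -> exists N, forall n, (N <= n)%N -> cnorm (x n) < e.
Proof. by move=> h /(null_near h) [N _ hN]; exists N => n Nn; exact: hN. Qed.

Lemma nullD x y : null x -> null y -> null (fun n => x n + y n).
Proof.
move=> hx hy; apply: (@null_le _ (fun n => cnorm (x n) + cnorm (y n))).
  by move=> n; exact: cnormD.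
by rewrite -(addr0 0); exact: cvgD.
Qed.

Lemma nullN x : null x -> null (fun n => - x n).
Proof.
move=> h; apply: (@null_le _ (fun n => cnorm (x n))) => // n.
by rewrite cnormN.
Qed.

Lemma nullB x y : null x -> null y -> null (fun n => x n - y n).
Proof. by move=> hx hy; apply: nullD => //; exact: nullN. Qed.

Lemma null_star x : null x -> null (fun n => star (x n)).
Proof.
move=> h; apply: (@null_le _ (fun n => cnorm (x n))) => // n.
by rewrite cnorm_star.
Qed.

Lemma eq_null x y : x =1 y -> null x -> null y.
Proof. by move=> /funext ->. Qed.

Definition bounded x := exists r, forall n, cnorm (x n) <= r.

Lemma nullMl x y : bounded x -> null y -> null (fun n => x n * y n).
Proof.
move=> [r hr] hy; apply: (@null_le _ (fun n => r * cnorm (y n))).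
  by move=> n; exact: cnormM_le.
by rewrite -(mulr0 r); apply: cvgM => //; exact: cvg_cst.
Qed.

Lemma nullMr x y : null x -> bounded y -> null (fun n => x n * y n).
Proof.
move=> hx [r hr]; apply: (@null_le _ (fun n => cnorm (x n) * r)).
  by move=> n; exact: cnormM_le.
by rewrite -(mul0r r); apply: cvgM => //; exact: cvg_cst.
Qed.

Lemma null0 : null (fun=> 0).
Proof. by rewrite /null cnorm0; exact: cvg_cst. Qed.

Lemma null_sum (I : Type) (s : seq I) (P : pred I) (F : I -> nat -> A) :
  (forall i, P i -> null (F i)) -> null (fun n => \sum_(i <- s | P i) F i n).
Proof.
move=> h; elim: s => [|i s IH].
  by apply: eq_null null0 => n; rewrite big_nil.
case Pi: (P i); last by apply: eq_null IH => n; rewrite big_cons Pi.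
by apply: eq_null (nullD (h _ Pi) IH) => n; rewrite big_cons Pi.
Qed.

Lemma null_cst l : null (fun=> l) -> l = 0.
Proof.
by move=> h; apply: cnorm0_eq0; apply: (cvg_unique _ _ h) => //; exact: cvg_cst.
Qed.

Lemma bounded_cst l : bounded (fun=> l).
Proof. by exists (cnorm l). Qed.

Lemma boundedM x y : bounded x -> bounded y -> bounded (fun n => x n * y n).
Proof. by move=> [r hr] [s hs]; exists (r * s) => n; exact: cnormM_le. Qed.

Lemma cv_cst l : cv (fun=> l) l.
Proof. by rewrite /cv subrr; exact: null0. Qed.

Lemma cvD x y l l' : cv x l -> cv y l' -> cv (fun n => x n + y n) (l + l').
Proof. by move=> hx hy; apply: eq_null (nullD hx hy) => n; rewrite opprD addrACA. Qed.

Lemma cv_star x l : cv x l -> cv (fun n => star (x n)) (star l).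
Proof. by move=> hx; apply: eq_null (null_star hx) => n; rewrite starB. Qed.

Lemma cvM x y l l' : cv x l -> cv y l' -> cv (fun n => x n * y n) (l * l').
Proof.
move=> hx hy.
have e n : x n * y n - l * l' = (x n - l) * (y n - l') + (x n - l) * l' + l * (y n - l').
  alg.
suff h : null (fun n => (x n - l) * (y n - l')).
  apply: eq_null (nullD (nullD h (nullMr hx (bounded_cst l')))
                        (nullMl (bounded_cst l) hy)) => n; by rewrite e.
apply: (@null_le _ (fun n => cnorm (x n - l) * cnorm (y n - l'))) => [n|]; first exact: cnormM.
by rewrite -(mulr0 0); exact: cvgM.
Qed.

Lemma cvMl x l l' : cv x l -> cv (fun n => l' * x n) (l' * l).
Proof. by move=> h; apply: cvM => //; exact: cv_cst. Qed.

Lemma cvMr x l l' : cv x l -> cv (fun n => x n * l') (l * l').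
Proof. by move=> h; apply: cvM => //; exact: cv_cst. Qed.

Lemma cvZ (c : R[i]) x l : cv x l -> cv (fun n => c *: x n) (c *: l).
Proof.
move=> hx; apply: eq_null (nullMl (bounded_cst (c%:A)) hx) => n.
by rewrite -scalerAl mul1r scalerBr.
Qed.

Lemma cv_unique x l l' : cv x l -> cv x l' -> l = l'.
Proof.
move=> h h'; apply/eqP; rewrite -subr_eq0; apply/eqP; apply: null_cst.
by apply: eq_null (nullB h' h) => n; rewrite opprB addrC addrA subrK.
Qed.

Lemma eq_cv x y l : x =1 y -> cv x l -> cv y l.
Proof. by move=> /funext ->. Qed.

Lemma cv_norm_le x l r : (forall n, cnorm (x n) <= r) -> cv x l -> cnorm l <= r.
Proof.
move=> h hl; apply/ler_addgt0Pr => e e0.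
have [N /(_ N (leqnn N)) hN] := null_lt hl e0.
rewrite -[l](subKr (x N)); apply: le_trans (cnormB _ _) _.
by apply: lerD => //; exact: ltW.
Qed.

Lemma cv_eq0 x l : (forall e : R, 0 < e -> exists N, forall n, (N <= n)%N -> cnorm (x n - l) < e) -> cv x l.
Proof.
move=> h; rewrite /cv /null; apply/cvgrPdist_lt => e /h [N hN]; exists N => // n /= Nn.
by rewrite sub0r normrN ger0_norm ?cnorm_ge0 ?hN.
Qed.

Lemma cauchy_cv x (f : nat -> R) :
  (forall n m, (n <= m)%N -> cnorm (x m - x n) <= f n) ->
  f n @[n --> \oo] --> (0 : R) -> exists l, cv x l.
Proof.
move=> h f0; apply: cnorm_complete => e e0.
have [N _ hN] : \forall n \near \oo, `|0 - f n| < e / 2.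
  by move/cvgrPdist_lt: f0 => /(_ (e / 2)); apply; rewrite divr_gt0.
have fN : f N < e / 2.
  by have := hN N (leqnn N); rewrite /= sub0r normrN; apply: le_lt_trans; exact: ler_norm.
exists N => m n Nm Nn.
rewrite (_ : x m - x n = (x m - x N) - (x n - x N)); last by alg.
apply: le_lt_trans (cnormB _ _) _; rewrite [e]splitr.
by apply: ltrD; apply: le_lt_trans fN; exact: h.
Qed.

End Sequences.

(** * Positive elements *)

Section SquareRoot.
Variables (R : realType) (A : cstarAlgType R).
Implicit Types (x y z a b : A) (r s t : R).
Local Open Scope classical_set_scope.

Fixpoint majorant (n : nat) : R := if n is m.+1 then 2^-1 * (1 + majorant m ^+ 2) else 0.

Lemma majorant_bounds n : 0 <= majorant n <= 1 /\ majorant n <= majorant n.+1.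
Proof.
elim: n => [|n [/andP[h0 h1] h]] /=; first by split; nra.
by split; [apply/andP; split; nra|rewrite /= in h; nra].
Qed.

Fixpoint sqrt_iter x (n : nat) : A :=
  if n is m.+1 then (2^-1)%:C *: (x + sqrt_iter x m * sqrt_iter x m) else 0.

(* Visser iteration for [1 - sqrt (1 - x)], dominated by its scalar version at [x = 1]. *)
Lemma sqrt_iter_cv x : cnorm x <= 1 ->
  exists y, cv (sqrt_iter x) y /\ cnorm y <= 1.
Proof.
move=> x1; pose u := sqrt_iter x.
have uc z n : GRing.comm z x -> GRing.comm z (u n).
  move=> zx; elim: n => [|n IH] /=; first exact: commr0.
  rewrite /GRing.comm -scalerAl -scalerAr; congr (_ *: _).
  exact: commrD zx (commrM IH IH).
have uu n m : GRing.comm (u n) (u m) by apply/uc/commr_sym/uc.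
have uS n : u n.+1 = (2^-1)%:C *: (x + u n * u n) by [].
have un n : cnorm (u n) <= majorant n.
  have [/andP[_ _] _] := majorant_bounds n.
  elim: n => [|n IH] /=; first by rewrite cnorm0.
  rewrite cnormZr ger0_norm ?invr_ge0 // ler_pM2l ?invr_gt0 //.
  by apply: le_trans (cnormD _ _) _; rewrite lerD // expr2 cnormM_le.
have step n : cnorm (u n.+1 - u n) <= majorant n.+1 - majorant n.
  elim: n => [|n IH].
    by have := un 1; rewrite {3}/u /= !subr0.
  have -> : u n.+2 - u n.+1 = (2^-1)%:C *: ((u n.+1 - u n) * (u n.+1 + u n)).
    have -> : (u n.+1 - u n) * (u n.+1 + u n) = u n.+1 * u n.+1 - u n * u n.
      by rewrite mulrDr !mulrBl (uu n n.+1); alg.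
    rewrite (uS n.+1) [X in _ - X](uS n); alg.
  rewrite cnormZr ger0_norm ?invr_ge0 //.
  have e : majorant n.+2 - majorant n.+1 =
      2^-1 * ((majorant n.+1 - majorant n) * (majorant n.+1 + majorant n)) by rewrite /=; ring.
  rewrite e ler_pM2l ?invr_gt0 //; apply: cnormM_le => //.
  by apply: le_trans (cnormD _ _) _; exact: lerD.
have dist n k : cnorm (u (n + k)%N - u n) <= majorant (n + k) - majorant n.
  elim: k => [|k IH]; first by rewrite addn0 !subrr cnorm0.
  rewrite addnS (_ : _ - _ = (u (n + k).+1 - u (n + k)%N) + (u (n + k)%N - u n)); last by alg.
  apply: le_trans (cnormD _ _) _; apply: le_trans (lerD (step _) IH) _.
  by rewrite addrA subrK.
have mc : cvgn majorant.
  apply: nondecreasing_is_cvgn.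
    by apply/nondecreasing_seqP => n; case: (majorant_bounds n).
  by exists 1 => _ [n _ <-]; case: (majorant_bounds n) => /andP[].
have [] := @cauchy_cv _ _ u (fun n => limn majorant - majorant n).
- move=> n m nm; rewrite -(subnKC nm); apply: le_trans (dist _ _) _.
  rewrite lerD2r; apply: nondecreasing_cvgn_le => //.
  by apply/nondecreasing_seqP => k; case: (majorant_bounds k).
- by rewrite -(subrr (limn majorant)); apply: cvgB => //; exact: cvg_cst.
move=> y hy; exists y; split => //; apply: cv_norm_le hy => n.
by apply: le_trans (un n) _; case: (majorant_bounds n) => /andP[].
Qed.

(** The limit [y] of the iteration solves [2 y = x + y ^ 2], that is [(1 - y) ^ 2 = 1 - x].
    Commutation and self-adjointness hold for every iterate and pass to the limit. *)
Lemma sqrt_unit x : cnorm x <= 1 ->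
  exists y, [/\ cnorm y <= 1, (1 - y) * (1 - y) = 1 - x,
    forall z, GRing.comm z x -> GRing.comm z y & sa x -> sa y].
Proof.
move=> /sqrt_iter_cv [y [hy y1]].
have hy' : cv (fun n => sqrt_iter x n.+1) ((2^-1)%:C *: (x + y * y)).
  by apply: cvZ; apply: cvD; [exact: cv_cst|exact: cvM].
have hS : cv (fun n => sqrt_iter x n.+1) y.
  apply: cv_eq0 => e e0; have [N hN] := null_lt hy e0.
  by exists N => n Nn; apply: hN; exact: leqW.
have ey := cv_unique hS hy'.
exists y; split => //.
- transitivity (1 - y - y + y * y); first by alg.
  by rewrite {1 2}ey; alg; field.
- move=> z zx.
  have h n : z * sqrt_iter x n = sqrt_iter x n * z.
    elim: n => [|n IH] /=; first by rewrite mulr0 mul0r.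
    rewrite -scalerAl -scalerAr; congr (_ *: _).
    exact: commrD zx (commrM IH IH).
  by apply: cv_unique (cvMl z hy) _; apply: eq_cv (cvMr z hy) => n; rewrite h.
- move=> sx; apply: cv_unique (cv_star hy) _; apply: eq_cv hy => n.
  by elim: n => [|n IH] /=; rewrite ?star0 // starZr starD starM -IH sx.
Qed.

(** The triangle inequality closes this cone under sums, which is not visible for elements of the
    form [star b * b]. That the two notions agree is [positiveP]. *)
Definition pos a := sa a /\ exists2 t, 0 <= t & cnorm (t%:C *: 1 - a) <= t.

Lemma pos_sa a : pos a -> sa a. Proof. by case. Qed.

Lemma pos0 : pos 0.
Proof. by split; [exact: sa0|exists 0 => //; rewrite scale0r subr0 cnorm0]. Qed.

Lemma posD a b : pos a -> pos b -> pos (a + b).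
Proof.
move=> [sa_ [s s0 hs]] [sb [t t0 ht]]; split; first exact: saD.
exists (s + t); first exact: addr_ge0.
rewrite (_ : _ - _ = (s%:C *: 1 - a) + (t%:C *: 1 - b)); last by alg.
by apply: le_trans (cnormD _ _) _; exact: lerD.
Qed.

Lemma posZ r a : 0 <= r -> pos a -> pos (r%:C *: a).
Proof.
move=> r0 [sa_ [t t0 ht]]; split; first exact: saZ.
exists (r * t); first exact: mulr_ge0.
rewrite (_ : _ - _ = r%:C *: (t%:C *: 1 - a)); last by alg.
by rewrite cnormZr ger0_norm // ler_wpM2l.
Qed.

Lemma pos_scalar r : 0 <= r -> pos (r%:C *: 1).
Proof.
move=> r0; split; first exact/saZ/sa1.
by exists r => //; rewrite subrr cnorm0.
Qed.

Lemma pos1 : pos 1. Proof. by have := pos_scalar ler01; rewrite scale1r. Qed.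

Lemma pos_sum (I : Type) (s : seq I) (P : pred I) (F : I -> A) :
  (forall i, P i -> pos (F i)) -> pos (\sum_(i <- s | P i) F i).
Proof. by move=> h; elim/big_rec: _ => [|i x Pi]; [exact: pos0|apply/posD/h]. Qed.

Lemma pos_norm_sub r a : sa a -> cnorm a <= r -> pos (r%:C *: 1 - a).
Proof.
move=> sa_ h; have r0 : 0 <= r := le_trans (cnorm_ge0 _) h.
split; first by apply: saB => //; exact/saZ/sa1.
by exists r => //; rewrite opprB addrC subrK.
Qed.

(** With [t] from the definition of [pos], [x = 1 - a / t] lies in the unit ball, and
    [sqrt t * (1 - y)] is the root. The commutation clause stands in for functional calculus: it
    makes roots of commuting elements commute. *)
Lemma pos_sqrt_ex a : pos a ->
  exists b, [/\ pos b, b * b = a & forall z, GRing.comm z a -> GRing.comm z b].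
Proof.
move=> [sa_ [t t0 ht]].
have [t00|tn0] := eqVneq t 0.
  exists 0; split; [exact: pos0| |by move=> z _; exact: commr0].
  move: ht; rewrite t00 scale0r sub0r cnormN mul0r => h.
  by apply/esym/cnorm0_eq0/eqP; rewrite eq_le h cnorm_ge0.
have tp : 0 < t by rewrite lt_def tn0.
have tC : t%:C != 0 :> R[i] by rewrite (inj_eq (@complexI _)).
pose x : A := 1 - (t^-1)%:C *: a.
have [] := @sqrt_unit x.
  rewrite (_ : x = (t^-1)%:C *: (t%:C *: 1 - a)); last first.
    by rewrite /x scalerBr scalerA -rmorphM mulVf // scale1r.
  by rewrite cnormZr ger0_norm ?invr_ge0 // ler_pdivrMl // mulr1.
move=> y [y1 yx yc ys].
have sx : sa x by apply: saB; [exact: sa1|exact: saZ].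
exists ((Num.sqrt t)%:C *: (1 - y)); split.
- split; first by apply/saZ/saB; [exact: sa1|exact: ys].
  exists (Num.sqrt t); first exact: sqrtr_ge0.
  rewrite -scalerBr opprB addrC subrK cnormZr ger0_norm ?sqrtr_ge0 //.
  by rewrite ler_piMr ?sqrtr_ge0.
- rewrite -scalerAl -scalerAr scalerA -rmorphM -expr2 sqr_sqrtr // yx.
  by rewrite /x opprB addrC subrK scalerA -rmorphM mulfV // scale1r.
- move=> z za; rewrite /GRing.comm -scalerAl -scalerAr; congr (_ *: _).
  apply: commrB (commr1 _) (yc _ _); apply: commrB (commr1 _) _.
  by rewrite /GRing.comm -scalerAl -scalerAr za.
Qed.

Lemma scale_ii x : ('i * 'i) *: x = - x.
Proof. by rewrite (_ : 'i * 'i = -1) ?scaleN1r //; exact: sqr_i. Qed.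

(** The element [w = b + i c] satisfies [star w * w = r], so its norm is [sqrt r], and [b] is its
    real part. *)
Lemma sa_pair_norm r b c : sa b -> sa c -> GRing.comm b c ->
  b * b + c * c = r%:C *: 1 -> 0 <= r -> cnorm b ^+ 2 <= r.
Proof.
move=> sb sc bc bcr r0; pose w := b + 'i *: c.
have sw : star w = b - 'i *: c.
  rewrite starD starZ sb sc -scaleNr; congr (_ + _ *: _).
  by apply/eqP; rewrite eq_complex /= oppr0 !eqxx.
have ww : star w * w = r%:C *: 1.
  have -> : star w * w = b * b - ('i * 'i) *: (c * c) + 'i *: (b * c - c * b).
    by rewrite sw /w; alg.
  by rewrite scale_ii bc subrr scaler0 addr0 opprK.
have <- : cnorm w ^+ 2 = r by rewrite -cnorm_starM ww cnormZr cnorm1 mulr1 ger0_norm.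
rewrite ler_pXn2r ?nnegrE // (_ : b = (2^-1)%:C *: (w + star w)); last first.
  by rewrite sw /w; alg; field.
rewrite cnormZr ger0_norm ?invr_ge0 // ler_pdivrMl //.
by apply: le_trans (cnormD _ _) _; rewrite cnorm_star; lra.
Qed.

Lemma commZ1 r z : GRing.comm z (r%:C *: 1).
Proof. by rewrite /GRing.comm -scalerAl -scalerAr mulr1 mul1r. Qed.

(** Roots [b] of [a] and [c] of [r - a] commute and satisfy [b ^ 2 + c ^ 2 = r], which is the
    situation of [sa_pair_norm]. *)
Lemma pos_norm_le r a : 0 <= r -> pos a -> pos (r%:C *: 1 - a) -> cnorm a <= r.
Proof.
move=> r0 /pos_sqrt_ex [b [pb ba _]] /pos_sqrt_ex [c [pc ca cc]].
have bc : GRing.comm b c.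
  by apply: cc; apply: commrB; [exact: commZ1|rewrite -ba; exact: commrM].
rewrite -ba cnorm_sa_sq; last exact: pos_sa.
apply: (sa_pair_norm (pos_sa pb) (pos_sa pc) bc) => //.
by rewrite ba ca addrC subrK.
Qed.

Lemma pos_eq0 a : pos a -> pos (- a) -> a = 0.
Proof.
move=> ha hb; apply: cnorm0_eq0; apply/eqP; rewrite eq_le cnorm_ge0 andbT.
by apply: pos_norm_le => //; rewrite scale0r sub0r.
Qed.

Lemma pos_add_eq0 a b : pos a -> pos b -> a + b = 0 -> a = 0.
Proof. by move=> ha hb /eqP; rewrite addr_eq0 => /eqP e; apply: pos_eq0 => //; rewrite e opprK. Qed.

(** For a contraction [c], the root [d] of [1 - c ^ 2] gives [d ^ 2 + c ^ 2 = 1], hence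
    [1 - c ^ 2 = d ^ 2] has norm at most 1, which is positivity of [c ^ 2] with [t = 1]. The general
    case is a rescaling by [1 + cnorm b], which is never zero. *)
Lemma pos_sq b : sa b -> pos (b * b).
Proof.
move=> sb.
have h c : sa c -> cnorm c <= 1 -> pos (c * c).
  move=> sc c1.
  have c2 : cnorm (c * c) <= 1 by rewrite cnorm_sa_sq // expr_le1.
  have /pos_sqrt_ex [d [pd dd dc]] : pos (1 - c * c).
    by have := pos_norm_sub (sa_sq sc) c2; rewrite scale1r.
  split; first exact: sa_sq.
  exists 1 => //; rewrite scale1r -dd cnorm_sa_sq; last exact: pos_sa.
  apply: (sa_pair_norm (pos_sa pd) sc) => //; last by rewrite dd subrK scale1r.
  by apply/commr_sym/dc; apply: commrB; [exact: commr1|exact: commrM].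
pose r := 1 + cnorm b.
have r0 : 0 < r by rewrite ltr_pwDl.
have -> : b * b = (r ^+ 2)%:C *: (((r^-1)%:C *: b) * ((r^-1)%:C *: b)).
  rewrite -scalerAl -scalerAr !scalerA -!rmorphM.
  by rewrite -mulrA -expr2 -exprMn divff ?gt_eqF // expr1n scale1r.
apply: posZ; first by rewrite sqr_ge0.
apply: h; first exact: saZ.
have ri : 0 <= r^-1 by rewrite invr_ge0 ltW.
rewrite cnormZr ger0_norm // ler_pdivrMl // mulr1 /r.
by rewrite ler_wpDl.
Qed.

Lemma sa_sq_eq0 x : sa x -> x * x = 0 -> x = 0.
Proof.
move=> sx xx; apply: cnorm0_eq0; apply/eqP.
by rewrite -sqrf_eq0 -cnorm_sa_sq // xx cnorm0.
Qed.

Lemma star_mul_eq0 x : star x * x = 0 -> x = 0.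
Proof.
move=> xx; apply: cnorm0_eq0; apply/eqP.
by rewrite -sqrf_eq0 -cnorm_starM // xx cnorm0.
Qed.

Lemma comm_mulACA a b c d : GRing.comm b c -> a * b * (c * d) = (a * c) * (b * d).
Proof. by move=> bc; rewrite mulrA -(mulrA a) bc !mulrA. Qed.

Lemma posM a b : pos a -> pos b -> GRing.comm a b -> pos (a * b).
Proof.
move=> /pos_sqrt_ex [p [pp pa pc]] /pos_sqrt_ex [q [pq qb qc]] ab.
have pb : GRing.comm p q by apply/qc/commr_sym/pc/commr_sym.
rewrite -pa -qb -(comm_mulACA _ _ (commr_sym pb)); apply: pos_sq.
by apply: saM => //; exact: pos_sa.
Qed.

(** With [m = |a|] the candidates [p = (m + a) / 2] and [q = (m - a) / 2] have product zero, but
    their positivity is not clear. Comparing them with [p' = |p|] and [q' = |q|]: since [p' q' = 0],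
    both [m] and [p' + q'] are positive roots of [a ^ 2], hence equal. Then [p - p' = q' - q] has
    square zero. *)
Lemma pos_parts a : sa a -> exists p q, [/\ pos p, pos q, a = p - q, p * q = 0 &
  forall z, GRing.comm z a -> GRing.comm z p /\ GRing.comm z q].
Proof.
move=> sa_; have [m [pm mm mc]] := pos_sqrt_ex (pos_sq sa_).
have am : a * m = m * a by apply: mc; exact: commrM.
pose p := (2^-1)%:C *: (m + a); pose q := (2^-1)%:C *: (m - a).
have pqc z : GRing.comm z a -> GRing.comm z p /\ GRing.comm z q.
  move=> za; have zm : GRing.comm z m by apply: mc; exact: commrM.
  by rewrite /GRing.comm -!scalerAl -!scalerAr (commrD zm za) (commrB zm za).
have sm := pos_sa pm.
have sp : sa p by apply/saZ/saD.
have sq : sa q by apply/saZ/saB.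
have pq0 : p * q = 0.
  have -> : p * q = (4^-1)%:C *: ((m * m - a * a) + (a * m - m * a)).
    by rewrite /p /q; alg; field.
  by rewrite mm am !subrr addr0 scaler0.
have mpq : m = p + q by rewrite /p /q; alg; field.
have apq : a = p - q by rewrite /p /q; alg; field.
have ap : GRing.comm a p by case: (pqc a (commr_refl a)).
have pq : GRing.comm p q by case: (pqc p (commr_sym ap)).
have qp0 : q * p = 0 by rewrite -pq.
have [p' [pp' pp'p pc']] := pos_sqrt_ex (pos_sq sp).
have [q' [pq' qq'q qc']] := pos_sqrt_ex (pos_sq sq).
have p'p : GRing.comm p p' by apply: pc'; exact: commrM.
have q'q : GRing.comm q q' by apply: qc'; exact: commrM.
have pq'c : GRing.comm p q' by apply: qc'; exact: commrM.
have qp'c : GRing.comm q p' by apply: pc'; apply: commrM; exact: commr_sym.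
have p'q' : GRing.comm p' q' by apply: qc'; apply: commrM; exact: commr_sym.
have sp' := pos_sa pp'; have sq' := pos_sa pq'.
have zero x y : sa x -> sa y -> GRing.comm x y -> x * x * (y * y) = 0 -> x * y = 0.
  by move=> sx sy xy h; apply: sa_sq_eq0; [exact: saM|rewrite comm_mulACA // h].
have ppqq : p * p * (q * q) = 0 by rewrite -mulrA (mulrA p q) pq0 mul0r mulr0.
have p'q'0 : p' * q' = 0 by apply: zero => //; rewrite pp'p qq'q.
have pq'0 : p * q' = 0 by apply: zero => //; rewrite qq'q.
have p'q0 : p' * q = 0 by apply: zero => //; rewrite pp'p.
have q'p'0 : q' * p' = 0 by rewrite -p'q'.
have q'p0 : q' * p = 0 by rewrite -pq'c.
have qp'0 : q * p' = 0 by rewrite qp'c.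
(* Uniqueness of the positive root for commuting [m] and [n]: with [D = m - n], the positive
   elements [D ^ 2 m] and [D ^ 2 n] add up to zero, so both vanish and [D ^ 3 = 0]. *)
have msum : m = p' + q'.
  have mq : (p' + q') * (p' + q') = m * m.
    rewrite mpq !mulrDl !mulrDr pp'p qq'q p'q'0 q'p'0 pq0 qp0.
    by rewrite !addr0.
  have cm : GRing.comm m (p' + q').
    by rewrite mpq; apply/commr_sym/commrD; apply/commr_sym/commrD => //; exact: commr_sym.
  set n := p' + q' in mq cm *.
  have pn : pos n by exact: posD.
  have sd : sa (m - n) by apply: saB => //; exact: pos_sa.
  have d0 : (m - n) * (m + n) = 0 by rewrite mulrDr !mulrBl mq cm; alg.
  have cd : GRing.comm (m - n) (m - n) by [].
  have cdm : GRing.comm ((m - n) * (m - n)) m.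
    by apply/commr_sym/commrM; apply: commrB.
  have cdn : GRing.comm ((m - n) * (m - n)) n.
    by apply/commr_sym/commrM; apply: commrB => //; exact: commr_sym.
  have h : (m - n) * (m - n) * m + (m - n) * (m - n) * n = 0.
    by rewrite -mulrDr -mulrA d0 mulr0.
  have h1 := pos_add_eq0 (posM (pos_sq sd) pm cdm) (posM (pos_sq sd) pn cdn) h.
  have h2 : (m - n) * (m - n) * n = 0 by move: h; rewrite h1 add0r.
  have h3 : (m - n) * (m - n) * ((m - n) * (m - n)) = 0.
    by rewrite mulrA [X in X * _]mulrBr h1 h2 subrr mul0r.
  have /(sa_sq_eq0 sd)/eqP := sa_sq_eq0 (sa_sq sd) h3.
  by rewrite subr_eq0 => /eqP.
have e : p - p' = q' - q.
  transitivity (p + q - q - p'); first by alg.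
  by rewrite -mpq msum; alg.
have /eqP : p - p' = 0.
  apply: sa_sq_eq0; first exact: saB.
  by rewrite {2}e mulrBr !mulrBl pq'0 p'q'0 pq0 p'q0 !subrr.
rewrite subr_eq0 => /eqP pE.
have qE : q' = q by apply/eqP; rewrite -subr_eq0 -e pE subrr.
by exists p, q; split => //; rewrite ?pE // -qE.
Qed.

(* Kelley-Vaught: with [star x * x = p - q] the element [y = x * q] has
   [star y * y = - q ^+ 3], and then [y1 = y * q ^+ (3/2)] makes both [star y1 * y1] and
   [y1 * star y1] negative although their sum is positive. *)
Lemma pos_starM x : pos (star x * x).
Proof.
have sx : sa (star x * x) by rewrite /sa starM starK.
have [p [q [pp pq e pq0 comm_pq]]] := pos_parts sx.
have sq := pos_sa pq.
have qp0 : q * p = 0 by rewrite -[LHS]starK starM sq (pos_sa pp) pq0 star0.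
have pw : pos (q * (q * q)) by apply: posM => //; [exact: pos_sq|exact: commrM].
set w := q * (q * q) in pw.
have yy : star (x * q) * (x * q) = - w.
  have -> : star (x * q) * (x * q) = q * (star x * x) * q by rewrite starM sq !mulrA.
  by rewrite e mulrBr qp0 sub0r mulNr /w mulrA.
set y := x * q in yy.
have [v [pv vw vc]] := pos_sqrt_ex pw; have sv := pos_sa pv.
have vwc : v * w = w * v by rewrite -vw mulrA.
have y1y1 : star (y * v) * (y * v) = - (w * w).
  have -> : star (y * v) * (y * v) = v * (star y * y) * v by rewrite starM sv !mulrA.
  by rewrite yy mulrN mulNr vwc -mulrA vw.
have y1y1' : (y * v) * star (y * v) = - ((y * star y) * (y * star y)).
  have -> : y * v * star (y * v) = y * (v * v) * star y by rewrite starM sv !mulrA.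
  by rewrite vw -[w]opprK -yy mulrN mulNr !mulrA.
(* In terms of the real and imaginary parts [h] and [k] of [z], the sum is [2 (h ^ 2 + k ^ 2)]. *)
have sum z : pos (star z * z + z * star z).
  pose h := (2^-1)%:C *: (z + star z); pose k := (2^-1)%:C *: ('i *: (star z - z)).
  have sh : sa h by apply: saZ; rewrite /sa starD starK addrC.
  have sk : sa k.
    apply: saZ; rewrite /sa starZ starB starK -(opprB (star z)) scalerN -scaleNr.
    by congr (_ *: _); apply/eqP; rewrite eq_complex /= oppr0 opprK !eqxx.
  have -> : star z * z + z * star z = 2%:C *: (h * h + k * k).
    suff -> : k * k = - ((2^-1)%:C *: (star z - z)) * ((2^-1)%:C *: (star z - z)).
      by rewrite /h; alg; field.
    have -> : k * k = ('i * 'i) *: (((2^-1)%:C *: (star z - z)) * ((2^-1)%:C *: (star z - z))).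
      by rewrite /k; alg.
    by rewrite scale_ii mulNr.
  by apply: posZ => //; apply: posD; exact: pos_sq.
have syy : sa (y * star y) by rewrite /sa starM starK.
have sww := sa_sq (pos_sa pw).
have ww0 : w * w = 0.
  apply: pos_eq0; first exact/pos_sq/pos_sa.
  have -> : - (w * w) = (star (y * v) * (y * v) + (y * v) * star (y * v)) +
                        (y * star y) * (y * star y) by rewrite y1y1 y1y1' subrK.
  by apply: posD => //; exact: pos_sq.
have w0 := sa_sq_eq0 (pos_sa pw) ww0.
have q0 : q = 0.
  apply: sa_sq_eq0 => //; apply: sa_sq_eq0; first exact: sa_sq.
  by rewrite -mulrA -/w w0 mulr0.
by rewrite e q0 subr0.
Qed.

End SquareRoot.

(** * Order, inverses and intertwining *)

Section Order.
Variables (R : realType) (A : cstarAlgType R).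
Implicit Types (x y z a b p q : A) (r s t : R).
Local Open Scope classical_set_scope.

Lemma pos_starMr x : pos (x * star x).
Proof. by rewrite -{1}[x]starK; exact: pos_starM. Qed.

Lemma positiveP a : positive a <-> pos a.
Proof.
split=> [[b ->]|/pos_sqrt_ex [b [/pos_sa sb <- _]]]; first exact: pos_starM.
by exists b; rewrite sb.
Qed.

Lemma pos_conj a x : pos a -> pos (star x * a * x).
Proof.
move=> /pos_sqrt_ex [b [/pos_sa sb <- _]].
have -> : star x * (b * b) * x = star (b * x) * (b * x) by rewrite starM sb !mulrA.
exact: pos_starM.
Qed.

Lemma pos_conjr a x : pos a -> pos (x * a * star x).
Proof. by rewrite -{1}[x]starK; exact: pos_conj. Qed.

Lemma pos_conj_sa a x : sa x -> pos a -> pos (x * a * x).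
Proof. by move=> sx /(pos_conj x); rewrite sx. Qed.

Lemma pos_le_trans a b c : pos (b - a) -> pos (c - b) -> pos (c - a).
Proof. by move=> h1 h2; rewrite -[c](subrK b) -addrA; exact: posD. Qed.

Lemma pos_le_norm a b : pos a -> pos (b - a) -> cnorm a <= cnorm b.
Proof.
move=> pa pba; apply: pos_norm_le => //; apply: (pos_le_trans pba).
by apply: pos_norm_sub => //; rewrite -[b](subrK a); apply: saD; exact: pos_sa.
Qed.

Lemma sa_norm_le r x : sa x -> 0 <= r -> pos (r%:C *: 1 - x) -> pos (r%:C *: 1 + x) ->
  cnorm x <= r.
Proof.
move=> sx r0 h1 h2.
have h : pos ((r ^+ 2)%:C *: 1 - x * x).
  have -> : (r ^+ 2)%:C *: 1 - x * x = (r%:C *: 1 - x) * (r%:C *: 1 + x) by alg.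
  apply: posM => //; have c := commZ1 r x.
  by apply: commrD; apply/commr_sym/commrB.
have := pos_norm_le (sqr_ge0 r) (pos_sq sx) h.
by rewrite cnorm_sa_sq // ler_pXn2r // nnegrE.
Qed.

Lemma neumann x : cnorm (1 - x) < 1 -> exists y, x * y = 1 /\ y * x = 1.
Proof.
move=> v1; pose v := 1 - x; pose q := cnorm v.
have q0 : 0 <= q by exact: cnorm_ge0.
have q1 : 0 < 1 - q by rewrite subr_gt0.
pose S n := \sum_(i < n) v ^+ i.
have dist n k : cnorm (S (n + k)%N - S n) <= (q ^+ n - q ^+ (n + k)) / (1 - q).
  elim: k => [|k IH]; first by rewrite addn0 !subrr cnorm0 mul0r.
  rewrite addnS /S big_ord_recr /= -/(S _) addrAC; apply: le_trans (cnormD _ _) _.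
  apply: le_trans (lerD IH (cnormX _ _)) _.
  have -> : (q ^+ n - q ^+ (n + k).+1) / (1 - q) =
      (q ^+ n - q ^+ (n + k)) / (1 - q) + q ^+ (n + k).
    by rewrite exprS -[X in _ = _ + X](mulfK (lt0r_neq0 q1)) -mulrDl; congr (_ / _); ring.
  by [].
have [] := @cauchy_cv _ _ S (fun n => q ^+ n / (1 - q)).
- move=> n m nm; rewrite -(subnKC nm); apply: le_trans (dist _ _) _.
  by rewrite ler_pM2r ?invr_gt0 // gerBl exprn_ge0.
- rewrite -(mul0r (1 - q)^-1); apply: cvgM; last exact: cvg_cst.
  by apply: cvg_expr; rewrite ger0_norm.
move=> y hy; exists y.
have xE : x = 1 - v by rewrite /v opprB addrC subrK.
have SE n : S n.+1 = 1 + v * S n.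
  rewrite /S big_ord_recl expr0 mulr_sumr; congr (_ + _).
  by apply: eq_bigr => i _; rewrite exprS.
have SE' n : S n.+1 = 1 + S n * v.
  rewrite /S big_ord_recl expr0 mulr_suml; congr (_ + _).
  by apply: eq_bigr => i _; rewrite exprSr.
have hS : cv (fun n => S n.+1) y.
  apply: cv_eq0 => e e0; have [N hN] := null_lt hy e0.
  by exists N => n Nn; apply: hN; exact: leqW.
have e1 : y = 1 + v * y.
  apply: cv_unique hS _; apply: eq_cv (cvD (cv_cst 1) (cvMl v hy)) => n.
  by rewrite SE.
have e2 : y = 1 + y * v.
  apply: cv_unique hS _; apply: eq_cv (cvD (cv_cst 1) (cvMr v hy)) => n.
  by rewrite SE'.
by rewrite xE mulrBl mulrBr mul1r mulr1 {1}e1 addrK {1}e2 addrK.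
Qed.

Lemma comm_inv x y z : x * y = 1 -> y * x = 1 -> GRing.comm z x -> GRing.comm z y.
Proof.
move=> xy yx zx; rewrite /GRing.comm -[z * y]mul1r -yx -mulrA (mulrA x) -zx.
by rewrite -(mulrA z) xy mulr1.
Qed.

(** If [t] witnesses positivity of [a], then [(a + s) / (s + t)] has distance at most
    [t / (s + t) < 1] from 1. The last clause holds because [1 - s j = a j]. *)
Lemma pos_inv a s : pos a -> 0 < s -> exists j, [/\ pos j,
  j * (a + s%:C *: 1) = 1, (a + s%:C *: 1) * j = 1,
  forall z, GRing.comm z a -> GRing.comm z j & pos (1 - s%:C *: j)].
Proof.
move=> pa s0; have [sa_ [t t0 ht]] := pa.
pose b := a + s%:C *: 1; have st : 0 < s + t by rewrite ltr_pwDl.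
have stC : (s + t)%:C != 0 :> R[i] by rewrite (inj_eq (@complexI _)) gt_eqF.
have [] := @neumann (((s + t)^-1)%:C *: b).
  have -> : 1 - ((s + t)^-1)%:C *: b = ((s + t)^-1)%:C *: (t%:C *: 1 - a).
    have {1}-> : 1 = ((s + t)^-1)%:C *: ((s + t)%:C *: 1) :> A.
      by rewrite scalerA -rmorphM mulVf ?scale1r // gt_eqF.
    by rewrite /b; alg.
  rewrite cnormZr ger0_norm ?invr_ge0 ?(ltW st) // ltr_pdivrMl // mulr1.
  by apply: le_lt_trans ht _; rewrite ltrDr.
move=> y [by1 yb1]; pose j := ((s + t)^-1)%:C *: y.
have bj : b * j = 1 by rewrite -by1 /j; alg.
have jb : j * b = 1 by rewrite -yb1 /j; alg.
have sb : sa b by apply: saD => //; exact/saZ/sa1.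
have sj : sa j.
  rewrite /sa -[star j]mulr1 -bj mulrA -{1}sb -starM.
  by rewrite bj star1 mul1r.
have pb : pos b by apply: posD => //; exact/pos_scalar/ltW.
have pj : pos j by rewrite -[j]mul1r -jb -{2}sj; exact: pos_conjr.
have jc z : GRing.comm z a -> GRing.comm z j.
  by move=> za; apply: comm_inv bj jb _; apply: commrD => //; exact: commZ1.
exists j; split => //.
have -> : 1 - s%:C *: j = a * j by rewrite -bj /b; alg.
by apply: posM => //; exact: jc.
Qed.

(** No polynomial approximation of the root is used. The difference [z = x p - q x] satisfies
    [z p = - q z], so for [w = star z * z] the element [w p = - star z * q * z] is negative. Being
    self-adjoint, it makes [w] and [p] commute, so it is also positive, hence zero. Thus
    [z p = q z = 0], and expanding [star z] in [w * w] gives zero. *)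
Lemma sqrt_intertwine x p q : pos p -> pos q -> x * (p * p) = q * q * x -> x * p = q * x.
Proof.
move=> pp pq e; have sp := pos_sa pp; have sq := pos_sa pq.
pose z := x * p - q * x.
have zpq : z * p = - (q * z).
  apply/eqP; rewrite -subr_eq0 opprK; apply/eqP.
  have -> : z * p + q * z = x * (p * p) - q * q * x by rewrite /z; alg.
  by rewrite e subrr.
pose w := star z * z.
have wp : w * p = - (star z * q * z) by rewrite /w -mulrA zpq mulrN !mulrA.
have swp : sa (w * p) by rewrite wp; apply/saN/pos_sa/pos_conj.
have pw : pos w by exact: pos_starM.
have cwp : GRing.comm w p by rewrite /GRing.comm -{1}swp starM sp (pos_sa pw).
have wp0 : w * p = 0.
  apply: pos_eq0; first exact: posM.
  by rewrite wp opprK; exact: pos_conj.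
have zp0 : z * p = 0.
  apply: star_mul_eq0.
  have -> : star (z * p) * (z * p) = p * (w * p) by rewrite starM sp /w !mulrA.
  by rewrite wp0 mulr0.
have qz0 : q * z = 0 by apply/eqP; rewrite -oppr_eq0 -zpq zp0.
have sz : star z = p * star x - star x * q by rewrite starB !starM sp sq.
have ww : w * w = 0.
  have -> : w * w = star z * ((z * p) * star x - z * star x * q) * z.
    by rewrite /w {2}sz; alg.
  by rewrite zp0 mul0r sub0r mulrN mulNr mulrA -(mulrA _ q) qz0 mulr0 oppr0.
have /star_mul_eq0/eqP := sa_sq_eq0 (pos_sa pw) ww.
by rewrite subr_eq0 => /eqP.
Qed.

Lemma pos_mul0C a b : pos a -> pos b -> a * b = 0 -> b * a = 0.
Proof. by move=> /pos_sa sc /pos_sa sd cd; rewrite -[LHS]starK starM sc sd cd star0. Qed.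

(** The sum of the two parts of [a] is a positive root of [a ^ 2], so [sqrt_intertwine] applies to
    the sums; half sums and differences give the parts. *)
Lemma parts_intertwine x a b p q p' q' : pos p -> pos q -> p * q = 0 -> a = p - q ->
  pos p' -> pos q' -> p' * q' = 0 -> b = p' - q' -> x * a = b * x ->
  x * p = p' * x /\ x * q = q' * x.
Proof.
move=> pp pq pq0 ea pp' pq' pq0' eb e.
have sq (c d : A) : pos c -> pos d -> c * d = 0 -> (c + d) * (c + d) = (c - d) * (c - d).
  move=> pc pd cd.
  have -> : (c + d) * (c + d) = (c - d) * (c - d) + 2%:C *: (c * d + d * c) by alg.
  by rewrite cd (pos_mul0C pc pd cd) addr0 scaler0 addr0.
have h : x * (p + q) = (p' + q') * x.
  apply: sqrt_intertwine; [exact: posD|exact: posD|].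
  by rewrite (sq p q) // (sq p' q') // -ea -eb mulrA e -mulrA e mulrA.
have two : 2%:C != 0 :> R[i] by rewrite (inj_eq (@complexI _)) pnatr_eq0.
split; apply: (scalerI two).
- have -> : 2%:C *: (x * p) = x * (p + q) + x * (p - q) by alg.
  by rewrite h -ea e eb; alg.
- have -> : 2%:C *: (x * q) = x * (p + q) - x * (p - q) by alg.
  by rewrite h -ea e eb; alg.
Qed.

(** A high power of [t] replaces a spectral projection near the top of the spectrum: it has norm one
    and [t] acts on it almost as 1. *)
Lemma pos_peak (t : A) (e : R) : pos t -> cnorm t = 1 -> 0 < e -> exists g,
  [/\ pos g, cnorm g = 1, GRing.comm g t, cnorm (g * (1 - t)) <= e &
   forall x, t * x = 0 -> g * x = 0].
Proof.
move=> pt t1 e0; have st := pos_sa pt.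
have p1t : pos (1 - t) by have := @pos_norm_sub _ _ 1 t st; rewrite t1 scale1r; apply.
have ptk k : pos (t ^+ k).
  elim: k => [|k IH]; first by rewrite expr0; exact: pos1.
  by rewrite exprS; apply: posM => //; exact: commrX.
have c1 k : GRing.comm (t ^+ k) (1 - t).
  by apply: commrB; [exact: commr1|apply/commr_sym/commrX].
have ptk1 k : pos (1 - t ^+ k).
  elim: k => [|k IH]; first by rewrite expr0 subrr; exact: pos0.
  have -> : 1 - t ^+ k.+1 = (1 - t ^+ k) + t ^+ k * (1 - t).
    by rewrite exprSr; alg.
  by apply: posD => //; exact: posM.
(* For [n <= k], [1 - t ^ n] is the sum of the [t ^ i (1 - t)] with [i < n], each of which dominates
   [t ^ k (1 - t)]. Hence [k t ^ k (1 - t) <= 1]. *)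
have main k : pos (1 - k%:R%:C *: (t ^+ k * (1 - t))).
  have h n : (n <= k)%N ->
    pos (1 - t ^+ n - n%:R%:C *: (t ^+ k * (1 - t))).
    elim: n => [|n IH] nk; first by rewrite expr0 scale0r !subrr; exact: pos0.
    have -> : 1 - t ^+ n.+1 - n.+1%:R%:C *: (t ^+ k * (1 - t)) =
       (1 - t ^+ n - n%:R%:C *: (t ^+ k * (1 - t))) + (t ^+ n * (1 - t ^+ (k - n))) * (1 - t).
      have -> : t ^+ k = t ^+ n * t ^+ (k - n) by rewrite -exprD subnKC // ltnW.
      have -> : n.+1%:R%:C = n%:R%:C + 1 :> R[i] by rewrite -addn1 natrD rmorphD.
      by rewrite exprSr; alg.
    apply: posD; first exact/IH/ltnW.
    apply: posM => //; first by apply: posM => //; apply: commrB; [exact: commr1|exact/commrX/commr_sym/commrX].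
    apply/commr_sym/commrM; first exact/commr_sym/c1.
    by apply: commrB; [exact: commr1|exact/commr_sym/c1].
  have -> : 1 - k%:R%:C *: (t ^+ k * (1 - t)) =
    (1 - t ^+ k - k%:R%:C *: (t ^+ k * (1 - t))) + t ^+ k by alg.
  exact: posD (h k (leqnn k)) (ptk k).
have [k hk] : exists k, e^-1 <= (2 ^ k)%:R.
  exists (Num.truncn e^-1).+1; apply/ltW/(lt_le_trans (truncnS_gt _)).
  by rewrite ler_nat ltnW // ltn_expl.
exists (t ^+ (2 ^ k)); split => //.
- by rewrite cnorm_sa_exp2 // t1 expr1n.
- exact/commr_sym/commrX.
- have k0 : (0 : R) < (2 ^ k)%:R by rewrite ltr0n expn_gt0.
  have := pos_norm_le ler01 (posZ (ltW k0) (posM (ptk (2 ^ k)%N) p1t (c1 _))).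
  rewrite scale1r => /(_ (main _)); rewrite cnormZr gtr0_norm // -ler_pdivlMl // mulr1.
  by move=> h; apply: le_trans h _; rewrite -[e]invrK lef_pV2 ?posrE ?invr_gt0.
- move=> x tx; have -> : (2 ^ k = (2 ^ k).-1.+1)%N by rewrite prednK ?expn_gt0.
  by rewrite exprSr -mulrA tx mulr0.
Qed.

End Order.

(** * Square roots and polar decomposition under perturbation *)

Section Perturbation.
Variables (R : realType) (A : cstarAlgType R).
Implicit Types (x y z a b p q : A) (r s t : R).
Local Open Scope classical_set_scope.

Lemma le_sqrt_sqr s t : 0 <= s -> s ^+ 2 <= t -> s <= Num.sqrt t.
Proof. by move=> s0 st; rewrite -[s]ger0_norm // -sqrtr_sqr; exact: ler_wsqrtr. Qed.

(** Both signs of [p - r] are treated by [half]. For [t = (a - b)_+] of norm [l], the peak element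
    [g] of [t / l] gives [g (a - b) ~ l g]. Symmetrising [(a - b) (a + b)] then shows
    [g (a ^ 2 - b ^ 2) g ~ l g (a + b) g], and this dominates [l g (a - b) g ~ l ^ 2 g ^ 2], whose
    norm is [l ^ 2]. *)
Lemma sqrt_holder p (r : A) : pos p -> pos r -> cnorm (p - r) ^+ 2 <= cnorm (p * p - r * r).
Proof.
move=> pp pr; set Q := cnorm (p * p - r * r).
have half (a b t t' : A) : pos a -> pos b -> pos t -> pos t' -> t * t' = 0 -> a - b = t - t' ->
    cnorm t ^+ 2 <= cnorm (a * a - b * b).
  move=> pa pb pt pt' tt' e.
  have [->|t0] := eqVneq t 0; first by rewrite cnorm0 expr2 mul0r.
  set l := cnorm t; have l0 : 0 < l by rewrite cnorm_gt0.
  pose t1 := (l^-1)%:C *: t.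
  have pt1 : pos t1 by apply: posZ => //; rewrite invr_ge0 ltW.
  have nt1 : cnorm t1 = 1 by rewrite cnormZr ger0_norm ?invr_ge0 ?ltW // mulVf ?gt_eqF.
  have tE : t = l%:C *: t1 by rewrite scalerA -rmorphM mulfV ?gt_eqF // scale1r.
  (* The errors made with a peak of precision [e0 / c] add up to [e0 / c * (c - 1)]. *)
  pose c := 1 + l ^+ 2 + l * cnorm (a + b).
  have c0 : 0 < c by rewrite !ltr_pwDl ?mulr_ge0 ?sqr_ge0 ?(ltW l0).
  apply/ler_addgt0Pr => e0 e00.
  have ec : 0 < e0 / c by rewrite divr_gt0.
  have [g [pg g1 gt1 gd gt']] := pos_peak pt1 nt1 ec.
  set d := g * (1 - t1) in gd.
  have sg := pos_sa pg.
  have gt'0 : g * t' = 0 by apply: gt'; rewrite -scalerAl tt' scaler0.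
  have t'g0 : t' * g = 0 by exact: pos_mul0C gt'0.
  have gw : g * (a - b) = l%:C *: (g - d) by rewrite e mulrBr gt'0 tE /d; alg.
  have wg : (a - b) * g = l%:C *: (g - d).
    by rewrite e mulrBl t'g0 tE /d -scalerAl -gt1; alg.
  have nP : l * cnorm (g * (a + b) * g) <= cnorm (a * a - b * b) + l * (e0 / c * cnorm (a + b)).
    have -> : l * cnorm (g * (a + b) * g) = cnorm (l%:C *: (g * (a + b) * g)).
      by rewrite cnormZr gtr0_norm.
    have -> : l%:C *: (g * (a + b) * g) = g * (a * a - b * b) * g +
        (2^-1)%:C *: (l%:C *: (d * (a + b) * g) + l%:C *: (g * (a + b) * d)).
      have -> : g * (a * a - b * b) * g = (2^-1)%:C *:
         (g * (a - b) * (a + b) * g + g * (a + b) * ((a - b) * g)) by alg; field.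
      by rewrite gw wg; alg; field.
    apply: le_trans (cnormD _ _) _; apply: lerD.
      by rewrite -[leRHS]mul1r -[leRHS]mulr1; apply: cnormM_le; rewrite ?g1 //; apply: cnormM_le; rewrite ?g1.
    rewrite cnormZr ger0_norm ?invr_ge0 // ler_pdivrMl //.
    apply: le_trans (cnormD _ _) _; rewrite !cnormZr ger0_norm ?(ltW l0) // mulr_natl.
    rewrite mulr2n; apply: lerD; rewrite ler_pM2l //.
      by rewrite -[leRHS]mulr1; apply: cnormM_le; rewrite ?g1 //; apply: cnormM_le.
    by rewrite mulrC; apply: cnormM_le => //; rewrite -[leRHS]mul1r; apply: cnormM_le; rewrite ?g1.
  have nw : l * (1 - e0 / c) <= cnorm (g * (a + b) * g).
    apply: (@le_trans _ _ (cnorm (g * (a - b) * g))); last first.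
      apply: pos_le_norm.
        by rewrite e mulrBr gt'0 subr0; exact: pos_conj_sa.
      have -> : g * (a + b) * g - g * (a - b) * g = 2%:C *: (g * b * g) by alg.
      by apply: posZ => //; exact: pos_conj_sa.
    rewrite gw -scalerAl cnormZr ger0_norm ?(ltW l0) // ler_pM2l //.
    have -> : 1 = cnorm (g * g) by rewrite cnorm_sa_sq // g1 expr1n.
    rewrite lerBlDr; have -> : g * g = (g - d) * g + d * g by alg.
    apply: le_trans (cnormD _ _) _; rewrite lerD2l -[leRHS]mulr1.
    by apply: cnormM_le; rewrite ?g1.
  have := le_trans (ler_wpM2l (ltW l0) nw) nP.
  have -> : l * (l * (1 - e0 / c)) = l ^+ 2 - e0 / c * l ^+ 2 by ring.
  rewrite lerBlDr => h; apply: le_trans h _; rewrite -addrA lerD2l.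
  have -> : l * (e0 / c * cnorm (a + b)) + e0 / c * l ^+ 2 = e0 / c * (c - 1) by rewrite /c; ring.
  by rewrite -[leRHS](divfK (lt0r_neq0 c0)) ler_pM2l // gerDl oppr_le0.
have [t [t' [pt pt' e tt' _]]] := pos_parts (saB (pos_sa pp) (pos_sa pr)).
have Q0 : 0 <= Q by exact: cnorm_ge0.
have h1 : cnorm t <= Num.sqrt Q.
  apply: le_sqrt_sqr => //; exact: (half p r t t').
have h2 : cnorm t' <= Num.sqrt Q.
  apply: le_sqrt_sqr => //; rewrite /Q cnormBC.
  by apply: (half r p t' t) => //; [exact: pos_mul0C|rewrite -opprB e opprB].
rewrite -[leRHS]sqr_sqrtr // ler_pXn2r ?nnegrE ?sqrtr_ge0 //.
apply: sa_norm_le; rewrite ?sqrtr_ge0 //.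
- by apply: saB; exact: pos_sa.
- have -> : (Num.sqrt Q)%:C *: 1 - (p - r) = ((Num.sqrt Q)%:C *: 1 - t) + t' by rewrite e; alg.
  by apply: posD => //; apply: pos_norm_sub => //; exact: pos_sa.
- have -> : (Num.sqrt Q)%:C *: 1 + (p - r) = ((Num.sqrt Q)%:C *: 1 - t') + t by rewrite e; alg.
  by apply: posD => //; apply: pos_norm_sub => //; exact: pos_sa.
Qed.

Lemma cvg_sqrt_harmonic : Num.sqrt (n.+1%:R^-1 : R) @[n --> \oo] --> (0 : R).
Proof.
rewrite -(sqrtr0 R); apply: continuous_cvg; first exact: sqrt_continuous.
exact: cvg_harmonic.
Qed.

(* The polar decomposition of [x * e], where [e ^+ 2 = q (q + s)^-1], turns the approximate
   relation [star x * x ~ d] into the exact one [star y * y = q]. *)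
Lemma perturb x d q q' s : 0 < s -> sa d -> cnorm (star x * x - d) <= s ->
  pos q -> pos q' -> q * q' = 0 -> d - (2 * s)%:C *: 1 = q - q' ->
  exists T y, [/\ cv (fun n => x * T n) y, star y * y = q &
    pos d -> cnorm (x - y) <= Num.sqrt (2 * s) + Num.sqrt (3 * s)].
Proof.
move=> s0 sd hs pq pq' qq' dq; have s0' := ltW s0.
have q'q := pos_mul0C pq pq' qq'.
have sq := pos_sa pq.
have dE : d = q - q' + (2 * s)%:C *: 1 by rewrite -dq subrK.
have qd : GRing.comm q d.
  rewrite dE; apply: commrD; last exact: commZ1.
  by apply: commrB => //; rewrite /GRing.comm qq' q'q.
have [j [pj j1 j2 jc psj]] := pos_inv pq s0.
have qj : GRing.comm q j by exact: jc.
have pqj : pos (q * j) by exact: posM.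
have qjE : q * j = 1 - s%:C *: j by rewrite -j2; alg.
have [e [pe ee ec]] := pos_sqrt_ex pqj; have se := pos_sa pe.
have de : GRing.comm d e.
  by apply: ec; apply: commrM; [exact/commr_sym|exact/jc/commr_sym].
have e1 : cnorm e <= 1.
  rewrite -(@ler_pXn2r _ 2) ?nnegrE // expr1n -cnorm_sa_sq // ee.
  apply: pos_norm_le => //; rewrite scale1r qjE opprB addrC subrK.
  exact: posZ.
have p1e : pos (1 - e) by have := pos_norm_sub se e1; rewrite scale1r.
(* On the support of [q] the element [d - s] is [q + s], which [e] on both sides turns into [q]. The
   cut by [2 * s] serves this: as [star x * x >= d - s], the compression [K] dominates [q]. *)
have ede : e * (d - s%:C *: 1) * e = q.
  have -> : e * (d - s%:C *: 1) * e = e * e * (d - s%:C *: 1) - e * (e * d - d * e) by alg.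
  rewrite -de subrr mulr0 subr0 ee.
  have -> : q * j * (d - s%:C *: 1) = q * (j * (q + s%:C *: 1)) - q * j * q'.
    by rewrite dE; alg.
  by rewrite j1 mulr1 qj -mulrA qq' mulr0 subr0.
pose H := star x * x; pose K := e * H * e.
have pH : pos H by exact: pos_starM.
have sH := pos_sa pH.
have pK : pos K by exact: pos_conj_sa.
have pKq : pos (K - q).
  have -> : K - q = e * (s%:C *: 1 - (d - H)) * e by rewrite -ede /K; alg.
  by apply: pos_conj_sa => //; apply: pos_norm_sub; [exact: saB|rewrite cnormBC].
have nKq : cnorm (K - q) <= 2 * s.
  have -> : K - q = e * (H - d) * e + s%:C *: (e * e) by rewrite -ede /K; alg.
  apply: le_trans (cnormD _ _) _; rewrite mulr_natl mulr2n; apply: lerD.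
    by rewrite -[leRHS]mul1r -[leRHS]mulr1; apply: cnormM_le => //; exact: cnormM_le.
  by rewrite cnormZr ger0_norm // ler_piMr // -(mulr1 1); exact: cnormM_le.
have [z [pz zz zc]] := pos_sqrt_ex pq; have sz := pos_sa pz.
have [k [pk kk kc]] := pos_sqrt_ex pK; have sk := pos_sa pk.
have xe w : cnorm (x * e * w) = cnorm (k * w).
  apply/eqP; rewrite -(@eqrXn2 _ 2) // -!cnorm_starM !starM sk se.
  by apply/eqP; congr cnorm; rewrite !mulrA -(mulrA _ k k) kk /K /H !mulrA.
(* With [F n = (K + sn n)^(-1/2)], the elements [x * e * F n] imitate the partial isometry of
   [x * e]. They need not converge, but their products with [z = q^(1/2)] do, because [q <= K]. *)
pose sn n : R := n.+1%:R^-1.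
have sn0 n : 0 < sn n by rewrite invr_gt0.
have [J hJ] := choice (fun n => pos_inv pK (sn0 n)).
have [F hF] := choice (fun n => let: And5 h _ _ _ _ := hJ n in pos_sqrt_ex h).
pose t n := k * F n.
(* The first norm equals that of [F n * q * F n], which is below [F n * K * F n = t n ^ 2 <= 1]. The
   second follows from [(1 - t) ^ 2 <= 1 - t ^ 2 = sn n * J n]. *)
have JFK n : cnorm (z * J n * z) <= 1 /\ cnorm ((1 - t n) * z) <= Num.sqrt (sn n).
  have [pJ J1 J2 Jc pJs] := hJ n; have [pF FF Fc] := hF n; have sF := pos_sa pF.
  have kF : GRing.comm k (F n) by apply/Fc/Jc/commr_sym/kc.
  have pt : pos (t n) by exact: posM.
  have JK : J n * K = 1 - (sn n)%:C *: J n by rewrite -J1; alg.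
  have tt : t n * t n = 1 - (sn n)%:C *: J n.
    rewrite /t (comm_mulACA _ _ (commr_sym kF)) FF kk -JK.
    exact: (Jc K).
  have t1 : cnorm (t n) <= 1.
    rewrite -(@ler_pXn2r _ 2) ?nnegrE // expr1n -cnorm_sa_sq; last exact: pos_sa.
    rewrite tt; apply: pos_norm_le => //.
    by rewrite scale1r opprB addrC subrK; apply/posZ/pJ/ltW.
  have p1t : pos (1 - t n) by have := pos_norm_sub (pos_sa pt) t1; rewrite scale1r.
  have nFz : cnorm (z * J n * z) <= 1.
    have -> : z * J n * z = star (F n * z) * (F n * z) by rewrite starM sF sz -FF !mulrA.
    rewrite cnorm_starM -cnorm_starMr starM sF sz mulrA -(mulrA (F n)) zz.
    apply: (@le_trans _ _ (cnorm (F n * K * F n))).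
      apply: pos_le_norm; first exact: pos_conj_sa.
      have -> : F n * K * F n - F n * q * F n = F n * (K - q) * F n by alg.
      exact: pos_conj_sa.
    have -> : F n * K * F n = t n * t n.
      by rewrite /t {1}kF -kk !mulrA.
    by rewrite -(mulr1 1); exact: cnormM_le.
  split=> //; apply: le_sqrt_sqr => //; rewrite -cnorm_starM starM starB star1.
  rewrite (pos_sa pt) sz.
  apply: (@le_trans _ _ (cnorm (z * ((sn n)%:C *: J n) * z))); last first.
    rewrite -scalerAr -scalerAl cnormZr gtr0_norm // -[leRHS]mulr1.
    by rewrite ler_pM2l.
  apply: pos_le_norm.
    have -> : z * (1 - t n) * ((1 - t n) * z) = z * ((1 - t n) * (1 - t n)) * z by rewrite !mulrA.
    by apply: pos_conj_sa => //; exact/pos_sq/pos_sa.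
  have -> : z * ((sn n)%:C *: J n) * z - z * (1 - t n) * ((1 - t n) * z) =
      z * (2%:C *: (t n * (1 - t n))) * z.
    have -> : (sn n)%:C *: J n = 1 - t n * t n by rewrite tt opprB addrC subrK.
    alg.
  apply: pos_conj_sa => //; apply: posZ => //; apply: posM => //.
  by apply: commrB => //; exact: commr1.
have Dn n := (JFK n).2; have nFz n := (JFK n).1.
pose T n := e * F n * z; pose Y n := x * T n.
have YE n w : cnorm (x * e * w - Y n) = cnorm (k * w - t n * z).
  have -> : x * e * w - Y n = x * e * (w - F n * z) by rewrite /Y /T; alg.
  by rewrite xe; congr cnorm; rewrite /t; alg.
have snm n m : (n <= m)%N -> Num.sqrt (sn m) <= Num.sqrt (sn n).
  by move=> nm; rewrite ler_wsqrtr // lef_pV2 ?posrE // ler_nat.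
have [] := @cauchy_cv _ _ Y (fun n => 2 * Num.sqrt (sn n)).
- move=> n m nm; rewrite cnormBC.
  have -> : Y n = x * e * (F n * z) by rewrite /Y /T !mulrA.
  rewrite YE; have -> : k * (F n * z) - t m * z = (1 - t m) * z - (1 - t n) * z.
    by rewrite /t; alg.
  apply: le_trans (cnormB _ _) _; rewrite mulr_natl mulr2n.
  by apply: lerD => //; apply: le_trans (Dn m) _; exact: snm.
- by rewrite -(mulr0 2); apply: cvgM; [exact: cvg_cst|exact: cvg_sqrt_harmonic].
move=> y hy; exists T, y; split => //.
- apply: cv_unique (cvM (cv_star hy) hy) _; apply: (@null_le _ _ _ sn).
    move=> n; have [pJ J1 J2 Jc pJs] := hJ n; have [pF FF Fc] := hF n; have sF := pos_sa pF.
    have kF : GRing.comm k (F n) by apply/Fc/Jc/commr_sym/kc.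
    have JK : J n * K = 1 - (sn n)%:C *: J n by rewrite -J1; alg.
    have KF : K * F n = F n * K by exact/Fc/Jc.
    have YY : star (Y n) * Y n = z * (J n * K) * z.
      have -> : star (Y n) * Y n = z * (F n * (K * F n)) * z.
        by rewrite /Y /T !starM sF sz se /K /H !mulrA.
      by rewrite KF (mulrA (F n)) FF.
    have -> : star (Y n) * Y n - q = - ((sn n)%:C *: (z * J n * z)).
      by rewrite YY JK -zz; alg.
    rewrite cnormN cnormZr gtr0_norm // -[leRHS]mulr1 ler_pM2l //.
  exact: cvg_harmonic.
- move=> pd; apply/ler_addgt0Pr => r r0.
  have r20 : 0 < r / 2 by rewrite divr_gt0.
  have [N1 h1] := null_lt hy r20.
  have [N2 _ h2] : \forall n \near \oo, `|0 - Num.sqrt (sn n)| < r / 2.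
    by have /cvgrPdist_lt/(_ (r / 2)) := cvg_sqrt_harmonic; apply.
  pose n := maxn N1 N2.
  have {}h1 := h1 n (leq_maxl _ _).
  have {}h2 : Num.sqrt (sn n) < r / 2.
    have := h2 n (leq_maxr _ _); rewrite /= sub0r normrN ger0_norm ?sqrtr_ge0 //.
  have h3 : cnorm (x - x * e) <= Num.sqrt (3 * s).
    apply: le_sqrt_sqr => //; rewrite -cnorm_starM.
    have -> : star (x - x * e) * (x - x * e) =
        (1 - e) * (H - d) * (1 - e) + (1 - e) * d * (1 - e).
      by rewrite starB starM se /H; alg.
    have n1e : cnorm (1 - e) <= 1.
      by apply: pos_norm_le => //; rewrite scale1r opprB addrC subrK.
    have -> : 3 * s = s + 2 * s by ring.
    apply: le_trans (cnormD _ _) _; apply: lerD.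
      by rewrite -[leRHS]mul1r -[leRHS]mulr1; apply: cnormM_le => //; exact: cnormM_le.
    apply: pos_norm_le; [by rewrite mulr_ge0|exact/pos_conj_sa/pd/pos_sa|].
    (* From [e ^ 2 d = q + s e ^ 2]. The three terms on the right are positive, the last one because
       [d] is. *)
    have -> : (2 * s)%:C *: 1 - (1 - e) * d * (1 - e) =
        q' + s%:C *: (e * e) + 2%:C *: (e * (1 - e) * d).
      have -> : (1 - e) * d * (1 - e) = d - e * d - e * d + e * e * d.
        have -> : (1 - e) * d * (1 - e) = d - e * d - d * e + e * (d * e) by alg.
        by rewrite de mulrA.
      have eed : e * e * d = q + s%:C *: (e * e).
        have -> : q + s%:C *: (e * e) = e * (d * e) by rewrite -ede; alg.
        by rewrite de mulrA.
      have -> : 2%:C *: (e * (1 - e) * d) = 2%:C *: (e * d) - 2%:C *: (e * e * d) by alg.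
      by rewrite eed dE; alg.
    apply: posD; first by apply: posD => //; apply: posZ => //; exact: pos_sq.
    apply: posZ => //; apply: posM => //.
      by apply: posM => //; apply: commrB => //; exact: commr1.
    by apply/commr_sym/commrM => //; apply: commrB => //; exact: commr1.
  have h4 : cnorm (x * e - Y n) <= Num.sqrt (2 * s) + r / 2.
    have := YE n 1; rewrite !mulr1 => ->.
    have -> : k - t n * z = (k - z) + (1 - t n) * z by alg.
    apply: le_trans (cnormD _ _) _; apply: lerD.
      apply: le_sqrt_sqr => //; apply: le_trans (sqrt_holder pk pz) _.
      by rewrite kk zz.
    exact: le_trans (Dn n) (ltW h2).
  have -> : x - y = (x - x * e) + (x * e - Y n) + (Y n - y) by alg.
  apply: le_trans (cnormD _ _) _; rewrite [r]splitr [leRHS]addrA.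
  apply: lerD; last exact: ltW h1.
  apply: le_trans (cnormD _ _) _; rewrite [X in _ <= X + _]addrC -[leRHS]addrA.
  exact: lerD.
Qed.

End Perturbation.

(** * Star homomorphisms and Cuntz subequivalence *)

Section StarHom.
Variables (R : realType) (A B : cstarAlgType R) (f : {lrmorphism A -> B}).

(* Unlike the results of [rmorphB], [rmorphM] and [linearP], those of the next three lemmas
   contain [f] itself and not a coercion of it, so [alg] identifies its values. *)
Lemma homB a b : f (a - b) = f a - f b.
Proof. exact: rmorphB. Qed.

Lemma homM a b : f (a * b) = f a * f b.
Proof. exact: rmorphM. Qed.

Lemma hom_linear (c : R[i]) a b : f (c *: a + b) = c *: f a + f b.
Proof. exact: linearP. Qed.

Hypothesis fs : star_hom f.

Lemma hom_scalar (c : R[i]) : f (c *: 1) = c *: 1.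
Proof. by rewrite linearZ /= rmorph1. Qed.

Lemma hom_sa x : sa x -> sa (f x).
Proof. by rewrite /sa -fs => ->. Qed.

Lemma hom_pos x : pos x -> pos (f x).
Proof.
by move=> /positiveP [y ->]; apply/positiveP; exists (f y); rewrite rmorphM /= fs.
Qed.

Lemma hom_norm x : cnorm (f x) <= cnorm x.
Proof.
rewrite -(@ler_pXn2r _ 2) ?nnegrE // -!cnorm_starM -fs -rmorphM.
set y := star x * x; have py : pos y by exact: pos_starM.
apply: pos_norm_le => //; first exact: hom_pos.
by rewrite -hom_scalar -rmorphB; apply/hom_pos/pos_norm_sub => //; exact: pos_sa.
Qed.

Lemma hom_null (x : nat -> A) : null x -> null (fun n => f (x n)).
Proof. by move=> h; apply: null_le h => n; exact: hom_norm. Qed.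

Lemma hom_cv (x : nat -> A) l : cv x l -> cv (fun n => f (x n)) (f l).
Proof. by move=> h; apply: eq_null (hom_null h) => n; rewrite rmorphB. Qed.

End StarHom.

Section SimpleInjective.
Variables (R : realType) (A B : cstarAlgType R) (f : {lrmorphism A -> B}).

Lemma simple_hom_inj : simple_cstar A -> star_hom f -> injective f.
Proof.
move=> sA fs; pose I := [set x | f x = 0]%classic.
have : I = [set 0]%classic \/ I = setT.
  apply: sA => /=.
  - move=> x l Ix xl; apply: cv_unique (hom_cv fs xl) _.
    by apply: eq_cv (cv_cst 0) => n; rewrite Ix.
  - exact: rmorph0.
  - by rewrite /I => x y /= hx hy; rewrite rmorphD /= hx hy addr0.
  - by rewrite /I => a x /= hx; rewrite !rmorphM /= hx mulr0 mul0r.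
move=> [I0|IT].
  move=> x y /eqP; rewrite -subr_eq0 -rmorphB => /eqP h.
  by have : I (x - y) by []; rewrite I0 => /eqP; rewrite subr_eq0 => /eqP.
have : I 1 by rewrite IT.
by move=> /eqP; rewrite /= rmorph1 oner_eq0.
Qed.

End SimpleInjective.

Section Cuntz.
Variables (R : realType) (A : cstarAlgType R).
Implicit Types (a b c d q x : A).
Local Open Scope classical_set_scope.

Lemma cuntzP a b : cuntz_sub a b <->
  forall e : R, 0 < e -> exists x, cnorm (a - x * b * star x) < e.
Proof.
split=> [[x hx] e e0|h].
  by have [N hN] := null_lt hx e0; exists (x N); exact: hN.
have n0 n : (0 : R) < n.+1%:R^-1 by rewrite invr_gt0.
have [x hx] := choice (fun n => h _ (n0 n)).
exists x; apply: (@null_le _ _ (fun n => a - x n * b * star (x n)) (fun n => n.+1%:R^-1)) => [n|].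
  exact/ltW/hx.
exact: cvg_harmonic.
Qed.

Lemma cuntz_trans b a c : cuntz_sub a b -> cuntz_sub b c -> cuntz_sub a c.
Proof.
move=> /cuntzP ab /cuntzP bc; apply/cuntzP => e e0.
have e2 : 0 < e / 2 by rewrite divr_gt0.
have [x hx] := ab _ e2; pose r := 1 + cnorm x * cnorm x.
have r0 : 0 < r by rewrite ltr_pwDl // mulr_ge0.
have [y hy] := bc _ (divr_gt0 e2 r0); exists (x * y).
have -> : a - x * y * c * star (x * y) =
    (a - x * b * star x) + x * (b - y * c * star y) * star x by rewrite starM; alg.
apply: le_lt_trans (cnormD _ _) _; rewrite [e]splitr; apply: ltr_leD => //.
apply: (@le_trans _ _ (cnorm x * cnorm (b - y * c * star y) * cnorm x)).
  by apply: cnormM_le; [exact: cnormM|rewrite cnorm_star].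
rewrite mulrAC; apply: (@le_trans _ _ (r * (e / 2 / r))); last by rewrite mulrC divfK ?gt_eqF.
by apply: ler_pM; [exact: mulr_ge0|by []|rewrite /r ler_wpDl|exact: ltW].
Qed.

Lemma cuntz_conj x a : cuntz_sub (x * a * star x) a.
Proof. by apply/cuntzP => e e0; exists x; rewrite subrr cnorm0. Qed.

(** Rordam's lemma with a doubled cut: for [x] the root of [a] in [perturb], [q] is the limit of
    [star (T n) * a * T n]. *)
Lemma cuntz_perturb a d q q' (s : R) : 0 < s -> pos a -> sa d -> cnorm (a - d) <= s ->
  pos q -> pos q' -> q * q' = 0 -> d - (2 * s)%:C *: 1 = q - q' -> cuntz_sub q a.
Proof.
move=> s0 pa sd; have [x [px <- _]] := pos_sqrt_ex pa.
rewrite -{1}(pos_sa px) => ad pq pq' qq' dq.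
have [T [y [Ty <- _]]] := perturb s0 sd ad pq pq' qq' dq.
exists (fun n => star (T n)).
apply: eq_null (nullN (cvM (cv_star Ty) Ty)) => n.
by rewrite starK starM (pos_sa px) opprB !mulrA.
Qed.

End Cuntz.

(** * Matrices over a C*-algebra *)

Section HilbertModule.
Variables (R : realType) (A : cstarAlgType R) (n : nat).
Implicit Types (v w : 'cV[A]_n) (X Y : 'M[A]_n) (a b : A) (c : R[i]) (r s t : R).

(** The standard Hilbert module over [A]. The operator norm of matrices on it is a C*-norm, obtained
    without representing [A] on a Hilbert space, and this makes [perturb] available for matrices. *)
Definition ip v w : A := \sum_i star (v i 0) * w i 0.

Definition vnorm v : R := Num.sqrt (cnorm (ip v v)).

Definition vscale c v := map_mx ( *:%R c) v.

Lemma vnorm_ge0 v : 0 <= vnorm v. Proof. exact: sqrtr_ge0. Qed.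
Hint Resolve vnorm_ge0 : core.

Lemma vnorm_sq v : vnorm v ^+ 2 = cnorm (ip v v). Proof. by rewrite sqr_sqrtr. Qed.

Lemma ip_pos v : pos (ip v v).
Proof. by apply: pos_sum => i _; exact: pos_starM. Qed.

Lemma star_ip v w : star (ip v w) = ip w v.
Proof. by rewrite star_sum; apply: eq_bigr => i _; rewrite starM starK. Qed.

Lemma ipDr v w w' : ip v (w + w') = ip v w + ip v w'.
Proof. by rewrite -big_split; apply: eq_bigr => i _; rewrite mxE mulrDr. Qed.

Lemma ipDl v w w' : ip (w + w') v = ip w v + ip w' v.
Proof. by rewrite -big_split; apply: eq_bigr => i _; rewrite mxE starD mulrDl. Qed.

(** For [s] above the norm of [ip v v] and [z = v c - s w], adding the positive element
    [star c * (s - ip v v) * c] to [ip z z] leaves [s ^ 2 ip w w - s (star c * c)]. The strict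
    inequality permits division by [s]; then [s] tends to that norm. *)
Lemma cauchy_schwarz v w : cnorm (ip v w) <= vnorm v * vnorm w.
Proof.
rewrite -(@ler_pXn2r _ 2) ?nnegrE ?mulr_ge0 // exprMn !vnorm_sq.
set t := cnorm (ip v v); set u := cnorm (ip w w); set c := ip v w.
have main s : t < s -> cnorm c ^+ 2 <= s * u.
  move=> ts; have s0 : 0 < s by apply: le_lt_trans ts; exact: cnorm_ge0.
  pose z := \col_i (v i 0 * c - s%:C *: w i 0).
  have zz : ip z z = star c * ip v v * c - (2 * s)%:C *: (star c * c) + (s ^+ 2)%:C *: ip w w.
    have e : ip z z = \sum_i (star c * (star (v i 0) * v i 0) * c
        - s%:C *: (star c * (star (v i 0) * w i 0)) - s%:C *: ((star (w i 0) * v i 0) * c)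
        + (s ^+ 2)%:C *: (star (w i 0) * w i 0)).
      by apply: eq_bigr => i _; rewrite mxE starB starM starZr; alg.
    rewrite e !big_split /= !sumrN -!mulr_suml -!scaler_sumr -mulr_suml -!mulr_sumr.
    by rewrite -!/(ip _ _) -(star_ip v w) -/c; alg.
  have h : pos (s%:C *: ip w w - star c * c).
    have -> : s%:C *: ip w w - star c * c = (s^-1)%:C *:
        (ip z z + star c * (s%:C *: 1 - ip v v) * c).
      rewrite zz; have -> : (s ^+ 2)%:C = s%:C * s%:C :> R[i] by rewrite -rmorphM.
      have ss : (s^-1)%:C * s%:C = 1 :> R[i] by rewrite -rmorphM mulVf // gt_eqF.
      transitivity (((s^-1)%:C * s%:C * s%:C) *: ip w w - ((s^-1)%:C * s%:C) *: (star c * c)).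
        by rewrite ss mul1r scale1r.
      alg.
    apply: posZ; first by rewrite invr_ge0 ltW.
    apply: posD; first exact: ip_pos.
    by apply: pos_conj; apply: pos_norm_sub; [exact/pos_sa/ip_pos|exact: ltW].
  rewrite -cnorm_starM; apply: le_trans (pos_le_norm (pos_starM c) h) _.
  by rewrite cnormZr gtr0_norm.
apply/ler_addgt0Pr => e e0; have u0 : 0 <= u by exact: cnorm_ge0.
have u1 : 0 < 1 + u by rewrite ltr_pwDl.
have /main h : t < t + e / (1 + u) by rewrite ltrDl divr_gt0.
apply: le_trans h _; rewrite mulrDl lerD2l mulrAC ler_pdivrMr // ler_pM2l //.
by rewrite lerDr.
Qed.

Lemma vnormD v w : vnorm (v + w) <= vnorm v + vnorm w.
Proof.
rewrite -(@ler_pXn2r _ 2) ?nnegrE ?addr_ge0 // vnorm_sq ipDr !ipDl.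
apply: le_trans (cnormD _ _) _.
have h1 := cnormD (ip v v) (ip w v); have h2 := cnormD (ip v w) (ip w w).
have := cauchy_schwarz v w; have := cauchy_schwarz w v.
rewrite -!vnorm_sq in h1 h2 *; nra.
Qed.

Lemma entry_le_vnorm v i : cnorm (v i 0) <= vnorm v.
Proof.
rewrite -(@ler_pXn2r _ 2) ?nnegrE // vnorm_sq -cnorm_starM /ip (bigD1 i) //=.
apply: pos_le_norm; first exact: pos_starM.
by rewrite addrAC subrr add0r; apply: pos_sum => j _; exact: pos_starM.
Qed.

Lemma vnorm_le_sum v : vnorm v <= \sum_i cnorm (v i 0).
Proof.
have s0 (P : pred 'I_n) : 0 <= \sum_(i | P i) cnorm (v i 0) by exact: sumr_ge0.
rewrite -(@ler_pXn2r _ 2) ?nnegrE // vnorm_sq.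
apply: le_trans (cnorm_sum _ _ _) _; rewrite expr2 mulr_suml ler_sum // => i _.
rewrite cnorm_starM expr2 ler_wpM2l // (bigD1 i) //= lerDl; exact: s0.
Qed.

Lemma normc_conj c : Normc.normc (Num.conj c * c) = Normc.normc c ^+ 2.
Proof. by rewrite Normc.normcM expr2; congr (_ * _); case: c => a b; rewrite /= sqrrN. Qed.

Lemma normc_ge0 c : 0 <= Normc.normc c.
Proof. by case: c => a b; exact: sqrtr_ge0. Qed.

Lemma vnormZ c v : vnorm (vscale c v) = Normc.normc c * vnorm v.
Proof.
rewrite /vnorm; have -> : ip (vscale c v) (vscale c v) = (Num.conj c * c) *: ip v v.
  rewrite /ip scaler_sumr; apply: eq_bigr => i _.
  by rewrite !mxE starZ -scalerAl -scalerAr scalerA.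
by rewrite cnormZ normc_conj sqrtrM ?sqr_ge0 // sqrtr_sqr ger0_norm ?normc_ge0.
Qed.

Lemma mulmx_vscale X c v : X *m vscale c v = vscale c (X *m v).
Proof.
apply/matrixP => i j; rewrite !mxE scaler_sumr; apply: eq_bigr => k _.
by rewrite !mxE scalerAr.
Qed.

Lemma ip_mulmx X v w : ip v (X *m w) = ip (mxstar X *m v) w.
Proof.
rewrite /ip.
transitivity (\sum_i \sum_j star (v i 0) * X i j * w j 0).
  by apply: eq_bigr => i _; rewrite mxE mulr_sumr; apply: eq_bigr => j _; rewrite mulrA.
rewrite exchange_big; apply: eq_bigr => j _ /=.
rewrite mxE star_sum mulr_suml; apply: eq_bigr => i _.
by rewrite !mxE starM starK.
Qed.

Definition mxsum X : R := \sum_i \sum_j cnorm (X i j).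

Lemma vnorm_mulmx_sum X v : vnorm (X *m v) <= mxsum X * vnorm v.
Proof.
apply: le_trans (vnorm_le_sum _) _; rewrite /mxsum mulr_suml ler_sum // => i _.
rewrite mxE mulr_suml; apply: le_trans (cnorm_sum _ _ _) _; rewrite ler_sum // => j _.
by apply: cnormM_le => //; exact: entry_le_vnorm.
Qed.

Definition mxnorm X : R := sup [set vnorm (X *m v) | v in [set v | vnorm v <= 1]]%classic.

Lemma vnorm0 : vnorm 0 = 0.
Proof.
rewrite /vnorm /ip big1 ?cnorm0 ?sqrtr0 // => i _.
by rewrite mxE mulr0.
Qed.

Lemma mxsum_ge0 X : 0 <= mxsum X.
Proof. by apply: sumr_ge0 => i _; exact: sumr_ge0. Qed.

Lemma mxnorm_sup X v : vnorm v <= 1 -> vnorm (X *m v) <= mxnorm X.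
Proof.
move=> v1; apply: ub_le_sup; last by exists v.
exists (mxsum X) => _ [w /= w1 <-]; apply: le_trans (vnorm_mulmx_sum _ _) _.
by rewrite -[leRHS]mulr1 ler_wpM2l // mxsum_ge0.
Qed.

Lemma mxnorm_le X r : (forall v, vnorm v <= 1 -> vnorm (X *m v) <= r) -> mxnorm X <= r.
Proof.
move=> h; apply: ge_sup => [|_ [v /= v1 <-]]; last exact: h.
by exists (vnorm (X *m 0)), 0 => //=; rewrite vnorm0 ler01.
Qed.

Lemma mxnorm_ge0 X : 0 <= mxnorm X.
Proof. by apply: le_trans (mxnorm_sup X (v := 0) _); rewrite // vnorm0. Qed.
Hint Resolve mxnorm_ge0 : core.

Lemma vnorm_mulmx X v : vnorm (X *m v) <= mxnorm X * vnorm v.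
Proof.
have [v0|v0] := eqVneq (vnorm v) 0.
  by have := vnorm_mulmx_sum X v; rewrite v0 !mulr0.
have vp : 0 < vnorm v by rewrite lt_def v0 vnorm_ge0.
have := @mxnorm_sup X (vscale ((vnorm v)^-1)%:C v).
rewrite mulmx_vscale !vnormZ normcR ger0_norm ?invr_ge0 // mulVf // => /(_ (lexx _)).
by rewrite ler_pdivrMl // mulrC.
Qed.

Lemma mxnorm_le_mul X r : 0 <= r -> (forall v, vnorm (X *m v) <= r * vnorm v) -> mxnorm X <= r.
Proof.
move=> r0 h; apply: mxnorm_le => v v1; apply: le_trans (h v) _.
by rewrite -[leRHS]mulr1 ler_wpM2l.
Qed.

Lemma mxnorm_le_sum X : mxnorm X <= mxsum X.
Proof. by apply: mxnorm_le_mul; [exact: mxsum_ge0|exact: vnorm_mulmx_sum]. Qed.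

Lemma entry_le_mxnorm X i j : cnorm (X i j) <= mxnorm X.
Proof.
pose v : 'cV[A]_n := delta_mx j 0.
have v1 : vnorm v <= 1.
  apply: le_trans (vnorm_le_sum _) _; rewrite (bigD1 j) //= big1 => [|k kj].
    by rewrite mxE !eqxx cnorm1 addr0.
  by rewrite mxE (negbTE kj) cnorm0.
apply: le_trans (mxnorm_sup X v1); apply: le_trans (entry_le_vnorm _ i).
rewrite mxE (bigD1 j) //= big1 => [|k kj]; first by rewrite mxE !eqxx mulr1 addr0.
by rewrite mxE (negbTE kj) mulr0.
Qed.

Lemma mxnormD X Y : mxnorm (X + Y) <= mxnorm X + mxnorm Y.
Proof.
apply: mxnorm_le => v v1; rewrite mulmxDl; apply: le_trans (vnormD _ _) _.
by apply: lerD; exact: mxnorm_sup.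
Qed.

Lemma mxnormM X Y : mxnorm (X *m Y) <= mxnorm X * mxnorm Y.
Proof.
apply: mxnorm_le => v v1; rewrite -mulmxA; apply: le_trans (vnorm_mulmx _ _) _.
by rewrite ler_wpM2l // mxnorm_sup.
Qed.

Lemma mxnorm_star_le X : mxnorm (mxstar X) <= mxnorm X.
Proof.
apply: mxnorm_le_mul => // v.
have [->|v0] := eqVneq (vnorm (mxstar X *m v)) 0; first by rewrite mulr_ge0.
rewrite -(ler_pM2r (_ : 0 < vnorm (mxstar X *m v))); last by rewrite lt_def v0 vnorm_ge0.
rewrite -expr2 vnorm_sq -ip_mulmx; apply: le_trans (cauchy_schwarz _ _) _.
rewrite [mxnorm X * _]mulrC -mulrA ler_wpM2l //; exact: vnorm_mulmx.
Qed.

Lemma mxnorm_starM X : mxnorm (mxstar X *m X) = mxnorm X ^+ 2.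
Proof.
apply/eqP; rewrite eq_le; apply/andP; split.
  apply: le_trans (mxnormM _ _) _; rewrite expr2 ler_wpM2r //; exact: mxnorm_star_le.
have s0 : 0 <= Num.sqrt (mxnorm (mxstar X *m X)) by exact: sqrtr_ge0.
rewrite -[leRHS]sqr_sqrtr // ler_pXn2r ?nnegrE //; apply: mxnorm_le => v v1.
apply: le_sqrt_sqr => //; rewrite vnorm_sq ip_mulmx mulmxA.
apply: le_trans (cauchy_schwarz _ _) _.
rewrite -[leRHS]mulr1; apply: ler_pM => //; exact: mxnorm_sup.
Qed.

End HilbertModule.

(** A separate name, because ['M[A]_k.+1] already carries a scaling by elements of [A], and here the
    scalars are complex. *)
Definition cmx (R : realType) (A : cstarAlgType R) (k : nat) : Type := 'M[A]_k.+1.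

Section MatrixAlgebra.
Variables (R : realType) (A : cstarAlgType R) (k : nat).
Implicit Types (X Y : 'M[A]_k.+1) (c : R[i]).

HB.instance Definition _ := GRing.NzRing.copy (cmx A k) 'M[A]_k.+1.

Definition cmx_scale c (X : cmx A k) : cmx A k := map_mx ( *:%R c) X.

Let scaleA a b (X : cmx A k) : cmx_scale a (cmx_scale b X) = cmx_scale (a * b) X.
Proof. by apply/matrixP => i j; rewrite !mxE scalerA. Qed.
Let scale1 : left_id 1 cmx_scale.
Proof. by move=> X; apply/matrixP => i j; rewrite !mxE scale1r. Qed.
Let scaleDr : right_distributive cmx_scale +%R.
Proof. by move=> c X Y; apply/matrixP => i j; rewrite !mxE scalerDr. Qed.
Let scaleDl (X : cmx A k) : {morph cmx_scale^~ X : a b / a + b}.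
Proof. by move=> a b; apply/matrixP => i j; rewrite !mxE scalerDl. Qed.

HB.instance Definition _ :=
  GRing.Zmodule_isLmodule.Build R[i] (cmx A k) scaleA scale1 scaleDr scaleDl.

Let scaleAl c (X Y : cmx A k) : c *: (X * Y) = c *: X * Y.
Proof.
apply/matrixP => i j; rewrite !mxE scaler_sumr; apply: eq_bigr => l _.
by rewrite !mxE scalerAl.
Qed.
Let scaleAr c (X Y : cmx A k) : c *: (X * Y) = X * (c *: Y).
Proof.
apply/matrixP => i j; rewrite !mxE scaler_sumr; apply: eq_bigr => l _.
by rewrite !mxE scalerAr.
Qed.

HB.instance Definition _ := GRing.Lmodule_isLalgebra.Build R[i] (cmx A k) scaleAl.
HB.instance Definition _ := GRing.Lalgebra_isAlgebra.Build R[i] (cmx A k) scaleAr.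

Let cmx_star (X : cmx A k) : cmx A k := mxstar X.
Let cmx_starK : involutive cmx_star.
Proof. by move=> X; apply/matrixP => i j; rewrite !mxE starK. Qed.
Let cmx_starD : {morph cmx_star : x y / x + y}.
Proof. by move=> X Y; apply/matrixP => i j; rewrite !mxE starD. Qed.
Let cmx_starZ c (X : cmx A k) : cmx_star (c *: X) = Num.conj c *: cmx_star X.
Proof. by apply/matrixP => i j; rewrite !mxE starZ. Qed.
Let cmx_starM (X Y : cmx A k) : cmx_star (X * Y) = cmx_star Y * cmx_star X.
Proof.
apply/matrixP => i j; rewrite !mxE star_sum; apply: eq_bigr => l _.
by rewrite !mxE starM.
Qed.

HB.instance Definition _ := isStarAlgebra.Build R (cmx A k)
  cmx_starK cmx_starD cmx_starZ cmx_starM.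

Let cmx_norm (X : cmx A k) : R := mxnorm X.
Let cmx_norm0_eq0 X : cmx_norm X = 0 -> X = 0.
Proof.
move=> X0; apply/matrixP => i j; rewrite mxE; apply: cnorm0_eq0; apply/eqP.
by rewrite eq_le cnorm_ge0 andbT -X0 entry_le_mxnorm.
Qed.
Let cmx_normD (X Y : cmx A k) : cmx_norm (X + Y) <= cmx_norm X + cmx_norm Y.
Proof. exact: mxnormD. Qed.
Let cmx_normZ c (X : cmx A k) : cmx_norm (c *: X) = Normc.normc c * cmx_norm X.
Proof.
have h d (Y : cmx A k) : cmx_norm (d *: Y) <= Normc.normc d * cmx_norm Y.
  apply: mxnorm_le_mul => [|v]; first by rewrite mulr_ge0 ?normc_ge0 ?mxnorm_ge0.
  have -> : (d *: Y : cmx A k) *m v = vscale d (Y *m v).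
    by rewrite -mulmx_vscale; apply/matrixP => i j; rewrite !mxE;
       apply: eq_bigr => l _; rewrite !mxE -scalerAl -scalerAr.
  by rewrite vnormZ -mulrA ler_wpM2l ?normc_ge0 // vnorm_mulmx.
apply/eqP; rewrite eq_le h /=.
have [->|c0] := eqVneq c 0; first by rewrite Normc.normc0 mul0r; exact: mxnorm_ge0.
have n0 : 0 < Normc.normc c.
  by rewrite lt_def normc_ge0 andbT; apply: contra_neq c0; exact: Normc.eq0_normc.
rewrite -ler_pdivlMl // -Normc.normcV; apply: le_trans (h _ _).
by rewrite scalerA mulVf // scale1r.
Qed.
Let cmx_normM (X Y : cmx A k) : cmx_norm (X * Y) <= cmx_norm X * cmx_norm Y.
Proof. exact: mxnormM. Qed.
Let cmx_norm_starM (X : cmx A k) : cmx_norm (star X * X) = cmx_norm X ^+ 2.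
Proof. exact: mxnorm_starM. Qed.
Let cmx_complete (x : nat -> cmx A k) :
  (forall eps : R, 0 < eps -> exists N, forall m n,
     (N <= m)%N -> (N <= n)%N -> cmx_norm (x m - x n) < eps) ->
  exists l, (cmx_norm (x n - l) @[n --> \oo] --> (0 : R))%classic.
Proof.
move=> hx.
have h i j : exists l, cv (fun n => x n i j) l.
  apply: cnorm_complete => e /hx [N hN]; exists N => m n Nm Nn.
  apply: le_lt_trans (hN m n Nm Nn).
  by have := entry_le_mxnorm (x m - x n) i j; rewrite !mxE.
have h' i : exists l : 'I_k.+1 -> A, forall j, cv (fun n => x n i j) (l j).
  by have [l hl] := choice (h i); exists l.
have [l hl] := choice h'.
exists (\matrix_(i, j) l i j).
apply: (@squeeze_cvgr _ _ _ _ (fun=> 0) (fun n => \sum_i \sum_j cnorm (x n i j - l i j))).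
- apply: nearW => n; rewrite mxnorm_ge0; apply: le_trans (mxnorm_le_sum _) _.
  by apply: ler_sum => i _; apply: ler_sum => j _; rewrite !mxE.
- exact: cvg_cst.
- have e : 0 = \sum_(i < k.+1) \sum_(j < k.+1) 0 :> R by rewrite big1 // => i _; rewrite big1.
  rewrite [X in (_ --> X)%classic]e.
  apply: cvg_big => [|i _]; first exact: add_continuous.
  by apply: cvg_big => [|j _]; [exact: add_continuous|exact: hl].
Qed.

HB.instance Definition _ := isCstarAlgebra.Build R (cmx A k)
  cmx_norm0_eq0 cmx_normD cmx_normZ cmx_normM cmx_norm_starM cmx_complete.

End MatrixAlgebra.

Section ComplexCstar.
Variable R : realType.
Implicit Types (x y : R[i]^o).

(** With the complex numbers as a C*-algebra, [opnorm] becomes the norm of an instance of [cmx], and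
    the facts about star homomorphisms cover scalar matrices and complex-valued homomorphisms. *)
Let cnormC x : R := Normc.normc x.
Let cnormC_eq0 x : cnormC x = 0 -> x = 0. Proof. exact: Normc.eq0_normc. Qed.
Let cnormCD x y : cnormC (x + y) <= cnormC x + cnormC y. Proof. exact: le_normcD. Qed.
Let cnormCZ (c : R[i]) x : cnormC (c *: x) = Normc.normc c * cnormC x.
Proof. exact: Normc.normcM. Qed.
Let cnormCM x y : cnormC (x * y) <= cnormC x * cnormC y.
Proof. by rewrite /cnormC Normc.normcM. Qed.
Let cnormC_starM x : cnormC (star x * x) = cnormC x ^+ 2.
Proof. exact: normc_conj. Qed.
Let cnormC_complete (x : nat -> R[i]^o) :
  (forall eps : R, 0 < eps -> exists N, forall m n,
     (N <= m)%N -> (N <= n)%N -> cnormC (x m - x n) < eps) ->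
  exists l, (cnormC (x n - l) @[n --> \oo] --> (0 : R))%classic.
Proof.
move=> hx.
have real_part (p : R[i] -> R) : (forall z, `|p z| <= Normc.normc z) ->
    {morph p : y z / y - z} -> exists l : R, (p (x n) @[n --> \oo] --> l)%classic.
  move=> p1 pB; suff h : cvgn (fun n => p (x n)) by exists (limn (fun n => p (x n))).
  apply: cauchy_cvg; apply: cauchy_exP => e /hx [N hN].
  exists (p (x N)); exists N => // n /= Nn.
  by rewrite /ball /= -pB; apply: le_lt_trans (p1 _) (hN _ _ _ _).
have [a ha] : exists l : R, (complex.Re (x n) @[n --> \oo] --> l)%classic.
  apply: real_part => [[u v]|[u v] [u' v'] //]; rewrite /= -sqrtr_sqr ler_wsqrtr //.
  by rewrite lerDl sqr_ge0.
have [b hb] : exists l : R, (complex.Im (x n) @[n --> \oo] --> l)%classic.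
  apply: real_part => [[u v]|[u v] [u' v'] //]; rewrite /= -sqrtr_sqr ler_wsqrtr //.
  by rewrite lerDr sqr_ge0.
exists (a +i* b).
apply: (@squeeze_cvgr _ _ _ _ (fun=> 0)
  (fun n => `|complex.Re (x n) - a| + `|complex.Im (x n) - b|)).
- apply: nearW => n; rewrite normc_ge0 /=; case: (x n) => u v /=.
  rewrite -[leRHS]ger0_norm ?addr_ge0 // -sqrtr_sqr ler_wsqrtr //.
  rewrite -real_normK ?num_real // -[X in _ + X]real_normK ?num_real //.
  by rewrite sqrrD lerD2r lerDl mulrn_wge0 // mulr_ge0.
- exact: cvg_cst.
- rewrite -(addr0 (0 : R)); apply: cvgD.
    by apply/norm_cvg0P; rewrite -(subrr a); apply: cvgB => //; exact: cvg_cst.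
  by apply/norm_cvg0P; rewrite -(subrr b); apply: cvgB => //; exact: cvg_cst.
Qed.

HB.instance Definition _ := isCstarAlgebra.Build R R[i]^o
  cnormC_eq0 cnormCD cnormCZ cnormCM cnormC_starM cnormC_complete.

End ComplexCstar.

(** * Scalar and diagonal matrices *)

Section ScalarMatrices.
Variables (R : realType) (A : cstarAlgType R) (n : nat).
Implicit Types (c : R[i]) (a : A).

Definition cmx_lift (x : cmx (R[i]^o : cstarAlgType R) n) : cmx A n :=
  map_mx (fun c : R[i] => c%:A) x.

Let lift_linear : linear cmx_lift.
Proof.
by move=> c x y; apply/matrixP => i j; rewrite !mxE scalerDl scalerA.
Qed.
Let lift_multiplicative : monoid_morphism cmx_lift.
Proof.
split=> [|x y]; apply/matrixP => i j.
  by rewrite !mxE; case: eqP => _; rewrite ?scale1r ?scale0r.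
rewrite !mxE scaler_suml; apply: eq_bigr => l _.
by rewrite !mxE -scalerAl mul1r scalerA.
Qed.

HB.instance Definition _ := GRing.isLinear.Build R[i] (cmx (R[i]^o : cstarAlgType R) n)
  (cmx A n) *:%R cmx_lift lift_linear.
HB.instance Definition _ := GRing.isMonoidMorphism.Build (cmx (R[i]^o : cstarAlgType R) n)
  (cmx A n) cmx_lift lift_multiplicative.

Lemma cmx_lift_star : star_hom cmx_lift.
Proof. by move=> x; apply/matrixP => i j; rewrite !mxE starZ star1. Qed.

Definition cmx_diag (a : A) : cmx A n := a%:M.

Let diag_linear : linear cmx_diag.
Proof.
move=> c x y; apply/matrixP => i j; rewrite !mxE.
by case: eqP; rewrite ?mulr1n ?mulr0n ?scaler0 ?addr0.
Qed.
Let diag_multiplicative : monoid_morphism cmx_diag.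
Proof. by split=> [//|x y]; rewrite /cmx_diag scalar_mxM. Qed.

HB.instance Definition _ := GRing.isLinear.Build R[i] A (cmx A n) *:%R cmx_diag diag_linear.
HB.instance Definition _ := GRing.isMonoidMorphism.Build A (cmx A n) cmx_diag
  diag_multiplicative.

Lemma cmx_diag_star : star_hom cmx_diag.
Proof.
move=> x; apply/matrixP => i j; rewrite !mxE eq_sym.
by case: eqP; rewrite ?mulr1n ?mulr0n ?star0.
Qed.

Lemma lift_diagC x a : cmx_lift x * cmx_diag a = cmx_diag a * cmx_lift x.
Proof.
apply/matrixP => i j; rewrite !mxE (bigD1 j) //= [RHS](bigD1 i) //= !big1 ?addr0.
- by rewrite !mxE !eqxx !mulr1n -scalerAl -scalerAr mul1r mulr1.
- by move=> k ki; rewrite !mxE eq_sym (negbTE ki) mulr0n mul0r.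
- by move=> k kj; rewrite !mxE (negbTE kj) mulr0n mulr0.
Qed.

Lemma opnorm_mxnorm (x : 'M[R[i]]_n.+1) :
  opnorm x = cnorm (x : cmx (R[i]^o : cstarAlgType R) n).
Proof.
have e (v : 'cV[R[i]]_n.+1) : l2norm v = vnorm (v : 'cV[(R[i]^o : cstarAlgType R)]_n.+1).
  congr Num.sqrt.
  have -> : ip (v : 'cV[(R[i]^o : cstarAlgType R)]_n.+1) v =
      (\sum_i Normc.normc (v i 0) ^+ 2)%:C.
    rewrite rmorph_sum; apply: eq_bigr => i _ /=; rewrite mulrC.
    case: (v i 0) => a b; rewrite /= sqr_sqrtr ?addr_ge0 ?sqr_ge0 //.
    by apply/eqP; rewrite eq_complex /=; apply/andP; split; apply/eqP; ring.
  rewrite [cnorm _]normcR ger0_norm //; apply: sumr_ge0 => i _; exact: sqr_ge0.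
congr sup; apply/seteqP; split=> [_ [v /= v1 <-]|_ [v /= v1 <-]].
  by exists v; rewrite -e.
by exists v => /=; rewrite e.
Qed.

Lemma cmx_lift_norm (x : 'M[R[i]]_n.+1) : cnorm (cmx_lift x) <= opnorm x.
Proof. by rewrite opnorm_mxnorm; exact: (hom_norm cmx_lift_star). Qed.

End ScalarMatrices.

Section OperatorNormTheory.
Variables (R : realType) (n : nat).
Implicit Types x : 'M[R[i]]_n.+1.

Lemma entry_le_opnorm x i j : Normc.normc (x i j) <= opnorm x.
Proof. by rewrite opnorm_mxnorm; exact: (entry_le_mxnorm (A := R[i]^o : cstarAlgType R)). Qed.

Lemma opnorm1 : opnorm (1 : 'M[R[i]]_n.+1) = 1.
Proof. by rewrite opnorm_mxnorm; exact: cnorm1. Qed.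

Lemma opnorm_gt0 x : x != 0 -> 0 < opnorm x.
Proof. by rewrite opnorm_mxnorm cnorm_gt0. Qed.

Lemma opnormZ (c : R[i]) x : opnorm (c *: x) = Normc.normc c * opnorm x.
Proof.
by rewrite !opnorm_mxnorm -cnormZ; congr cnorm; apply/matrixP => i j; rewrite !mxE.
Qed.

Lemma opnorm_delta i j : opnorm (delta_mx i j : 'M[R[i]]_n.+1) <= 1.
Proof.
rewrite opnorm_mxnorm; apply: le_trans (mxnorm_le_sum _) _.
rewrite /mxsum (bigD1 i) //= (bigD1 j) //= !big1 ?addr0.
- by rewrite mxE !eqxx cnorm1.
- by move=> k ki; rewrite big1 // => l _; rewrite mxE (negbTE ki) cnorm0.
- by move=> l lj; rewrite mxE (negbTE lj) andbF cnorm0.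
Qed.

End OperatorNormTheory.

(** * Order zero maps of matrix algebras *)

Section RowMaps.
Variables (R : realType) (A : cstarAlgType R) (n : nat).
Implicit Types (y : 'I_n.+1 -> A) (d : A) (x : 'M[R[i]]_n.+1).

(** A row padded with zero rows to a square matrix, so that it lives in the C*-algebra [cmx A n]. *)
Definition rowmx y : cmx A n := \matrix_(i, j) if i == 0 then y j else 0.

Definition rowmap y x : A := (rowmx y * cmx_lift A x * star (rowmx y)) 0 0.

Lemma rowmapE y x : rowmap y x = \sum_i \sum_j x i j *: (y i * star (y j)).
Proof.
rewrite /rowmap mxE exchange_big /=; apply: eq_bigr => j _.
rewrite !mxE eqxx mulr_suml; apply: eq_bigr => i _.
by rewrite !mxE eqxx -scalerAr mulr1 scalerAl.
Qed.

Let rowmap_linear y : linear (rowmap y).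
Proof.
move=> c a b; rewrite !rowmapE scaler_sumr -big_split; apply: eq_bigr => i _.
rewrite scaler_sumr -big_split; apply: eq_bigr => j _.
by rewrite !mxE scalerDl scalerA.
Qed.

HB.instance Definition _ y := GRing.isLinear.Build R[i] 'M[R[i]]_n.+1 A *:%R (rowmap y)
  (rowmap_linear y).

Lemma rowmap_cp y : completely_positive (rowmap y).
Proof.
move=> [|k] X [Y ->].
  by exists (map_mx (rowmap y) (mxstar Y *m Y)); apply/matrixP => -[].
(* Each [Y r q] is itself a matrix, and [l] runs over its rows: [Z l] applies the row [star y] to
   the [l]-th rows of all blocks. As [cmx A k] has size [k.+1], the empty matrix was treated
   before. *)
pose Z l : cmx A k := \matrix_(r, q) \sum_j Y r q l j *: star (y j).
have : pos (\sum_l star (Z l) * Z l) by apply: pos_sum => l _; exact: pos_starM.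
move=> /positiveP [W hW]; exists W; rewrite -[RHS]hW.
apply/matrixP => p q; rewrite summxE [LHS]mxE /= rowmapE.
have e i j : (mxstar Y *m Y) p q i j = \sum_r \sum_l Num.conj (Y r p l i) * Y r q l j.
  rewrite mxE summxE; apply: eq_bigr => r _; rewrite mxE; apply: eq_bigr => l _.
  by rewrite !mxE.
transitivity (\sum_i \sum_j \sum_r \sum_l
    (Num.conj (Y r p l i) * Y r q l j) *: (y i * star (y j))).
  apply: eq_bigr => i _; apply: eq_bigr => j _; rewrite e scaler_suml.
  by apply: eq_bigr => r _; rewrite scaler_suml.
have -> : \sum_l (star (Z l) * Z l) p q = \sum_l \sum_r \sum_i \sum_j
    (Num.conj (Y r p l i) * Y r q l j) *: (y i * star (y j)).
  apply: eq_bigr => l _; rewrite mxE; apply: eq_bigr => r _.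
  rewrite !mxE star_sum mulr_suml; apply: eq_bigr => i _.
  rewrite mulr_sumr; apply: eq_bigr => j _.
  by rewrite starZ starK -scalerAl -scalerAr scalerA.
transitivity (\sum_r \sum_l \sum_i \sum_j
    (Num.conj (Y r p l i) * Y r q l j) *: (y i * star (y j))); last exact: exchange_big.
transitivity (\sum_i \sum_r \sum_j \sum_l
    (Num.conj (Y r p l i) * Y r q l j) *: (y i * star (y j))).
  by apply: eq_bigr => i _; exact: exchange_big.
rewrite exchange_big; apply: eq_bigr => r _ /=.
transitivity (\sum_i \sum_l \sum_j (Num.conj (Y r p l i) * Y r q l j) *: (y i * star (y j))).
  by apply: eq_bigr => i _; exact: exchange_big.
exact: exchange_big.
Qed.

Lemma star_rowmx y d : (forall i j, star (y i) * y j = d *+ (i == j)) ->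
  star (rowmx y) * rowmx y = cmx_diag n d.
Proof.
move=> yd; apply/matrixP => i j; rewrite !mxE (bigD1 0) //= big1 => [|k k0].
  by rewrite !mxE eqxx addr0 yd.
by rewrite !mxE (negbTE k0) mulr0.
Qed.

(** For [Y = rowmx y], [star Y * Y] is the diagonal matrix of [d], which commutes with scalar
    matrices. Hence [Y a (star Y) Y b (star Y)] contains the product [a b], and the norm of [Y] is
    at most 1. *)
Lemma rowmap_cpc_order_zero y d :
  (forall i j, star (y i) * y j = d *+ (i == j)) -> cnorm d <= 1 ->
  cpc_order_zero (rowmap y).
Proof.
move=> /star_rowmx yd d1; have nd : cnorm (cmx_diag n d) <= 1.
  by apply: le_trans d1; exact: (hom_norm (@cmx_diag_star R A n)).
split; first exact: rowmap_cp.
- move=> x; apply: le_trans (entry_le_mxnorm _ _ _) _.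
  apply: (@le_trans _ _ (cnorm (rowmx y) * cnorm (cmx_lift A x) * cnorm (rowmx y))).
    by apply: cnormM_le; [exact: cnormM|rewrite cnorm_star].
  rewrite mulrAC -expr2 -cnorm_starM yd -[leRHS]mul1r.
  by apply: ler_pM => //; exact: cmx_lift_norm.
- move=> a b _ _ ab0.
  have -> : rowmap y a * rowmap y b =
      ((rowmx y * cmx_lift A a * star (rowmx y)) * (rowmx y * cmx_lift A b * star (rowmx y)))
        0 0.
    rewrite [RHS]mxE (bigD1 0) //= big1 ?addr0 // => k k0.
    rewrite [X in _ * X](_ : _ = 0) ?mulr0 // -mulrA mxE big1 // => l _.
    by rewrite mxE (negbTE k0) mul0r.
  have -> : rowmx y * cmx_lift A a * star (rowmx y) * (rowmx y * cmx_lift A b * star (rowmx y)) =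
      rowmx y * cmx_lift A a * (star (rowmx y) * rowmx y) * cmx_lift A b * star (rowmx y).
    by rewrite !mulrA.
  rewrite yd -(mulrA _ (cmx_diag n d)) -lift_diagC -!mulrA (mulrA (cmx_lift A a)) -rmorphM.
  have -> : (a : cmx (R[i]^o : cstarAlgType R) n) * b = 0 by exact: ab0.
  by rewrite rmorph0 mul0r mulr0 mxE.
Qed.

Lemma row_perturb (c : 'I_n.+1 -> A) d q q' (s : R) : 0 < s -> pos d ->
  \sum_i \sum_j cnorm (star (c i) * c j - d *+ (i == j)) <= s ->
  pos q -> pos q' -> q * q' = 0 -> d - (2 * s)%:C *: 1 = q - q' ->
  exists y, (forall i j, star (y i) * y j = q *+ (i == j)) /\
    forall i, cnorm (c i - y i) <= Num.sqrt (2 * s) + Num.sqrt (3 * s).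
Proof.
move=> s0 pd hs pq pq' qq' dq.
pose D a : cmx A n := cmx_diag n a.
have Dpos a : pos a -> pos (D a) by exact: (hom_pos (@cmx_diag_star R A n)).
have h1 : cnorm (star (rowmx c) * rowmx c - D d) <= s.
  apply: le_trans (mxnorm_le_sum _) _; apply: le_trans hs.
  rewrite /mxsum ler_sum // => i _; rewrite ler_sum // => j _.
  rewrite !mxE (bigD1 0) //= big1 => [|k k0]; first by rewrite !mxE eqxx addr0.
  by rewrite !mxE (negbTE k0) mulr0.
have h2 : D q * D q' = 0 by rewrite /D -rmorphM qq' rmorph0.
have h3 : D d - (2 * s)%:C *: 1 = D q - D q'.
  by rewrite /D -(hom_scalar (cmx_diag n)) -!rmorphB dq.
have [T [Y [TY YY XY]]] :=
  perturb s0 (pos_sa (Dpos _ pd)) h1 (Dpos _ pq) (Dpos _ pq') h2 h3.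
(* The limit [Y] of the [rowmx c * T m] inherits their zero rows, so it is again a row. *)
have Yrow : Y = rowmx (fun j => Y 0 j).
  apply/matrixP => i j; rewrite mxE; case: eqP => [->//|/eqP i0].
  apply: (@null_cst _ A); apply: (@null_le _ _ _ (fun m => cnorm (rowmx c * T m - Y))).
    move=> m; apply: le_trans (entry_le_mxnorm _ i j); rewrite !mxE.
    rewrite big1 => [|k _]; last by rewrite mxE (negbTE i0) mul0r.
    by rewrite sub0r cnormN.
  exact: TY.
exists (fun j => Y 0 j); split=> [i j|i].
  have /matrixP/(_ i j) := YY; rewrite /D [RHS]mxE => <-.
  rewrite mxE (bigD1 0) //= big1 => [|k k0]; first by rewrite !mxE addr0.
  by rewrite Yrow !mxE (negbTE k0) mulr0.
apply: le_trans (XY (Dpos _ pd)).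
by have := entry_le_mxnorm (rowmx c - Y) 0 i; rewrite !mxE.
Qed.

End RowMaps.

Section PositiveSum.
Variables (R : realType) (A : cstarAlgType R).

Lemma pos_sum_eq0 (I : finType) (F : I -> A) :
  (forall i, pos (F i)) -> \sum_i F i = 0 -> forall i, F i = 0.
Proof.
move=> pF F0 i; move: F0; rewrite (bigD1 i) //=; apply: pos_add_eq0 => //.
exact: pos_sum.
Qed.

End PositiveSum.

Section OrderZeroRelations.
Variables (R : realType) (A : cstarAlgType R) (n : nat).
Variable phi : {linear 'M[R[i]]_n.+1 -> A}.
Hypotheses (phi_cp : completely_positive phi) (phi_oz : order_zero phi).
Implicit Types (w : A) (i j k l : 'I_n.+1).

Definition mxunit i j : A := phi (delta_mx i j).
Local Notation E := mxunit.

Lemma star_delta i j : star (delta_mx i j : 'M[R[i]]_n.+1) = delta_mx j i.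
Proof.
by apply/matrixP => p q; rewrite !mxE andbC; case: andP; rewrite ?rmorph1 ?rmorph0.
Qed.

Lemma delta_mul i j k l :
  (delta_mx i j : 'M[R[i]]_n.+1) * delta_mx k l = delta_mx i l *+ (j == k).
Proof. exact: mul_delta_mx_cond. Qed.

(** Complete positivity at the Choi matrix of the units [e_ij], which is positive because
    [e_ij = star (e_0i) * e_0j]. The factorisation serves in place of a dilation. *)
Lemma mxunit_factor : exists Y : 'M[A]_n.+1,
  forall i j, E i j = \sum_k star (Y k i) * Y k j.
Proof.
have [|Y hY] := phi_cp (X := \matrix_(i, j) (delta_mx i j : 'M[R[i]]_n.+1)).
  exists (\matrix_(k, j) if k == 0 then delta_mx 0 j else 0).
  apply/matrixP => i j; rewrite !mxE (bigD1 0) //= big1 => [|k k0].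
    by rewrite !mxE !eqxx addr0 star_delta delta_mul eqxx.
  by rewrite !mxE (negbTE k0) mulr0.
exists Y => i j; have /matrixP/(_ i j) := hY; rewrite !mxE /mxunit => ->.
by apply: eq_bigr => k _; rewrite !mxE.
Qed.

Lemma mxunit_star i j : star (E i j) = E j i.
Proof.
have [Y hY] := mxunit_factor; rewrite !hY star_sum.
by apply: eq_bigr => k _; rewrite starM starK.
Qed.

Lemma mxunit_pos i : pos (E i i).
Proof. by have [Y ->] := mxunit_factor; apply: pos_sum => k _; exact: pos_starM. Qed.

(** [w * E i i * star w] is the sum of the positive elements built from the [Y k i * star w]; if it
    vanishes, so does each of these, and [Y k i] occurs in every [E i j]. *)
Lemma mxunit_kill w i j : w * E i i = 0 -> w * E i j = 0.
Proof.
have [Y hY] := mxunit_factor; rewrite !hY => h.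
have h' k : star (Y k i * star w) * (Y k i * star w) = 0.
  apply: (@pos_sum_eq0 _ _ _ (fun k => star (Y k i * star w) * (Y k i * star w))).
    by move=> l; exact: pos_starM.
  transitivity (w * (\sum_k star (Y k i) * Y k i) * star w).
    rewrite mulr_sumr mulr_suml; apply: eq_bigr => l _.
    by rewrite starM starK !mulrA.
  by rewrite h mul0r.
rewrite mulr_sumr big1 // => k _.
by rewrite mulrA -[w * _]starK starM starK (star_mul_eq0 (h' k)) star0 mul0r.
Qed.

Lemma mxunit_diag i j : i != j -> E i i * E j j = 0.
Proof.
move=> ij; apply: phi_oz.
- by exists (delta_mx i i); rewrite star_delta delta_mul eqxx.
- by exists (delta_mx j j); rewrite star_delta delta_mul eqxx.
- by rewrite delta_mul (negbTE ij).
Qed.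

Lemma mxunit_mul0 k l i j : l != i -> E k l * E i j = 0.
Proof.
move=> li; apply: mxunit_kill.
rewrite -[LHS]starK starM !mxunit_star (mxunit_kill _ (mxunit_diag _)) ?star0 //.
by rewrite eq_sym.
Qed.

(** A relation that the structure theorem of order zero maps would give. The positive matrices [v 1]
    and [v (- 1)] are orthogonal, so [(D + X) (D - X) = (D - X) (D + X) = 0] and [D ^ 2 = X ^ 2].
    Hence [W = E i i ^ 2 - E i j * E j i] also equals [E j i * E i j - E j j ^ 2]. The second form
    is annihilated by [E i i], and this forces [W ^ 2 = 0]. *)
Lemma mxunit_mul i j : E i j * E j i = E i i * E i i.
Proof.
have [->//|ij] := eqVneq i j; have ji : j != i by rewrite eq_sym.
pose X := E i j + E j i; pose D := E i i + E j j.
pose v (c : R[i]) : 'M[R[i]]_n.+1 :=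
  delta_mx i i + delta_mx j j + c *: (delta_mx i j + delta_mx j i).
have phiv c : phi (v c) = D + c *: X by rewrite /v !linearD !linearZ /= -scalerDr.
have pv c : c * c = 1 -> Num.conj c = c -> positive (v c).
  move=> cc sc; exists (delta_mx i i + c *: delta_mx i j).
  rewrite starD starZ !star_delta sc mulrDl !mulrDr -!scalerAl -!scalerAr.
  rewrite !delta_mul !eqxx scalerA cc scale1r /v scalerDr.
  by rewrite !mulr1n [X in _ = _ + X]addrC [RHS]addrACA.
have vv c : c * c = 1 -> v c * v (- c) = 0.
  move=> cc; rewrite /v.
  set a := delta_mx i i + delta_mx j j; set x := delta_mx i j + delta_mx j i.
  have deltas := (mulrDl, mulrDr, delta_mul, eqxx, negbTE ij, negbTE ji, mulr1n, mulr0n, addr0, add0r).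
  have ax : a * x = x by rewrite /a /x !deltas.
  have xa : x * a = x by rewrite /a /x !deltas addrC.
  have aa : a * a = a by rewrite /a !deltas.
  have xx : x * x = a by rewrite /x /a !deltas.
  clearbody a x.
  rewrite mulrDl !mulrDr -!scalerAl -!scalerAr ax xa aa xx scalerA mulrN cc scaleN1r.
  by rewrite scaleNr addrA subrK subrr.
have DX c : c * c = 1 -> Num.conj c = c -> (D + c *: X) * (D - c *: X) = 0.
  move=> cc sc; rewrite -scaleNr -!phiv; apply: phi_oz; [exact: pv| |exact: vv].
  by apply: pv; rewrite ?mulrNN // rmorphN /= sc.
have h1 := DX 1 (mulr1 1) (rmorph1 _).
have h2 := DX (-1) (etrans (mulrNN 1 1) (mulr1 1)) (rmorphN1 _).
have DDXX : D * D = X * X.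
  apply: (scalerI (_ : 2%:C != 0 :> R[i])); first by rewrite (inj_eq (@complexI _)) pnatr_eq0.
  apply/eqP; rewrite -subr_eq0; apply/eqP; rewrite -[RHS]addr0 -{1}h1 -{1}h2.
  by alg.
have Xe : X * X = E i j * E j i + E j i * E i j.
  by rewrite /X mulrDl !mulrDr (mxunit_mul0 _ _ ji) (mxunit_mul0 _ _ ij) addr0 add0r.
have De : D * D = E i i * E i i + E j j * E j j.
  by rewrite /D mulrDl !mulrDr (mxunit_mul0 _ _ ij) (mxunit_mul0 _ _ ji) addr0 add0r.
pose W := E i i * E i i - E i j * E j i.
have WE : W = E j i * E i j - E j j * E j j.
  apply/eqP; rewrite -subr_eq0; apply/eqP.
  have -> : W - (E j i * E i j - E j j * E j j) = D * D - X * X by rewrite De Xe /W; alg.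
  by rewrite DDXX subrr.
have sW : star W = W by rewrite starB !starM !mxunit_star.
have iW : E i i * W = 0.
  by rewrite WE mulrBr !mulrA (mxunit_mul0 _ _ ij) (mxunit_mul0 _ _ ij) !mul0r subrr.
have Wi : W * E i i = 0 by rewrite -[LHS]starK starM mxunit_star sW iW star0.
have Wij : W * E i j = 0 by exact: mxunit_kill.
have /sa_sq_eq0 -/(_ sW)/eqP : W * W = 0.
  by rewrite {2}/W mulrBr !mulrA Wi Wij !mul0r subrr.
by rewrite subr_eq0 => /eqP.
Qed.

Lemma mxunit_sum : phi 1 = \sum_i E i i.
Proof. by rewrite /mxunit -linear_sum; congr (phi _); exact: mx1_sum_delta. Qed.

Lemma order_zero_sq : phi 1 * phi 1 = \sum_i E i i * E i i.
Proof.
rewrite mxunit_sum mulr_suml; apply: eq_bigr => i _.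
rewrite mulr_sumr (bigD1 i) //= big1 ?addr0 // => j ji.
by rewrite mxunit_mul0 // eq_sym.
Qed.

End OrderZeroRelations.

(** * Approximately central sequences in simple algebras *)

Section AsymptoticEquality.
Variables (R : realType) (A : cstarAlgType R).
Implicit Types (f g : nat -> A) (x y : A).

Definition aeq f g := null (fun m => f m - g m).

Lemma aeq_refl f : aeq f f.
Proof. by apply: eq_null (null0 A) => m; rewrite subrr. Qed.

Lemma aeq_sym f g : aeq f g -> aeq g f.
Proof. by move=> h; apply: eq_null (nullN h) => m; rewrite opprB. Qed.

Lemma aeq_trans g f h : aeq f g -> aeq g h -> aeq f h.
Proof. by move=> a b; apply: eq_null (nullD a b) => m; rewrite addrA subrK. Qed.

Lemma aeq_eq f g f' g' : aeq f g -> f =1 f' -> g =1 g' -> aeq f' g'.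
Proof. by move=> h /funext <- /funext <-. Qed.

Lemma aeqM f g f' g' : bounded f' -> bounded g -> aeq f f' -> aeq g g' ->
  aeq (fun m => f m * g m) (fun m => f' m * g' m).
Proof.
move=> bf bg ff gg; apply: eq_null (nullD (nullMr ff bg) (nullMl bf gg)) => m.
by alg.
Qed.

Lemma aeqMl f g g' : bounded f -> aeq g g' -> aeq (fun m => f m * g m) (fun m => f m * g' m).
Proof. by move=> bf gg; apply: eq_null (nullMl bf gg) => m; alg. Qed.

Lemma aeqMr f f' g : bounded g -> aeq f f' -> aeq (fun m => f m * g m) (fun m => f' m * g m).
Proof. by move=> bg ff; apply: eq_null (nullMr ff bg) => m; alg. Qed.

Lemma aeq_sum (I : Type) (s : seq I) (P : pred I) (F F' : I -> nat -> A) :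
  (forall i, P i -> aeq (F i) (F' i)) ->
  aeq (fun m => \sum_(i <- s | P i) F i m) (fun m => \sum_(i <- s | P i) F' i m).
Proof.
by move=> h; apply: eq_null (@null_sum _ _ _ s P (fun i m => F i m - F' i m) h) => m; rewrite sumrB.
Qed.

Lemma eq_aeq f g : f =1 g -> aeq f g.
Proof. by move=> /funext ->; exact: aeq_refl. Qed.

Lemma aeq_null f g : aeq f g -> null g -> null f.
Proof. by move=> a b; apply: eq_null (nullD a b) => m; rewrite subrK. Qed.

Lemma bounded_exp f k : bounded f -> bounded (fun m => f m ^+ k).
Proof.
move=> bf; elim: k => [|k [r hr]]; first by exists 1 => m; rewrite expr0 cnorm1.
have [t ht] := bf; exists (t * r) => m; rewrite exprS.
exact: cnormM_le.
Qed.

Definition acomm f y := aeq (fun m => f m * y) (fun m => y * f m).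

Lemma acomm_exp f y k : bounded f -> acomm f y -> acomm (fun m => f m ^+ k) y.
Proof.
move=> bf fy; elim: k => [|k IH].
  by apply: eq_aeq => m; rewrite expr0 mulr1 mul1r.
apply: (@aeq_trans (fun m => f m * y * f m ^+ k)).
  by apply: aeq_eq (aeqMl bf IH) _ _ => m; rewrite ?exprS ?mulrA.
by apply: aeq_eq (aeqMr (bounded_exp k bf) fy) _ _ => m; rewrite ?exprS ?mulrA.
Qed.

Lemma acommM f x y : acomm f x -> acomm f y -> acomm f (x * y).
Proof.
move=> fx fy; apply: (@aeq_trans (fun m => x * f m * y)).
  by apply: aeq_eq (aeqMr (bounded_cst y) fx) _ _ => m; rewrite ?mulrA.
by apply: aeq_eq (aeqMl (bounded_cst x) fy) _ _ => m; rewrite ?mulrA.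
Qed.

Lemma acommX f x k : acomm f x -> acomm f (x ^+ k).
Proof.
move=> fx; elim: k => [|k IH]; first by apply: eq_aeq => m; rewrite expr0 mulr1 mul1r.
by rewrite exprS; exact: acommM.
Qed.

End AsymptoticEquality.

Section Simple.
Variables (R : realType) (A : cstarAlgType R).
Hypothesis simpleA : simple_cstar A.
Implicit Types (x y f g e : A).

(** The closure of the ideal generated by [x] is all of [A], so the ideal itself has an element at
    distance less than 1 from 1; it is invertible. *)
Lemma simple_unit x : x != 0 -> exists s : seq (A * A), \sum_(p <- s) p.1 * x * p.2 = 1.
Proof.
move=> x0; pose J y := exists s : seq (A * A), \sum_(p <- s) p.1 * x * p.2 = y.
pose I := [set l | forall e : R, 0 < e -> exists2 y, J y & cnorm (l - y) < e]%classic.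
have JI y : J y -> I y by move=> Jy e e0; exists y; rewrite // subrr cnorm0.
have J0 : J 0 by exists [::]; rewrite big_nil.
have : I = [set 0]%classic \/ I = setT.
  apply: simpleA => /=.
  - move=> y l Iy yl e e0; have e2 : 0 < e / 2 by rewrite divr_gt0.
    have [N /(_ N (leqnn N)) hN] := null_lt yl e2.
    have [z Jz hz] := Iy N _ e2; exists z => //.
    rewrite (_ : l - z = (y N - z) - (y N - l)); last by alg.
    by apply: le_lt_trans (cnormB _ _) _; rewrite [e]splitr; exact: ltrD.
  - exact: JI.
  - move=> y z Iy Iz e e0; have e2 : 0 < e / 2 by rewrite divr_gt0.
    have [y' [s hs] hy] := Iy _ e2; have [z' [t ht] hz] := Iz _ e2.
    exists (y' + z'); first by exists (s ++ t); rewrite big_cat hs ht.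
    rewrite (_ : _ - _ = (y - y') + (z - z')); last by alg.
    by apply: le_lt_trans (cnormD _ _) _; rewrite [e]splitr; exact: ltrD.
  - move=> a y Iy; have a1 : 0 < 1 + cnorm a by rewrite ltr_pwDl.
    have small (e : R) z : 0 < e -> cnorm z < e / (1 + cnorm a) ->
        cnorm a * cnorm z < e.
      move=> e0 hz; apply: (@le_lt_trans _ _ ((1 + cnorm a) * cnorm z)).
        by rewrite ler_wpM2r // lerDr.
      by rewrite mulrC -ltr_pdivlMr.
    split=> e e0; have [y' [s hs] hy] := Iy _ (divr_gt0 e0 a1).
    + exists (a * y').
        exists [seq (a * p.1, p.2) | p <- s]; rewrite big_map -hs mulr_sumr.
        by apply: eq_bigr => p _; rewrite /= !mulrA.
      by rewrite -mulrBr; apply: le_lt_trans (cnormM _ _) _; exact: small.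
    + exists (y' * a).
        exists [seq (p.1, p.2 * a) | p <- s]; rewrite big_map -hs mulr_suml.
        by apply: eq_bigr => p _; rewrite /= !mulrA.
      by rewrite -mulrBl; apply: le_lt_trans (cnormM _ _) _; rewrite mulrC; exact: small.
move=> [I0|IT].
  have : I x by apply: JI; exists [:: (1, 1)]; rewrite big_seq1 mul1r mulr1.
  by rewrite I0 => /= /eqP; rewrite (negbTE x0).
have : I 1 by rewrite IT.
move=> /(_ _ ltr01) [y [s hs] /neumann [z [yz _]]].
exists [seq (p.1, p.2 * z) | p <- s]; rewrite big_map -yz -hs mulr_suml.
by apply: eq_bigr => p _; rewrite /= !mulrA.
Qed.

(** Multiply the expression of 1 from [simple_unit] by [f] and move [f] to the left next to [x],
    which costs commutators with the right factors. *)
Lemma simple_lower_bound x : x != 0 -> exists (s : seq A) (c : R), 0 < c /\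
  forall f, cnorm f <= c * (cnorm (x * f) + \sum_(q <- s) cnorm (f * q - q * f)).
Proof.
move=> /simple_unit [s hs].
pose c := \sum_(p <- s) (cnorm p.1 * cnorm p.2 + cnorm (p.1 * x)).
have c0 : 0 <= c by apply: sumr_ge0 => p _; rewrite addr_ge0 ?mulr_ge0.
exists (map snd s), (1 + c); split=> [|f]; first by rewrite ltr_pwDl.
rewrite big_map; set S := \sum_(p <- s) cnorm _.
have S0 : 0 <= S by exact: sumr_ge0.
have fE : f = \sum_(p <- s) (p.1 * (x * f) * p.2 - p.1 * x * (f * p.2 - p.2 * f)).
  rewrite -{1}[f]mul1r -hs mulr_suml; apply: eq_bigr => p _; alg.
apply: (@le_trans _ _ (c * (cnorm (x * f) + S))); last first.
  by rewrite ler_wpM2r ?addr_ge0 // lerDr.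
rewrite {1}fE; apply: le_trans (cnorm_sum _ _ _) _; rewrite /c mulr_suml.
rewrite [leRHS]big_seq [leLHS]big_seq ler_sum // => p ps.
have pS : cnorm (f * p.2 - p.2 * f) <= S.
  rewrite /S (big_rem p) //= lerDl; exact: sumr_ge0.
apply: le_trans (cnormB _ _) _.
have h1 : cnorm (p.1 * (x * f) * p.2) <= cnorm p.1 * cnorm p.2 * cnorm (x * f).
  by rewrite mulrAC; apply: cnormM_le => //; exact: cnormM.
have h2 : cnorm (p.1 * x * (f * p.2 - p.2 * f)) <= cnorm (p.1 * x) * S.
  exact: cnormM_le.
apply: le_trans (lerD h1 h2) _; rewrite mulrDl; apply: lerD.
  by rewrite ler_wpM2l ?mulr_ge0 // lerDl.
by rewrite ler_wpM2l // lerDr.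
Qed.

Lemma central_lower_bound x : x != 0 -> exists (s : seq A) (c : R), 0 < c /\
  forall f : nat -> A, (forall m, cnorm (f m) = 1) -> (forall q, q \in s -> acomm f q) ->
  exists N, forall m, (N <= m)%N -> c <= cnorm (x * f m).
Proof.
move=> /simple_lower_bound [s [c [c0 hc]]]; exists s, (2 * c)^-1.
have c2 : 0 < 2 * c by rewrite mulr_gt0.
split=> [|f f1 fs]; first by rewrite invr_gt0.
(* The real sequence is turned into multiples of 1 so that the calculus of [null] applies to it. *)
have h : null (fun m => (\sum_(q <- s) cnorm (f m * q - q * f m))%:C *: (1 : A)).
  elim: s {hc} fs => [|q s IH] fs.
    by apply: eq_null (null0 A) => m; rewrite big_nil scale0r.
  have hq : null (fun m => (cnorm (f m * q - q * f m))%:C *: (1 : A)).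
    apply: (@null_le _ _ _ (fun m => cnorm (f m * q - q * f m))) => [m|].
      by rewrite cnormZr cnorm1 mulr1 ger0_norm.
    by apply: fs; rewrite inE eqxx.
  apply: eq_null (nullD hq (IH _)) => [m|r rs]; last by apply: fs; rewrite inE rs orbT.
  by rewrite big_cons rmorphD scalerDl.
have ci : 0 < (2 * c)^-1 by rewrite invr_gt0.
have [N hN] := null_lt h ci; exists N => m /hN; rewrite cnormZr cnorm1 mulr1.
have := hc (f m); rewrite f1; set t := cnorm _; set S := \sum_(_ <- _) _ => ht hS.
have {}hS : S < (2 * c)^-1 by apply: le_lt_trans hS; exact: ler_norm.
have hh : c * (t + S) <= c * (t + (2 * c)^-1) by rewrite ler_pM2l // lerD2l ltW.
have := le_trans ht hh; rewrite mulrDr.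
have -> : c * (2 * c)^-1 = 2^-1 by field; rewrite gt_eqF.
have -> : (2 * c)^-1 = 2^-1 / c by field; rewrite gt_eqF.
by rewrite ler_pdivrMr // mulrC; lra.
Qed.

(* Compressing by [e] has norm at least [1/4] on [x]: otherwise, with [g = (x - |x|/2)_+],
   [e^k g x^k g e^k >= (|x|/2)^k e^k g^2 e^k] would contradict
   [e^k g x^k g e^k ~ g (e x e)^k g] for large [k], as [|g e^k|] is bounded below. *)
Lemma compression_lower_bound x : pos x -> x != 0 -> exists s : seq A,
  forall e : nat -> A, (forall m, pos (e m) /\ cnorm (e m) = 1) ->
  (forall q, q \in s -> acomm e q) ->
  exists N, forall m, (N <= m)%N -> cnorm x / 4 <= cnorm (e m * x * e m).
Proof.
move=> px x0; set l := cnorm x; have l0 : 0 < l by rewrite cnorm_gt0.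
have sx := pos_sa px.
have [g [g' [pg pg' xg gg' gc]]] := pos_parts (saB sx (saZ (l / 2) (sa1 A))).
have sg := pos_sa pg.
have g0 : g != 0.
  apply/eqP => g0; have : cnorm x <= l / 2.
    apply: pos_norm_le => //; first by rewrite divr_ge0 // ltW.
    by rewrite -opprB xg g0 sub0r opprK.
  by rewrite -/l; lra.
have gx : GRing.comm g x.
  have [h _] := gc x (commrB (commr_refl x) (commZ1 _ _)); exact: commr_sym.
have g1 k : pos (x ^+ k * g - ((l / 2) ^+ k)%:C *: g).
  elim: k => [|k IH]; first by rewrite !expr0 mul1r scale1r subrr; exact: pos0.
  have xgE : x * g = (l / 2)%:C *: g + g * g.
    have -> : x * g = (x - (l / 2)%:C *: 1) * g + (l / 2)%:C *: g by alg.
    by rewrite xg mulrBl (pos_mul0C pg pg' gg') subr0 addrC.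
  have -> : x ^+ k.+1 * g - ((l / 2) ^+ k.+1)%:C *: g =
      x * (x ^+ k * g - ((l / 2) ^+ k)%:C *: g) + ((l / 2) ^+ k)%:C *: (g * g).
    have -> : g * g = x * g - (l / 2)%:C *: g by rewrite xgE addrC addKr.
    by rewrite !exprS; alg.
  apply: posD; last by apply: posZ; [rewrite exprn_ge0 // divr_ge0 // ltW|exact: pos_sq].
  apply: posM => //; apply: commrB.
    by apply: commrM; [exact: commrX|exact: commr_sym].
  by rewrite /GRing.comm -scalerAl -scalerAr gx.
have [s [c [c0 hc]]] := central_lower_bound g0.
(* With this exponent [cnorm g ^ 2 (l / 4) ^ k] is at most half of the lower bound
   [(l / 2) ^ k c ^ 2]; the other half is left for the commutation errors. *)
have [j hj] : exists j, 2 * cnorm g ^+ 2 / c ^+ 2 <= 2 ^+ (2 ^ j).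
  exists (Num.truncn (2 * cnorm g ^+ 2 / c ^+ 2)).+1.
  apply/ltW/(lt_le_trans (truncnS_gt _)).
  rewrite -natrX ler_nat; apply: leq_trans (ltnW (ltn_expl _ (ltnSn 1))) _.
  by rewrite leq_exp2l // ltnW // ltn_expl.
pose k := (2 ^ j)%N; exists [:: x, g & s] => e he es.
have pe m : pos (e m) by case: (he m).
have e1 m : cnorm (e m) = 1 by case: (he m).
have be : bounded e by exists 1 => m; rewrite e1.
have bek i : bounded (fun m => e m ^+ i) by exact: bounded_exp.
have ex : acomm e x by apply: es; rewrite inE eqxx.
have eg : acomm e g by apply: es; rewrite !inE eqxx orbT.
have ek1 m : cnorm (e m ^+ k) = 1 by rewrite cnorm_sa_exp2 ?e1 ?expr1n //; exact: pos_sa.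
have [N1 hN1] : exists N, forall m, (N <= m)%N -> c <= cnorm (g * e m ^+ k).
  apply: hc => // q qs; apply: acomm_exp => //; apply: es.
  by rewrite !inE qs !orbT.
have exe : aeq (fun m => (e m * x * e m) ^+ k) (fun m => e m ^+ k * x ^+ k * e m ^+ k).
  have h i : aeq (fun m => (e m * x * e m) ^+ i) (fun m => x ^+ i * e m ^+ (i + i)).
    elim: i => [|i IH]; first by apply: eq_aeq => m; rewrite !expr0 mulr1.
    apply: (@aeq_trans _ _ (fun m => (e m * x * e m) * (x ^+ i * e m ^+ (i + i)))).
      apply: aeq_eq (aeqMl _ IH) _ _ => [|m|//]; last by rewrite exprS.
      by apply: boundedM => //; apply: boundedM => //; exact: bounded_cst.
    apply: (@aeq_trans _ _ (fun m => x * e m * e m * (x ^+ i * e m ^+ (i + i)))).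
      apply: aeqMr; first by apply: boundedM => //; exact: bounded_cst.
      exact: aeqMr.
    apply: (@aeq_trans _ _ (fun m => x * (e m ^+ 2 * x ^+ i) * e m ^+ (i + i))).
      by apply: eq_aeq => m; rewrite expr2 !mulrA.
    apply: (@aeq_trans _ _ (fun m => x * (x ^+ i * e m ^+ 2) * e m ^+ (i + i))).
      apply: aeqMr => //; apply: aeqMl; first exact: bounded_cst.
      by apply: acommX; exact: acomm_exp.
    have ii : (i.+1 + i.+1 = 2 + (i + i))%N by rewrite addSn addnS.
    apply: eq_aeq => m; rewrite ii [x ^+ i.+1]exprS [e m ^+ (2 + _)]exprD; move: (e m ^+ 2) => e2.
    by rewrite !mulrA.
  apply: aeq_trans (h k) _; apply: aeq_sym.
  apply: (@aeq_trans _ _ (fun m => x ^+ k * e m ^+ k * e m ^+ k)).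
    by apply: aeqMr => //; apply: acommX; exact: acomm_exp.
  by apply: eq_aeq => m; rewrite -mulrA -exprD.
have main : null (fun m => e m ^+ k * g * x ^+ k * g * e m ^+ k - g * (e m * x * e m) ^+ k * g).
  have ekg : acomm (fun m => e m ^+ k) g by exact: acomm_exp.
  have bxg : bounded (fun m => x ^+ k * (e m ^+ k * g)).
    apply: boundedM; first exact: bounded_cst.
    by apply: boundedM => //; exact: bounded_cst.
  apply: (@aeq_trans _ _ (fun m => g * e m ^+ k * (x ^+ k * (e m ^+ k * g)))).
    apply: (@aeq_trans _ _ (fun m => e m ^+ k * g * (x ^+ k * (g * e m ^+ k)))).
      by apply: eq_aeq => m; rewrite !mulrA.
    apply: aeqM => //.
    - by apply: boundedM => //; exact: bounded_cst.
    - apply: boundedM; first exact: bounded_cst.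
      by apply: boundedM => //; exact: bounded_cst.
    - by apply: aeqMl; [exact: bounded_cst|exact: aeq_sym].
  by apply: aeq_eq (aeq_sym (aeqMr (bounded_cst g) (aeqMl (bounded_cst g) exe))) _ _ => m;
    rewrite ?mulrA.
have l2 : 0 < (l / 2) ^+ k by rewrite exprn_gt0 // divr_gt0.
have d0 : 0 < (l / 2) ^+ k * c ^+ 2 / 2 by rewrite divr_gt0 // mulr_gt0 // exprn_gt0.
have [N2 hN2] := null_lt main d0.
exists (maxn N1 N2) => m; rewrite geq_max => /andP[/hN1 hc1 /hN2 hm].
rewrite leNgt; apply/negP => small.
have sek : sa (e m ^+ k) by apply/sa_expX/pos_sa.
have low : (l / 2) ^+ k * c ^+ 2 <= cnorm (e m ^+ k * g * x ^+ k * g * e m ^+ k).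
  apply: (@le_trans _ _ (cnorm (((l / 2) ^+ k)%:C *: (star (g * e m ^+ k) * (g * e m ^+ k))))).
    rewrite cnormZr gtr0_norm // cnorm_starM ler_pM2l //.
    by rewrite ler_pXn2r ?nnegrE ?(ltW c0).
  apply: pos_le_norm; first by apply: posZ (pos_starM _); exact: ltW.
  rewrite starM sek sg.
  have -> : e m ^+ k * g * x ^+ k * g * e m ^+ k -
      ((l / 2) ^+ k)%:C *: (e m ^+ k * g * (g * e m ^+ k)) =
      e m ^+ k * (g * (x ^+ k * g - ((l / 2) ^+ k)%:C *: g)) * e m ^+ k by alg.
  apply: pos_conj_sa => //; apply: posM => //; apply: commrB.
    by apply: commrM => //; exact: commrX.
  by rewrite /GRing.comm -scalerAl -scalerAr.
have high : cnorm (g * (e m * x * e m) ^+ k * g) <= cnorm g ^+ 2 * (l / 4) ^+ k.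
  rewrite expr2 mulrAC; apply: cnormM_le => //; apply: cnormM_le => //.
  apply: le_trans (cnormX _ _) _; apply: lerXn2r; last exact: ltW.
    by rewrite nnegrE.
  by rewrite nnegrE divr_ge0 // ltW.
have : (l / 2) ^+ k * c ^+ 2 < (l / 2) ^+ k * c ^+ 2 / 2 + cnorm g ^+ 2 * (l / 4) ^+ k.
  apply: le_lt_trans low _.
  rewrite -[X in cnorm X](subrK (g * (e m * x * e m) ^+ k * g)).
  by apply: le_lt_trans (cnormD _ _) _; apply: ltr_leD.
have -> : l / 4 = (l / 2) / 2 by field.
rewrite [(l / 2 / 2) ^+ k]exprMn exprVn.
apply/negP; rewrite -leNgt.
have c20 : 0 < c ^+ 2 by rewrite exprn_gt0.
have k0 : (0 : R) < 2 ^+ k by rewrite exprn_gt0.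
move: hj; rewrite -/k ler_pdivrMr // => hj.
have : cnorm g ^+ 2 * ((l / 2) ^+ k / 2 ^+ k) <= (l / 2) ^+ k * c ^+ 2 / 2.
  rewrite mulrA ler_pdivrMr // mulrC.
  have -> : (l / 2) ^+ k * c ^+ 2 / 2 * 2 ^+ k = (l / 2) ^+ k * (2 ^+ k * c ^+ 2 / 2) by ring.
  by rewrite ler_pM2l // ler_pdivlMr // mulrC.
lra.
Qed.

End Simple.

(** * Rokhlin towers and orthogonal copies *)

Section RokhlinSequences.
Variables (R : realType) (A : cstarAlgType R) (G : finGroupType).
Variable alpha : G -> {lrmorphism A -> A}.
Hypothesis rokhlin : gen_tracial_Rokhlin alpha.
Implicit Types (a b : A) (s : seq A) (g h : G).

Lemma rokhlin_seq s a : pos a -> a != 0 -> exists e : nat -> G -> A,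
  [/\ forall m g, pos (e m g) /\ cnorm (e m g) = 1,
      forall m g h, g != h -> e m g * e m h = 0,
      forall m, cuntz_sub (1 - \sum_g e m g) a,
      forall g q, q \in s -> acomm (fun m => e m g) q
    & forall g h, aeq (fun m => alpha g (e m h)) (fun m => e m (g * h)%g)].
Proof.
move=> /positiveP pa a0.
have n0 m : (0 : R) < m.+1%:R^-1 by rewrite invr_gt0.
have [e he] := choice (fun m => rokhlin (n0 m) (finite_seq s) pa a0).
exists e; split.
- by move=> m g; have [h _] := he m; have [/positiveP pg ng] := h g.
- by move=> m; have [_ [h _ _ _]] := he m; exact: h.
- by move=> m; have [_ [_ h _ _]] := he m.
- move=> g q qs; apply: (@null_le _ _ _ (fun m => m.+1%:R^-1)); last exact: cvg_harmonic.
  by move=> m; apply: ltW; have [_ [_ _ h _]] := he m; exact: h.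
- move=> g h; apply: (@null_le _ _ _ (fun m => m.+1%:R^-1)); last exact: cvg_harmonic.
  by move=> m; apply: ltW; have [_ [_ _ _ h']] := he m; exact: h'.
Qed.

Hypothesis simpleA : simple_cstar A.

Lemma simple_orthogonal p q : p != 0 -> q != 0 -> exists z : A, p * z * q != 0.
Proof.
move=> p0 q0; apply: contrapT => h; have {}h z : p * z * q = 0.
  by apply: contrapT => /eqP hz; apply: h; exists z.
have [t ht] := simple_unit simpleA p0.
move/eqP: q0; apply; rewrite -[q]mul1r -ht mulr_suml big1 // => x _.
by rewrite -!mulrA [p * _]mulrA h mulr0.
Qed.

(** With [k] the root of [a], a difference [d] of two Rokhlin elements makes [k d k] neither
    positive nor negative, so both its parts [p] and [q] are nonzero, and simplicity gives a nonzero
    [T = p ^ 2 z q ^ 2]. As [T ^ 2 = 0], the elements [T * |T|] and [star T * T] have orthogonal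
    ranges and the same [star x * x]. Both factor through [k] on the left, as [p ^ 2 = k d k p] and
    [q ^ 2 = - k d k q]. *)
Lemma halving a g0 : g0 != 1%g -> pos a -> a != 0 -> exists (r1 r2 b : A),
  [/\ b != 0, star r1 * a * r2 = 0, star r1 * a * r1 = b & star r2 * a * r2 = b].
Proof.
move=> g01 pa a0; have [k [pk kk kc]] := pos_sqrt_ex pa; have sk := pos_sa pk.
have [s [c [c0 hc]]] := central_lower_bound simpleA a0.
have [e [he e0 _ es _]] := rokhlin_seq (k :: s) (pos1 A) (oner_neq0 A).
have pe m g : pos (e m g) by case: (he m g).
have e1 m g : cnorm (e m g) = 1 by case: (he m g).
have be g : bounded (fun m => e m g) by exists 1 => m; rewrite e1.
(* Otherwise compression by [e m h] would bound [t m] by a term tending to zero, since it contains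
   [e m h * e m g] up to commutators. But [t m * e m h ~ a * e m h ^+ 4] is bounded below; the extra
   factor makes the exponent a power of two. *)
have not_pos g h : g != h -> exists N, forall m, (N <= m)%N ->
    ~ pos (k * (e m g - e m h) * k).
  move=> gh; have [N1 hN1] : exists N, forall m, (N <= m)%N -> c <= cnorm (a * e m h ^+ 4).
    apply: hc => [m|q qs].
      by rewrite (_ : 4 = 2 ^ 2)%N // cnorm_sa_exp2 ?e1 ?expr1n //; exact: pos_sa.
    by apply: acomm_exp => //; apply: es; rewrite inE qs orbT.
  have ek f : acomm (fun m => e m f) k by apply: es; rewrite inE eqxx.
  pose t m := e m h * k * e m h * k * e m h.
  have ta : aeq (fun m => t m * e m h) (fun m => a * e m h ^+ 4).
    have bk f : bounded (fun m => k * e m f).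
      by apply: boundedM => //; exact: bounded_cst.
    apply: (@aeq_trans _ _ (fun m => k * e m h * (e m h * (k * (e m h * e m h))))).
      have bb : bounded (fun m => e m h * (k * (e m h * e m h))).
        by apply: boundedM => //; apply: boundedM; [exact: bounded_cst|exact: boundedM].
      by apply: aeq_eq (aeqMr bb (ek h)) _ _ => m; rewrite /t ?mulrA.
    apply: (@aeq_trans _ _ (fun m => k * e m h * (k * e m h * (e m h * e m h)))).
      apply: aeq_eq (aeqMl (bk h) (aeqMr (boundedM (be h) (be h)) (ek h))) _ _ => [m|//].
      by rewrite !mulrA.
    apply: aeq_eq (aeqMr (boundedM (be h) (boundedM (be h) (be h))) (aeqMl (bounded_cst k) (ek h))) _ _ => m.
      by rewrite !mulrA.
    by rewrite -kk !exprS expr0 mulr1 !mulrA.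
  have tz : null (fun m => e m h * k * e m g * k * e m h).
    have hg m : e m h * e m g = 0 by apply: e0; rewrite eq_sym.
    apply: aeq_null (_ : null (fun=> 0)); last exact: null0.
    have bb : bounded (fun m => e m g * (k * e m h)).
      by apply: boundedM => //; apply: boundedM => //; exact: bounded_cst.
    apply: aeq_eq (aeqMr bb (ek h)) _ _ => m.
    + by rewrite !mulrA.
    + by rewrite -!mulrA [e m h * (e m g * _)]mulrA hg mul0r mulr0.
  have c4 : 0 < c / 4 by rewrite divr_gt0.
  have [N2 hN2] := null_lt tz c4; have [N3 hN3] := null_lt ta c4.
  exists (maxn N1 (maxn N2 N3)) => m; rewrite !geq_max => /and3P[/hN1 h1 /hN2 h2 /hN3 h3].
  move=> /(pos_conj_sa (pos_sa (pe m h))) hp.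
  have pt : pos (t m).
    have -> : t m = e m h * (k * e m h * k) * e m h by rewrite /t !mulrA.
    by apply: pos_conj_sa; [exact: pos_sa|exact: pos_conj_sa].
  have : cnorm (t m) <= cnorm (e m h * k * e m g * k * e m h).
    apply: pos_le_norm => //.
    by move: hp; rewrite (_ : _ * _ * _ = e m h * k * e m g * k * e m h - t m) // /t; alg.
  have : cnorm (t m * e m h) <= cnorm (t m) * 1 by apply: cnormM_le; rewrite ?e1.
  have := cnormB (t m * e m h) (t m * e m h - a * e m h ^+ 4).
  by rewrite subKr; lra.
have [N1 hN1] := not_pos _ _ g01; have [N2 hN2] : exists N, forall m, (N <= m)%N ->
  ~ pos (k * (e m 1%g - e m g0) * k) by apply: not_pos; rewrite eq_sym.
pose m := maxn N1 N2; pose d := e m g0 - e m 1%g.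
have sd : sa d by apply: saB; exact: pos_sa.
have sS : sa (k * d * k) by rewrite -{1}sk; exact: sa_conj.
have [p [q [pp pq S pq0 _]]] := pos_parts sS.
have qp0 := pos_mul0C pp pq pq0.
have sp := pos_sa pp; have sq := pos_sa pq.
have p0 : p * p != 0.
  apply/eqP => /(sa_sq_eq0 sp) p0; apply: (hN2 m (leq_maxr _ _)).
  have -> : k * (e m 1%g - e m g0) * k = - (k * d * k) by rewrite /d; alg.
  by rewrite S p0 sub0r opprK.
have q0 : q * q != 0.
  apply/eqP => /(sa_sq_eq0 sq) q0; apply: (hN1 m (leq_maxl _ _)).
  by rewrite -/d S q0 subr0.
have [z hz] := simple_orthogonal p0 q0.
pose T := p * p * z * (q * q); pose u := star T * T.
have TT : T * T = 0.
  have -> : T * T = p * p * z * q * (q * p) * p * z * (q * q) by rewrite /T !mulrA.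
  by rewrite qp0 mulr0 !mul0r.
have [v [pv vv vc]] := pos_sqrt_ex (pos_starM T).
have kp : k * (d * k * p) = p * p by rewrite !mulrA S mulrBl qp0 subr0.
have kq : k * (- d * k * q) = q * q.
  by rewrite -!mulrA mulNr mulrN !mulrA S mulrBl pq0 sub0r opprK.
pose r1 := d * k * p * z * (q * q) * v.
pose r2 := - d * k * q * star z * (p * p) * T.
have kr1 : k * r1 = T * v by rewrite /r1 /T -kp !mulrA.
have kr2 : k * r2 = star T * T.
  have -> : star T = q * q * star z * (p * p) by rewrite /T !starM sp sq !mulrA.
  by rewrite /r2 -kq !mulrA.
have akr x y : star x * a * y = star (k * x) * (k * y) by rewrite starM sk -kk !mulrA.
have sT : star T * star T = 0 by rewrite -starM TT star0.
exists r1, r2, (u * u); split.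
- apply/eqP => /(sa_sq_eq0 (pos_sa (pos_starM T))) /star_mul_eq0 /eqP.
  by rewrite (negbTE hz).
- by rewrite akr kr1 kr2 starM -!mulrA [star T * (star T * _)]mulrA sT mul0r mulr0.
- rewrite akr kr1 starM (pos_sa pv).
  transitivity (v * (v * v) * v); first by rewrite vv !mulrA.
  by rewrite /u -vv !mulrA.
- by rewrite akr kr2 starM starK mulrA.
Qed.

Lemma copies a g0 N : g0 != 1%g -> pos a -> a != 0 -> exists b (r : nat -> A),
  [/\ pos b, b != 0 & forall i j, (i < 2 ^ N)%N -> (j < 2 ^ N)%N ->
   star (r i) * a * r j = b *+ (i == j)].
Proof.
move=> g01; elim: N a => [|N IH] a pa a0.
  exists a, (fun=> 1); split => // i j; rewrite !ltnS !leqn0 => /eqP -> /eqP ->.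
  by rewrite star1 mul1r mulr1.
have [r1 [r2 [b1 [b10 r12 r11 r22]]]] := halving g01 pa a0.
have pb1 : pos b1 by rewrite -r11; exact: pos_conj.
have [b [r [pb b0 hr]]] := IH b1 pb1 b10.
have r21 : star r2 * a * r1 = 0.
  rewrite -[LHS]starK (_ : star (star r2 * a * r1) = star r1 * a * r2) ?r12 ?star0 //.
  by rewrite !starM starK (pos_sa pa) mulrA.
exists b, (fun i => if (i < 2 ^ N)%N then r1 * r i else r2 * r (i - 2 ^ N)%N); split => //.
have e x y i j : star (x * r i) * a * (y * r j) = star (r i) * (star x * a * y) * r j.
  by rewrite starM !mulrA.
rewrite expnS mul2n -addnn => i j hi hj.
have [iN|iN] := ltnP i (2 ^ N); have [jN|jN] := ltnP j (2 ^ N); rewrite e ?r11 ?r12 ?r21 ?r22.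
- exact: hr.
- by rewrite mulr0 mul0r ltn_eqF // (leq_trans iN).
- by rewrite mulr0 mul0r gtn_eqF // (leq_trans jN).
- rewrite hr ?ltn_subLR // ?(leq_trans _ iN) //; congr (_ *+ nat_of_bool _).
  by rewrite -(eqn_add2r (2 ^ N)) !subnK.
Qed.

End RokhlinSequences.

(** * Density of the span in the crossed product *)

(** Bundled so that the subtype receives its own C*-structure and can serve as a target of the
    universal property. *)
Record sub_cstar (R : realType) (B : cstarAlgType R) := SubCstar {
  sub_pred :> {pred B};
  sub_pred_closed : subalg_closed sub_pred;
  sub_pred_star : forall x, x \in sub_pred -> star x \in sub_pred;
  sub_pred_lim : forall (x : nat -> B) l, (forall n, x n \in sub_pred) -> cv x l ->
    l \in sub_pred }.

Section SubCstarAlgebra.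
Variables (R : realType) (B : cstarAlgType R) (S : sub_cstar B).

Record sub_cstar_type := SubElement { sub_val : B; sub_valP : sub_val \in sub_pred S }.

HB.instance Definition _ := [isSub for sub_val].
HB.instance Definition _ := [Choice of sub_cstar_type by <:].
HB.instance Definition _ := GRing.isSubalgClosed.Build R[i] B (sub_pred S) (sub_pred_closed S).
HB.instance Definition _ := [SubChoice_isSubAlgebra of sub_cstar_type by <:].

Let sub_star (x : sub_cstar_type) : sub_cstar_type := SubElement (sub_pred_star (sub_valP x)).
Let sub_starK : involutive sub_star.
Proof. by move=> x; apply: val_inj; exact: starK. Qed.
Let sub_starD : {morph sub_star : x y / x + y}.
Proof. by move=> x y; apply: val_inj; exact: starD. Qed.
Let sub_starZ (c : R[i]) x : sub_star (c *: x) = Num.conj c *: sub_star x.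
Proof. by apply: val_inj; exact: starZ. Qed.
Let sub_starM x y : sub_star (x * y) = sub_star y * sub_star x.
Proof. by apply: val_inj; exact: starM. Qed.

HB.instance Definition _ := isStarAlgebra.Build R sub_cstar_type
  sub_starK sub_starD sub_starZ sub_starM.

Let sub_norm (x : sub_cstar_type) : R := cnorm (val x).
Let sub_norm0_eq0 x : sub_norm x = 0 -> x = 0.
Proof. by move=> /cnorm0_eq0 x0; exact: val_inj. Qed.
Let sub_normD x y : sub_norm (x + y) <= sub_norm x + sub_norm y.
Proof. exact: cnormD. Qed.
Let sub_normZ (c : R[i]) x : sub_norm (c *: x) = Normc.normc c * sub_norm x.
Proof. exact: cnormZ. Qed.
Let sub_normM x y : sub_norm (x * y) <= sub_norm x * sub_norm y.
Proof. exact: cnormM. Qed.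
Let sub_norm_starM x : sub_norm (star x * x) = sub_norm x ^+ 2.
Proof. exact: cnorm_starM. Qed.
Let sub_complete (x : nat -> sub_cstar_type) :
  (forall eps : R, 0 < eps -> exists N, forall m n,
     (N <= m)%N -> (N <= n)%N -> sub_norm (x m - x n) < eps) ->
  exists l, (sub_norm (x n - l) @[n --> \oo] --> (0 : R))%classic.
Proof.
move=> hx; have [l hl] := cnorm_complete (fun n => val (x n)) hx.
have lS : l \in sub_pred S by apply: sub_pred_lim hl => n; exact: valP.
by exists (SubElement lS).
Qed.

HB.instance Definition _ := isCstarAlgebra.Build R sub_cstar_type
  sub_norm0_eq0 sub_normD sub_normZ sub_normM sub_norm_starM sub_complete.

Definition sub_incl (x : sub_cstar_type) : B := val x.

Let sub_incl_linear : linear sub_incl. Proof. by []. Qed.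
Let sub_incl_multiplicative : monoid_morphism sub_incl. Proof. by split. Qed.

HB.instance Definition _ := GRing.isLinear.Build R[i] sub_cstar_type B *:%R sub_incl
  sub_incl_linear.
HB.instance Definition _ := GRing.isMonoidMorphism.Build sub_cstar_type B sub_incl
  sub_incl_multiplicative.

End SubCstarAlgebra.

Section CrossedProduct.
Variables (R : realType) (A : cstarAlgType R) (G : finGroupType).
Variable alpha : G -> {lrmorphism A -> A}.
Variables (B : cstarAlgType R) (iota : {lrmorphism A -> B}) (u : G -> B).
Hypothesis alpha_action : is_action alpha.
Hypothesis crossed : is_crossed_product alpha iota u.
Implicit Types (a : A) (b x y : B) (g h : G).

Lemma crossed_hom : star_hom iota. Proof. by case: crossed => -[]. Qed.

Lemma alpha_hom g : star_hom (alpha g). Proof. by case: alpha_action. Qed.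

Lemma alphaM g h a : alpha (g * h)%g a = alpha g (alpha h a).
Proof. by case: alpha_action => _ _ ->. Qed.

Lemma alpha1 a : alpha 1%g a = a. Proof. by case: alpha_action. Qed.

Lemma unitary_starM g : star (u g) * u g = 1.
Proof. by case: crossed => -[_ /(_ g) []]. Qed.

Lemma unitary_Mstar g : u g * star (u g) = 1.
Proof. by case: crossed => -[_ /(_ g) []]. Qed.

Lemma unitaryM g h : u (g * h)%g = u g * u h.
Proof. by case: crossed => -[]. Qed.

Lemma unitary1 : u 1%g = 1.
Proof. by rewrite -[LHS]mul1r -{1}(unitary_starM 1%g) -mulrA -unitaryM mulg1 unitary_starM. Qed.

Lemma star_unitary g : star (u g) = u g^-1%g.
Proof.
by rewrite -[RHS]mulr1 -(unitary_Mstar g) mulrA -unitaryM mulVg unitary1 mul1r.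
Qed.

Lemma unitary_conj g a : u g * iota a * star (u g) = iota (alpha g a).
Proof. by case: crossed => -[]. Qed.

Lemma unitary_comm g a : u g * iota a = iota (alpha g a) * u g.
Proof. by rewrite -unitary_conj -mulrA unitary_starM mulr1. Qed.

Lemma cnorm_unitary g : cnorm (u g) = 1.
Proof.
apply/eqP; rewrite -(@eqrXn2 _ 2) ?ler01 // -cnorm_starM unitary_starM cnorm1.
by rewrite expr1n.
Qed.

(** Lists, in which group elements may repeat, turn sums into concatenations and products into lists
    of pairs; [crossed_dense] collects equal group elements at the end. *)
Definition crossed_span b := exists s : seq (A * G), b = \sum_(p <- s) iota p.1 * u p.2.

Definition crossed_closure b :=
  forall e : R, 0 < e -> exists2 x, crossed_span x & cnorm (b - x) < e.

Lemma crossed_closure_cv b :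
  crossed_closure b <-> exists x : nat -> B, (forall n, crossed_span (x n)) /\ cv x b.
Proof.
split=> [h|[x [hx xb]] e e0]; last first.
  have [N /(_ N (leqnn N)) hN] := null_lt xb e0.
  by exists (x N) => //; rewrite cnormBC.
have n0 n : (0 : R) < n.+1%:R^-1 by rewrite invr_gt0.
have h' n : exists x, crossed_span x /\ cnorm (b - x) < n.+1%:R^-1.
  by have [x] := h _ (n0 n); exists x.
have [x hx] := choice h'; exists x; split=> [n|]; first by case: (hx n).
apply: (@null_le _ _ _ (fun n => n.+1%:R^-1)); last exact: cvg_harmonic.
by move=> n; rewrite cnormBC ltW //; case: (hx n).
Qed.

Lemma crossed_spanD (c : R[i]) x y : crossed_span x -> crossed_span y -> crossed_span (c *: x + y).
Proof.
move=> [s ->] [t ->]; exists ([seq (c *: p.1, p.2) | p <- s] ++ t).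
rewrite big_cat big_map scaler_sumr; congr (_ + _); apply: eq_bigr => p _.
by rewrite /= linearZ scalerAl.
Qed.

Lemma crossed_spanM x y : crossed_span x -> crossed_span y -> crossed_span (x * y).
Proof.
move=> [s ->] [t ->].
exists [seq (p.1 * alpha p.2 q.1, (p.2 * q.2)%g) | p <- s, q <- t].
rewrite big_allpairs_dep /= mulr_suml; apply: eq_bigr => p _.
rewrite mulr_sumr; apply: eq_bigr => q _.
by rewrite rmorphM /= unitaryM -!mulrA (mulrA (u p.2)) unitary_comm !mulrA.
Qed.

Lemma crossed_span_star x : crossed_span x -> crossed_span (star x).
Proof.
move=> [s ->]; exists [seq (alpha p.2^-1%g (star p.1), p.2^-1%g) | p <- s].
rewrite star_sum big_map; apply: eq_bigr => p _ /=.
by rewrite -unitary_comm starM star_unitary crossed_hom.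
Qed.

Let S b : bool := `[< crossed_closure b >].

Let S_closed : subalg_closed S.
Proof.
split=> [|c x y /asboolP /crossed_closure_cv [x' [hx xx]] /asboolP /crossed_closure_cv [y' [hy yy]]
  |x y /asboolP /crossed_closure_cv [x' [hx xx]] /asboolP /crossed_closure_cv [y' [hy yy]]];
  apply/asboolP.
- move=> e e0; exists 1; last by rewrite subrr cnorm0.
  by exists [:: (1, 1%g)]; rewrite big_seq1 rmorph1 mul1r unitary1.
- apply/crossed_closure_cv; exists (fun n => c *: x' n + y' n); split=> [n|].
    exact: crossed_spanD.
  exact: cvD (cvZ c xx) yy.
- apply/crossed_closure_cv; exists (fun n => x' n * y' n); split=> [n|].
    exact: crossed_spanM.
  exact: cvM.
Qed.

Let S_star x : x \in S -> star x \in S.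
Proof.
move=> /asboolP /crossed_closure_cv [x' [hx xx]]; apply/asboolP/crossed_closure_cv.
exists (fun n => star (x' n)); split=> [n|]; first exact: crossed_span_star.
exact: cv_star.
Qed.

Let S_lim (x : nat -> B) l : (forall n, x n \in S) -> cv x l -> l \in S.
Proof.
move=> hx xl; apply/asboolP => e e0; have e2 : 0 < e / 2 by rewrite divr_gt0.
have [N /(_ N (leqnn N)) hN] := null_lt xl e2.
have /asboolP /(_ _ e2) [y hy yN] := hx N; exists y => //.
rewrite (_ : l - y = (x N - y) - (x N - l)); last by alg.
by apply: le_lt_trans (cnormB _ _) _; rewrite [e]splitr; exact: ltrD.
Qed.

Let SC := SubCstar S_closed S_star S_lim.

Let S_span x : crossed_span x -> x \in sub_pred SC.
Proof. by move=> hx; apply/asboolP => e e0; exists x; rewrite // subrr cnorm0. Qed.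

Let S_iota a : iota a \in sub_pred SC.
Proof. by apply: S_span; exists [:: (a, 1%g)]; rewrite big_seq1 unitary1 mulr1. Qed.

Let S_u g : u g \in sub_pred SC.
Proof. by apply: S_span; exists [:: (1, g)]; rewrite big_seq1 rmorph1 mul1r. Qed.

Let iota' a : sub_cstar_type SC := SubElement (S_iota a).
Let u' g : sub_cstar_type SC := SubElement (S_u g).

Let iota'_linear : linear iota'.
Proof. by move=> c x y; apply: val_inj; rewrite /= linearP. Qed.
Let iota'_multiplicative : monoid_morphism iota'.
Proof.
by split=> [|x y]; apply: val_inj; rewrite /= ?rmorph1 ?rmorphM.
Qed.

HB.instance Definition _ := GRing.isLinear.Build R[i] A (sub_cstar_type SC) *:%R iota'
  iota'_linear.
HB.instance Definition _ := GRing.isMonoidMorphism.Build A (sub_cstar_type SC) iota'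
  iota'_multiplicative.

(** The closed span contains the covariant pair, so the universal property maps [B] into it.
    Followed by the inclusion, this map fixes the pair, so by uniqueness it is the identity of
    [B]. *)
Lemma crossed_dense b e : 0 < e ->
  exists a : G -> A, cnorm (b - \sum_g iota (a g) * u g) < e.
Proof.
have [_ univ] := crossed.
have cov : covariant_rep alpha (iota' : {lrmorphism A -> sub_cstar_type SC}) u'.
  split.
  - by move=> a; apply: val_inj; exact: crossed_hom.
  - by move=> g; split; apply: val_inj; [exact: unitary_starM|exact: unitary_Mstar].
  - by move=> g h; apply: val_inj; exact: unitaryM.
  - by move=> g a; apply: val_inj; exact: unitary_conj.
have [rho [rho_star rho_iota rho_u] _] := univ _ _ _ cov.
have [rho0 _ uniq] := univ B iota u crossed.1.
pose f : {lrmorphism B -> B} := [the {lrmorphism B -> B} of sub_incl (S := SC) \o rho].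
have f0 : f =1 rho0.
  apply: uniq; split=> x; rewrite /f /=.
  - by rewrite rho_star.
  - by have /= -> := rho_iota x.
  - by have /= -> := rho_u x.
have id0 : (idfun : {lrmorphism B -> B}) =1 rho0 by apply: uniq; split.
move=> e0; have /asboolP /(_ e e0) [x [s ->] hx] : b \in S.
  have -> : b = val (rho b) by rewrite -[LHS]/(idfun b) id0 -f0.
  exact: valP.
exists (fun g => \sum_(p <- s | p.2 == g) p.1); congr (cnorm (_ - _) < _): hx.
rewrite (partition_big snd xpredT) //=; apply: eq_bigr => g _.
rewrite rmorph_sum mulr_suml; apply: eq_bigr => p /eqP ->.
by [].
Qed.

Lemma crossed_trivial : (forall g, g = 1%g) -> exists2 rho : {lrmorphism B -> A},
  star_hom rho & cancel iota rho /\ cancel rho iota.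
Proof.
move=> G1; have [_ univ] := crossed.
have [|rho [rho_star rho_iota _] _] := univ A (idfun : {lrmorphism A -> A}) (fun=> 1).
  split=> [//|g|g h|g a]; rewrite ?star1 ?mulr1 ?mul1r //.
    by split; rewrite star1 mulr1.
  by rewrite (G1 g) alpha1.
have [rho0 _ uniq] := univ B iota u crossed.1.
pose f : {lrmorphism B -> B} := [the {lrmorphism B -> B} of iota \o rho].
have f0 : f =1 rho0.
  apply: uniq; split=> x; rewrite /f /=.
  - by rewrite rho_star crossed_hom.
  - by have /= -> := rho_iota x.
  - by rewrite (G1 x) unitary1 !rmorph1.
have id0 : (idfun : {lrmorphism B -> B}) =1 rho0 by apply: uniq; split.
exists rho => //; split=> x; first exact: rho_iota.
by rewrite -[RHS]/(idfun x) id0 -f0.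
Qed.

End CrossedProduct.

(** * Exact rows from approximate ones *)

Section ExactRow.
Variables (R : realType) (A : cstarAlgType R).
Implicit Types (a p q : A) (r s t : R).

(** Compression by [p] removes [q] and gives [p ^ 3 <= r p ^ 2]; then the norm of [p ^ 4] is at most
    [r cnorm p ^ 3]. *)
Lemma pos_part_norm_le p q r : pos p -> pos q -> p * q = 0 -> 0 <= r ->
  pos (r%:C *: 1 - (p - q)) -> cnorm p <= r.
Proof.
move=> pp pq pq0 r0 h; have sp := pos_sa pp.
have [->|p0] := eqVneq p 0; first by rewrite cnorm0.
have np : 0 < cnorm p by rewrite cnorm_gt0.
have h3 : cnorm (p * p * p) <= r * cnorm (p * p).
  rewrite -[r]ger0_norm // -cnormZr; apply: pos_le_norm; first exact: pos_conj_sa.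
  have -> : r%:C *: (p * p) - p * p * p = p * (r%:C *: 1 - (p - q)) * p - p * q * p by alg.
  by rewrite pq0 mul0r subr0; exact: pos_conj_sa.
have h4 : cnorm p ^+ 4 <= cnorm p * cnorm (p * p * p).
  have <- : cnorm (p ^+ (2 ^ 2)) = cnorm p ^+ 4 by rewrite cnorm_sa_exp2.
  have -> : p ^+ (2 ^ 2) = p * (p * p * p) by rewrite !exprS expr0 mulr1 !mulrA.
  exact: cnormM.
have h5 := le_trans h4 (ler_wpM2l (ltW np) h3).
move: h5; rewrite cnorm_sa_sq //.
have -> : cnorm p * (r * cnorm p ^+ 2) = r * cnorm p ^+ 3 by ring.
by rewrite exprS ler_pM2r // exprn_gt0.
Qed.

Variable n : nat.
Implicit Types (c y : 'I_n.+1 -> A).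

(** Two corrections. The polar decomposition yields a row with Gram element [q = (d - 2 t)_+], a
    contraction as [d <= 1 + t]. Multiplication by [r = (p + 1 - e)^(-1/2)], where
    [p = (q - (1 - e))_+], turns [q] into [min (1, q / (1 - e))]. With
    [T = \sum_i y i * star (y i)], the defect becomes a conjugate of [(1 - T - e)_+], and this cut
    lets [cuntz_perturb] with tolerance [e / 2] place it below any positive [s] close to
    [1 - \sum_i c i * star (c i)]. *)
Lemma exact_row c (t e : R) : 0 < t -> 0 < e -> e <= 2^-1 ->
  \sum_i \sum_j cnorm (star (c i) * c j - (star (c 0) * c 0) *+ (i == j)) <= t ->
  pos ((1 + t)%:C *: 1 - star (c 0) * c 0) ->
  let k := Num.sqrt (2 * t) + Num.sqrt (3 * t) in
  exists y d, [/\ forall i j, star (y i) * y j = d *+ (i == j), cnorm d <= 1,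
    forall i, cnorm (c i - y i) <= k + Num.sqrt (2 * e) &
    forall s : A, pos s ->
      cnorm (1 - \sum_i c i * star (c i) - s) + \sum_i (1 + cnorm (c i)) * k <= e / 2 ->
      cuntz_sub (1 - \sum_i y i * star (y i)) s].
Proof.
move=> t0 e0 e12 hc; set d := star (c 0) * c 0 => hd k.
have pd : pos d by exact: pos_starM.
have sd := pos_sa pd.
have [q [q' [pq pq' dq qq' _]]] := pos_parts (saB sd (saZ (2 * t) (sa1 A))).
have sq := pos_sa pq.
have [y [yq cy]] := row_perturb t0 pd hc pq pq' qq' dq.
have q1 : cnorm q <= 1.
  apply: (pos_part_norm_le pq pq' qq' ler01); rewrite -dq.
  have -> : 1%:C *: 1 - (d - (2 * t)%:C *: 1) = (1 + t)%:C *: 1 - d + t%:C *: 1 by alg.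
  by apply: posD => //; exact/pos_scalar/ltW.
have y1 i : cnorm (y i) <= 1.
  by rewrite -(@ler_pXn2r _ 2) ?nnegrE // -cnorm_starM yq eqxx mulr1n expr1n.
have s0 : 0 < 1 - e by lra.
have [p [p' [pp pp' qp pp0 pc]]] := pos_parts (saB sq (saZ (1 - e) (sa1 A))).
have p1 : cnorm p <= e.
  apply: (pos_part_norm_le pp pp' pp0 (ltW e0)); rewrite -qp.
  have -> : e%:C *: 1 - (q - (1 - e)%:C *: 1) = 1%:C *: 1 - q by alg.
  exact: pos_norm_sub.
have [j [pj j1 j2 jc psj]] := pos_inv pp s0.
have [r [pr rr rc]] := pos_sqrt_ex pj; have sr := pos_sa pr.
have rp : GRing.comm p r by exact/rc/jc.
have nj : cnorm j <= 2.
  have : cnorm ((1 - e)%:C *: j) <= 1.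
    by apply: pos_norm_le => //; [apply: posZ => //; exact: ltW|rewrite scale1r].
  by rewrite cnormZr gtr0_norm // => h; have := cnorm_ge0 j; nra.
have nr : cnorm (1 - r) <= Num.sqrt (2 * e).
  apply: le_sqrt_sqr => //; apply: le_trans (sqrt_holder (pos1 A) pr) _.
  rewrite mulr1 rr.
  have -> : 1 - j = j * (p - e%:C *: 1) by rewrite -{1}j1; alg.
  apply: cnormM_le => //; apply: sa_norm_le.
  - by apply: saB; [exact: pos_sa|exact/saZ/sa1].
  - exact: ltW.
  - have -> : e%:C *: 1 - (p - e%:C *: 1) = (e%:C *: 1 - p) + e%:C *: 1 by alg.
    apply: posD; first exact/pos_norm_sub/p1/pos_sa.
    exact/pos_scalar/ltW.
  - by rewrite addrC subrK.
pose y' i := y i * r.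
have y'y' i l : star (y' i) * y' l = (r * q * r) *+ (i == l).
  have -> : star (y' i) * y' l = r * (star (y i) * y l) * r by rewrite /y' starM sr !mulrA.
  by rewrite yq mulrnAr mulrnAl.
have mq : p + (1 - e)%:C *: 1 - q = p'.
  have -> : q = p - p' + (1 - e)%:C *: 1 by rewrite -qp subrK.
  by alg.
exists y', (r * q * r); split => //.
- apply: pos_norm_le => //; first exact: pos_conj_sa.
  have -> : 1%:C *: 1 - r * q * r = r * p' * r.
    have -> : r * p' * r = r * (p + (1 - e)%:C *: 1) * r - r * q * r by rewrite -mq; alg.
    congr (_ - _); rewrite scale1r -mulrA.
    have -> : (p + (1 - e)%:C *: 1) * r = r * (p + (1 - e)%:C *: 1).
      by rewrite mulrDl mulrDr rp; congr (_ + _); alg.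
    by rewrite mulrA rr j1.
  exact: pos_conj_sa.
- move=> i; have -> : c i - y' i = (c i - y i) + y i * (1 - r) by rewrite /y'; alg.
  apply: le_trans (cnormD _ _) _; apply: lerD => //.
  by rewrite -[leRHS]mul1r; exact: cnormM_le.
move=> s ps hs; pose T := \sum_i y i * star (y i).
have sT : sa T by rewrite /sa star_sum; apply: eq_bigr => i _; rewrite starM starK.
(* So [y i] carries the parts of [q - (1 - e)] to those of [T - (1 - e)], and [j] to [J]; the sum of
   the [y i * j * star (y i)] becomes [J * T]. *)
have yT i : y i * q = T * y i.
  rewrite mulr_suml (bigD1 i) //= big1 => [|l li].
    by rewrite addr0 -mulrA yq eqxx.
  by rewrite -mulrA yq (negbTE li) mulr0.
have [P [P' [pP pP' TP PP0 Pc]]] := pos_parts (saB sT (saZ (1 - e) (sa1 A))).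
have yP i : y i * p = P * y i.
  have h : y i * (q - (1 - e)%:C *: 1) = (T - (1 - e)%:C *: 1) * y i.
    by rewrite mulrBr mulrBl yT; alg.
  by have [] := parts_intertwine pp pp' pp0 qp pP pP' PP0 TP h.
have [J [pJ J1 J2 Jc psJ]] := pos_inv pP s0.
have yJ i : y i * j = J * y i.
  have -> : y i * j = J * ((P + (1 - e)%:C *: 1) * y i) * j by rewrite mulrA J1 mul1r.
  have -> : (P + (1 - e)%:C *: 1) * y i = y i * (p + (1 - e)%:C *: 1).
    by rewrite mulrDl mulrDr yP; congr (_ + _); alg.
  by rewrite -!mulrA j2 mulr1.
have [rJ [prJ rJJ rJc]] := pos_sqrt_ex pJ.
have -> : 1 - \sum_i y' i * star (y' i) = rJ * P' * star rJ.
  have -> : \sum_i y' i * star (y' i) = J * T.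
    rewrite mulr_sumr; apply: eq_bigr => i _; rewrite /y' starM sr.
    by rewrite -mulrA (mulrA r) rr mulrA yJ mulrA.
  have PPc : GRing.comm P' rJ.
    apply/rJc/Jc/commr_sym.
    by rewrite /GRing.comm PP0 (pos_mul0C pP pP' PP0).
  rewrite (pos_sa prJ) -mulrA PPc mulrA rJJ -{1}J1.
  have -> : T = P - P' + (1 - e)%:C *: 1 by rewrite -TP subrK.
  by alg.
apply: cuntz_trans (cuntz_conj _ _) _.
have e20 : 0 < e / 2 by rewrite divr_gt0.
apply: (cuntz_perturb (d := 1 - T) (q' := P) e20 ps) => //.
- by apply: saB => //; exact: sa1.
- apply: le_trans hs; rewrite cnormBC.
  have -> : 1 - T - s = (1 - \sum_i c i * star (c i) - s) +
     \sum_i ((c i - y i) * star (c i) + y i * star (c i - y i)).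
    have -> : \sum_i ((c i - y i) * star (c i) + y i * star (c i - y i)) =
        \sum_i c i * star (c i) - T.
      by rewrite -sumrB; apply: eq_bigr => i _; rewrite starB; alg.
    by alg.
  apply: le_trans (cnormD _ _) _; rewrite lerD2l.
  apply: le_trans (cnorm_sum _ _ _) _; apply: ler_sum => i _.
  apply: le_trans (cnormD _ _) _; rewrite [leRHS]mulrDl [leLHS]addrC; apply: lerD.
    by apply: cnormM_le => //; rewrite cnorm_star.
  by rewrite [leRHS]mulrC; apply: cnormM_le => //; rewrite cnorm_star.
- exact: pos_mul0C pP pP' PP0.
- have -> : 2 * (e / 2) = e by rewrite mulrC divfK // pnatr_eq0.
  have -> : 1 - T - e%:C *: 1 = - (T - (1 - e)%:C *: 1) by alg.
  by rewrite TP opprB.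
Qed.

End ExactRow.

Section NullFamilies.
Variables (R : realType) (A : cstarAlgType R).

Lemma null_seq_lt (T : eqType) (s : seq T) (x : T -> nat -> A) (t : R) :
  (forall i, i \in s -> null (x i)) -> 0 < t ->
  exists N, forall m, (N <= m)%N -> forall i, i \in s -> cnorm (x i m) < t.
Proof.
move=> + t0; elim: s => [|i s IH] h; first by exists 0.
have [N1 h1] := null_lt (h i (mem_head _ _)) t0.
have [|N2 h2] := IH; first by move=> k ks; apply: h; rewrite inE ks orbT.
exists (maxn N1 N2) => m; rewrite geq_max => /andP[/h1 hi /h2 hs] k.
by rewrite inE => /predU1P[->//|]; exact: hs.
Qed.

Lemma null_fin_lt (I : finType) (x : I -> nat -> A) (t : R) :
  (forall i, null (x i)) -> 0 < t ->
  exists N, forall m, (N <= m)%N -> forall i, cnorm (x i m) < t.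
Proof.
move=> h t0; have [N hN] := null_seq_lt (s := enum I) (fun i _ => h i) t0.
by exists N => m /hN hm i; apply: hm; rewrite mem_enum.
Qed.

End NullFamilies.

(** * The approximately invariant row *)

Section ApproximateRow.
Variables (R : realType) (A : cstarAlgType R) (G : finGroupType).
Variable alpha : G -> {lrmorphism A -> A}.
Hypotheses (alpha_action : is_action alpha) (rokhlin : gen_tracial_Rokhlin alpha).
Variables (n : nat) (phi : {linear 'M[R[i]]_n.+1 -> A}).
Hypothesis phi_oz : cpc_order_zero phi.
Implicit Types (a y : A) (g h : G) (i j : 'I_n.+1).
Local Notation E := (mxunit phi).

Lemma mxunit_norm i j : cnorm (E i j) <= 1.
Proof. by case: phi_oz => _ h _; apply: le_trans (h _) _; exact: opnorm_delta. Qed.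

Lemma orthogonal_sum_sq (e : G -> A) : (forall g h, g != h -> e g * e h = 0) ->
  (\sum_g e g) * (\sum_g e g) = \sum_g e g * e g.
Proof.
move=> e0; rewrite mulr_suml; apply: eq_bigr => g _.
rewrite mulr_sumr (bigD1 g) //= big1 ?addr0 // => h hg.
by rewrite e0 // eq_sym.
Qed.

Lemma orthogonal_sum_norm (e : G -> A) : (forall g, pos (e g) /\ cnorm (e g) = 1) ->
  (forall g h, g != h -> e g * e h = 0) -> cnorm (\sum_g e g) <= 1.
Proof.
move=> he e0; set p := \sum_g e g.
have pp : pos p by apply: pos_sum => g _; case: (he g).
have [->|p0] := eqVneq p 0; first by rewrite cnorm0.
have : cnorm (p * p) <= cnorm p.
  apply: pos_le_norm; first exact/pos_sq/pos_sa.
  rewrite orthogonal_sum_sq // -sumrB; apply: pos_sum => g _.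
  have [pe e1] := he g.
  have -> : e g - e g * e g = e g * (1%:C *: 1 - e g) by alg.
  apply: posM => //; first by apply: pos_norm_sub; [exact: pos_sa|rewrite e1].
  by apply: commrB; [exact: commZ1|].
rewrite cnorm_sa_sq; last exact: pos_sa.
by rewrite expr2 -[leRHS]mulr1 ler_pM2l // cnorm_gt0.
Qed.

(** The tower is chosen after [phi] and asymptotically commutes with all translates of the [E i j],
    so every relation of the [E i j] passes to the row with an error below any [t]. Only the
    commutation error [d] of [phi] itself remains, once for each level. Invariance is a reindexing
    of the sum over [G]. *)
Lemma approximate_row (s : seq A) (d t : R) a : pos a -> a != 0 -> 0 < t ->
  (forall g i y, y \in s -> cnorm (alpha g (E i 0) * y - y * alpha g (E i 0)) <= d) ->
  exists (e : G -> A) (c : 'I_n.+1 -> A),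
  [/\ (forall g, pos (e g) /\ cnorm (e g) = 1) /\ (forall g h, g != h -> e g * e h = 0),
      cuntz_sub (1 - \sum_g e g) a,
      (\sum_i \sum_j cnorm (star (c i) * c j - (star (c 0) * c 0) *+ (i == j)) <= t) /\
      pos ((1 + t)%:C *: 1 - star (c 0) * c 0),
      (forall i, cnorm (c i) <= #|G|%:R) /\
      ((forall g i, cnorm (alpha g (c i) - c i) <= t) /\
      (forall i y, y \in s -> cnorm (c i * y - y * c i) <= #|G|%:R * d + t))
    & cnorm (\sum_i c i * star (c i) - \sum_g e g * alpha g (phi 1 * phi 1) * e g) <= t].
Proof.
move=> pa a0 t0 hd; have [phi_cp phi_le phi0] := phi_oz.
have ah g : star_hom (alpha g) by exact: alpha_hom.
pose s' := [seq alpha g (E ij.1 ij.2) | g <- enum G, ij <- enum {: 'I_n.+1 * 'I_n.+1}].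
have [e [he e0 ea es eg]] := rokhlin_seq rokhlin (s' ++ s) pa a0.
have pe m g : pos (e m g) by case: (he m g).
have se m g : star (e m g) = e m g by exact/pos_sa.
have e1 m g : cnorm (e m g) = 1 by case: (he m g).
have be g : bounded (fun m => e m g) by exists 1 => m; rewrite e1.
have eE g h i j : acomm (fun m => e m g) (alpha h (E i j)).
  apply: es; rewrite mem_cat; apply/orP; left; apply/allpairsP.
  by exists (h, (i, j)); rewrite !mem_enum.
pose c m i := \sum_g e m g * alpha g (E i 0).
have bcg g i : bounded (fun m => e m g * alpha g (E i 0)).
  by apply: boundedM => //; exact: bounded_cst.
have sc m i : star (c m i) = \sum_g alpha g (E 0 i) * e m g.
  rewrite star_sum; apply: eq_bigr => g _; rewrite starM se -ah.
  by rewrite mxunit_star.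
pose D m i := \sum_g e m g * alpha g (E 0 0 * E 0 0 *+ (i == 0)) * e m g.
have gram m i j : star (c m i) * c m j = \sum_g alpha g (E 0 i) * e m g * (e m g * alpha g (E j 0)).
  rewrite sc mulr_suml; apply: eq_bigr => g _; rewrite mulr_sumr (bigD1 g) //=.
  rewrite big1 ?addr0 // => h hg.
  by rewrite -mulrA (mulrA (e m g)) e0 ?mul0r ?mulr0 // eq_sym.
have EE i j : E 0 i * E j 0 = (E 0 0 * E 0 0) *+ (i == j).
  have [->|ij] := eqVneq i j; first by rewrite mulr1n (mxunit_mul phi_cp phi0).
  by rewrite mulr0n (mxunit_mul0 phi_cp phi0).
have gramD i j : aeq (fun m => star (c m i) * c m j)
    (fun m => \sum_g e m g * alpha g ((E 0 0 * E 0 0) *+ (i == j)) * e m g).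
  have h : aeq (fun m => \sum_g alpha g (E 0 i) * e m g * (e m g * alpha g (E j 0)))
    (fun m => \sum_g e m g * alpha g ((E 0 0 * E 0 0) *+ (i == j)) * e m g).
    apply: aeq_sum => g _.
    apply: (@aeq_trans _ _ (fun m => e m g * alpha g (E 0 i) * (alpha g (E j 0) * e m g))).
      apply: aeqM => //.
      - by apply: boundedM => //; exact: bounded_cst.
      - by apply: aeq_sym; exact: eE.
      - exact: eE.
    by apply: eq_aeq => m; rewrite -EE rmorphM !mulrA.
  by apply: aeq_trans h; apply: eq_aeq => m; rewrite gram.
have gram0 i j : null (fun m => star (c m i) * c m j - (star (c m 0) * c m 0) *+ (i == j)).
  have [->|ij] := eqVneq i j.
    apply: aeq_trans (gramD j j) _; apply: aeq_sym.
    by apply: aeq_trans (gramD 0 0) _; apply: eq_aeq => m; rewrite !eqxx.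
  apply: aeq_trans (gramD i j) _; apply: eq_aeq => m.
  by rewrite (negbTE ij) mulr0n big1 // => g _; rewrite rmorph0 mulr0 mul0r.
have alphac g i : null (fun m => alpha g (c m i) - c m i).
  have h : aeq (fun m => \sum_h alpha g (e m h) * alpha (g * h)%g (E i 0))
               (fun m => \sum_h e m (g * h)%g * alpha (g * h)%g (E i 0)).
    by apply: aeq_sum => h _; apply: aeqMr => //; exact: bounded_cst.
  apply: aeq_eq h _ _ => m.
    rewrite rmorph_sum; apply: eq_bigr => h _.
    by rewrite rmorphM /= (alphaM alpha_action).
  by rewrite [RHS](reindex_inj (mulgI g)).
have comm_es g y : y \in s -> null (fun m => e m g * y - y * e m g).
  by move=> ys; apply: es; rewrite mem_cat ys orbT.
have range : null (fun m => \sum_i c m i * star (c m i) -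
    \sum_g e m g * alpha g (phi 1 * phi 1) * e m g).
  have h : aeq (fun m => \sum_i \sum_g \sum_h e m g * alpha g (E i 0) * (alpha h (E 0 i) * e m h))
    (fun m => \sum_i \sum_g \sum_h (if g == h then e m g * alpha g (E i i * E i i) * e m g else 0)).
    apply: aeq_sum => i _; apply: aeq_sum => g _; apply: aeq_sum => h _.
    have [<-|gh] := eqVneq g h.
      by apply: eq_aeq => m; rewrite -(mxunit_mul phi_cp phi0 i 0) rmorphM !mulrA.
    pose x := alpha g (E i 0) * alpha h (E 0 i).
    have ex : acomm (fun m => e m g) x by exact: acommM.
    by apply: aeq_eq (aeqMr (be h) ex) _ _ => m; rewrite /x -?mulrA // e0 // !mulr0.
  apply: aeq_eq h _ _ => m.
    apply: eq_bigr => i _; rewrite sc mulr_suml; apply: eq_bigr => g _.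
    by rewrite mulr_sumr.
  rewrite exchange_big; apply: eq_bigr => g _ /=.
  rewrite (order_zero_sq phi_cp phi0) rmorph_sum mulr_sumr mulr_suml.
  apply: eq_bigr => i _; rewrite (bigD1 g) //= eqxx big1 ?addr0 // => h hg.
  by rewrite eq_sym (negbTE hg).
pose nn : R := n.+1%:R ^+ 2; have nn0 : 0 < nn by rewrite exprn_gt0.
have tn : 0 < t / nn by rewrite divr_gt0.
pose GK : R := 1 + #|G|%:R; have GK0 : 0 < GK by rewrite ltr_pwDl.
have tG : 0 < t / GK by rewrite divr_gt0.
have [N1 hN1] := null_fin_lt (fun ij : 'I_n.+1 * 'I_n.+1 => gram0 ij.1 ij.2) tn.
have [N2 hN2] := null_fin_lt (fun gi : G * 'I_n.+1 => alphac gi.1 gi.2) t0.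
have [N3 hN3] : exists N, forall m, (N <= m)%N -> forall y, y \in s ->
    forall g, cnorm (e m g * y - y * e m g) < t / GK.
  have [N hN] : exists N, forall m, (N <= m)%N -> forall gy, gy \in
      [seq (g, y) | g <- enum G, y <- s] ->
    cnorm (e m gy.1 * gy.2 - gy.2 * e m gy.1) < t / GK.
    apply: (null_seq_lt (x := fun gy m => e m gy.1 * gy.2 - gy.2 * e m gy.1)) => //.
    by move=> gy /allpairsP [[g y] [_ ys ->]]; exact: comm_es.
  exists N => m /hN hm y ys g; apply: (hm (g, y)).
  by apply/allpairsP; exists (g, y); rewrite mem_enum.
have [N4 hN4] := null_lt range t0.
have [N5 hN5] := null_lt (gramD 0 0) t0.
pose m := maxn N1 (maxn N2 (maxn N3 (maxn N4 N5))).
have [m1 m2 m3 m4 m5] : [/\ (N1 <= m)%N, (N2 <= m)%N, (N3 <= m)%N, (N4 <= m)%N & (N5 <= m)%N].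
  by rewrite /m !leq_max !leqnn !orbT; split.
exists (e m), (c m); split; [split|exact: ea|split|split; [|split]|].
- exact: he.
- exact: e0.
- apply: (@le_trans _ _ (\sum_(i < n.+1) \sum_(j < n.+1) t / nn)).
    by apply: ler_sum => i _; apply: ler_sum => j _; exact/ltW/(hN1 m m1 (i, j)).
  rewrite !sumr_const !card_ord -mulrnA -(mulr_natr (t / nn)) natrM -expr2.
  by rewrite divfK // gt_eqF.
- have {}hN5 := ltW (hN5 m m5); rewrite eqxx in hN5.
  set d0 := star (c m 0) * c m 0 in hN5 *; set D0 := \sum_g _ in hN5.
  have pD0 : pos (1 - D0).
    have p1 := orthogonal_sum_norm (he m) (e0 m).
    pose p := \sum_g e m g; have sp : sa p by apply: pos_sa; apply: pos_sum => g _.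
    have -> : 1 - D0 = (1%:C *: 1 - p * p) +
        \sum_g e m g * (1 - alpha g (E 0 0 * E 0 0)) * e m g.
      rewrite /p orthogonal_sum_sq; last exact: e0.
      have -> : \sum_g e m g * (1 - alpha g (E 0 0 * E 0 0)) * e m g = \sum_g e m g * e m g - D0.
        by rewrite -sumrB; apply: eq_bigr => g _; rewrite mulr1n; alg.
      by alg.
    apply: posD.
      apply: pos_norm_sub; first exact: sa_sq.
      by rewrite -(mulr1 1); exact: cnormM_le.
    apply: pos_sum => g _; apply: pos_conj_sa; first exact: se.
    have -> : 1 - alpha g (E 0 0 * E 0 0) = alpha g (1%:C *: 1 - E 0 0 * E 0 0).
      by rewrite scale1r rmorphB rmorph1.
    have sE : sa (E 0 0) by exact/pos_sa/mxunit_pos.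
    apply: hom_pos => //; apply: pos_norm_sub; first exact: sa_sq.
    by rewrite -(mulr1 1); apply: cnormM_le; exact: mxunit_norm.
  have -> : (1 + t)%:C *: 1 - d0 = (1 - D0) + (t%:C *: 1 - (d0 - D0)) by alg.
  apply: posD => //; apply: pos_norm_sub => //; apply: saB.
    exact/pos_sa/pos_starM.
  by rewrite -[D0](subKr 1); apply: saB; [exact: sa1|exact: pos_sa].
- move=> i; apply: le_trans (cnorm_sum _ _ _) _.
  apply: (@le_trans _ _ (\sum_(g : G) 1)); last by rewrite sumr_const.
  apply: ler_sum => g _; rewrite -(mulr1 1); apply: cnormM_le; rewrite ?e1 //.
  exact: le_trans (hom_norm (ah g) _) (mxunit_norm _ _).
- by move=> g i; exact/ltW/(hN2 m m2 (g, i)).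
- move=> i y ys.
  have -> : c m i * y - y * c m i = \sum_g (e m g * (alpha g (E i 0) * y - y * alpha g (E i 0)) +
      (e m g * y - y * e m g) * alpha g (E i 0)).
    rewrite /c mulr_suml mulr_sumr -sumrB; apply: eq_bigr => g _; alg.
  apply: le_trans (cnorm_sum _ _ _) _.
  apply: (@le_trans _ _ (\sum_(g : G) (d + t / GK))).
    apply: ler_sum => g _; apply: le_trans (cnormD _ _) _; apply: lerD.
      by rewrite -[d]mul1r; apply: cnormM_le; rewrite ?e1 //; exact: hd.
    rewrite -[leRHS]mulr1; apply: cnormM_le; first exact/ltW/hN3.
    exact: le_trans (hom_norm (ah g) _) (mxunit_norm _ _).
  rewrite sumr_const -(mulr_natl (d + _)) mulrDr lerD2l mulrCA.
  by rewrite ler_piMr ?(ltW t0) // ler_pdivrMr // mul1r lerDr.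
- exact/ltW/hN4.
Qed.

End ApproximateRow.

(** * Transfer to the crossed product *)

Section Transfer.
Variables (R : realType) (A B : cstarAlgType R) (f : {lrmorphism A -> B}).
Hypothesis fs : star_hom f.

Lemma hom_cuntz a b : cuntz_sub a b -> cuntz_sub (f a) (f b).
Proof.
move=> [x hx]; exists (fun n => f (x n)); apply: eq_null (hom_null fs hx) => n.
by rewrite rmorphB !rmorphM /= fs.
Qed.

Lemma hom_cpc_order_zero n (phi : {linear 'M[R[i]]_n.+1 -> A}) :
  cpc_order_zero phi -> cpc_order_zero [the {linear 'M[R[i]]_n.+1 -> B} of f \o phi].
Proof.
move=> [cp le oz]; split.
- move=> k X /cp [Y hY]; exists (map_mx f Y).
  have /matrixP hY' := hY; apply/matrixP => i j; have := hY' i j; rewrite !mxE /= => ->.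
  rewrite rmorph_sum; apply: eq_bigr => l _.
  by rewrite rmorphM !mxE /= fs.
- by move=> x; apply: le_trans (hom_norm fs _) (le x).
- by move=> a b pa pb ab0; rewrite /= -rmorphM oz // rmorph0.
Qed.

Lemma isomorphic_tracially_Z_absorbing (g : {lrmorphism B -> A}) :
  star_hom g -> cancel f g -> cancel g f ->
  tracially_Z_absorbing A -> tracially_Z_absorbing B.
Proof.
move=> gs fK gK [notC tza]; split.
  move=> [h hs hb]; apply: notC; exists [the {lrmorphism A -> R[i]^o} of h \o f].
    by move=> x /=; rewrite fs hs.
  by apply: bij_comp => //; exists g.
move=> F e b n finF e0 pb b0.
have gb0 : g b != 0 by apply: contra_neq b0 => gb0; rewrite -[b]gK gb0 rmorph0.
have pgb : positive (g b) by case: pb => x ->; exists (g x); rewrite rmorphM /= gs.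
have [phi [cpc cz comm]] :=
  tza [set g y | y in F]%classic e (g b) n (finite_image g finF) e0 pgb gb0.
exists [the {linear 'M[R[i]]_n.+1 -> B} of f \o phi]; split.
- exact: hom_cpc_order_zero.
- by have := hom_cuntz cz; rewrite rmorphB rmorph1 gK.
- move=> x y x1 Fy /=; rewrite -[y]gK -!rmorphM -rmorphB.
  apply: le_lt_trans (hom_norm fs _) _; apply: comm => //.
  by exists y.
Qed.

End Transfer.

(** * Comparison in the crossed product *)

Section CrossedProductAbsorbing.
Variables (R : realType) (A : cstarAlgType R) (G : finGroupType).
Variable alpha : G -> {lrmorphism A -> A}.
Variables (B : cstarAlgType R) (iota : {lrmorphism A -> B}) (u : G -> B).
Hypotheses (simpleA : simple_cstar A) (alpha_action : is_action alpha).
Hypothesis crossed : is_crossed_product alpha iota u.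
Hypothesis rokhlin : gen_tracial_Rokhlin alpha.
Implicit Types (a : A) (b : B) (g h : G).

Let iota_star : star_hom iota := crossed_hom crossed.

(** A star homomorphism from [B] to the complex numbers restricts to one on [A], which is injective
    by simplicity and onto because of the scalars. *)
Lemma crossed_not_complex :
  ~ star_isomorphic A R[i]^o -> ~ star_isomorphic B R[i]^o.
Proof.
move=> notC [f fs _]; apply: notC.
pose k : {lrmorphism A -> R[i]^o} := [the {lrmorphism A -> R[i]^o} of f \o iota].
have ks : star_hom k by move=> x; rewrite /k /= iota_star fs.
have kinj : injective k := simple_hom_inj (B := R[i]^o : cstarAlgType R) simpleA ks.
have kc (c : R[i]^o) : k c%:A = c.
  by rewrite (hom_scalar k); exact: mulr1.
exists k => //; exists (fun c : R[i]^o => c%:A) => // x.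
by apply: kinj; rewrite kc.
Qed.

(* The off-diagonal terms of the product contain [e 1 * e k = 0] up to a small error. *)
Lemma corner_expectation (a : G -> A) (s : seq A) :
  exists e : nat -> A, [/\ forall m, pos (e m) /\ cnorm (e m) = 1,
    forall q, q \in s -> acomm e q &
    aeq (fun m => iota (e m) * ((\sum_g iota (a g) * u g) * star (\sum_g iota (a g) * u g)) *
                  iota (e m))
        (fun m => iota (e m * (\sum_g a g * star (a g)) * e m))].
Proof.
have ah g : star_hom (alpha g) by exact: alpha_hom.
pose z g h := a g * alpha (g * h^-1)%g (star (a h)).
have [e [he e0 _ es eg]] :=
  rokhlin_seq rokhlin (s ++ [seq z g h | g <- enum G, h <- enum G]) (pos1 A) (oner_neq0 A).
have be g : bounded (fun m => e m g) by exists 1 => m; case: (he m g) => _ ->.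
exists (fun m => e m 1%g); split=> [//|q qs|]; first by apply: es; rewrite mem_cat qs.
have term g h : aeq
    (fun m => iota (e m 1%g) * (iota (a g) * u g * star (iota (a h) * u h)) * iota (e m 1%g))
    (fun m => if g == h then iota (e m 1%g * (a g * star (a g)) * e m 1%g) else 0).
  pose k := (g * h^-1)%g.
  have uu : iota (a g) * u g * star (iota (a h) * u h) = iota (z g h) * u k.
    rewrite starM (star_unitary crossed) -iota_star mulrA -(mulrA (iota (a g))).
    by rewrite -(unitaryM crossed) -mulrA (unitary_comm crossed) mulrA -rmorphM.
  have ez : acomm (fun m => e m 1%g) (z g h).
    apply: es; rewrite mem_cat; apply/orP; right; apply/allpairsP.
    by exists (g, h); rewrite !mem_enum.
  have eqm m : iota (e m 1%g) * (iota (a g) * u g * star (iota (a h) * u h)) * iota (e m 1%g) =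
      iota (e m 1%g * z g h * alpha k (e m 1%g)) * u k.
    by rewrite uu mulrA -(mulrA _ (u k)) (unitary_comm crossed) mulrA -!rmorphM.
  apply: (@aeq_trans _ _ (fun m => iota (e m 1%g * z g h * alpha k (e m 1%g)) * u k)).
    by apply: eq_aeq => m; rewrite eqm.
  have [gh|gh] := eqVneq g h.
    apply: eq_aeq => m; rewrite /z /k gh mulgV !(alpha1 alpha_action) (unitary1 crossed).
    by rewrite mulr1.
  have k1 : k != 1%g by rewrite /k -eq_mulgV1.
  have ek : aeq (fun m => e m 1%g * z g h * alpha k (e m 1%g)) (fun=> 0).
    apply: (@aeq_trans _ _ (fun m => e m 1%g * z g h * e m k)).
      have ek := eg k 1%g; rewrite mulg1 in ek.
      by apply: aeqMl ek; apply: boundedM => //; exact: bounded_cst.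
    apply: aeq_eq (aeqMr (be k) ez) _ _ => m //.
    by rewrite -mulrA e0 ?mulr0 // eq_sym.
  have ek' : null (fun m => iota (e m 1%g * z g h * alpha k (e m 1%g))).
    by apply: hom_null => //; apply: aeq_null ek _; exact: null0.
  by apply: eq_null (nullMr ek' (bounded_cst (u k))) => m; rewrite subr0.
apply: aeq_eq (@aeq_sum _ _ _ (index_enum G) xpredT _ _ (fun g _ =>
  @aeq_sum _ _ _ (index_enum G) xpredT _ _ (fun h _ => term g h))) _ _ => m.
  rewrite star_sum mulr_suml mulr_sumr mulr_suml; apply: eq_bigr => g _.
  rewrite !mulr_sumr mulr_suml; apply: eq_bigr => h _.
  by [].
rewrite mulr_sumr mulr_suml rmorph_sum; apply: eq_bigr => g _.
rewrite (bigD1 g) //= eqxx big1 ?addr0 // => h hg.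
by rewrite eq_sym (negbTE hg).
Qed.

Lemma cuntz_below b : positive b -> b != 0 ->
  exists a, [/\ pos a, a != 0 & cuntz_sub (iota a) b].
Proof.
(* In the order [c * star c] the coefficient at the unit is [\sum_g a g * star (a g)], without a
   twist by [alpha]. *)
move=> [c0 ->] b0; pose c := star c0.
have -> : star c0 * c0 = c * star c by rewrite /c starK.
have nc : 0 < cnorm c.
  by rewrite cnorm_gt0; apply: contra_neq b0; rewrite /c => c00; rewrite c00 mul0r.
set l := cnorm c in nc; pose K : R := #|G|%:R.
have K1 : 1 <= K by rewrite ler1n; apply/card_gt0P; exists 1%g.
have K0 : 0 < K by exact: lt_le_trans K1.
have K2 : 0 < K ^+ 2 by rewrite exprn_gt0.
(* Some coefficient has norm at least [l / (2 K)], whose square is [16 d]. Compression keeps a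
   quarter of it, and [4 d] survives the cut by [2 d]. *)
pose d := l ^+ 2 / (64 * K ^+ 2).
have d0 : 0 < d by rewrite divr_gt0 ?exprn_gt0 // mulr_gt0.
(* The first bound keeps the norm of the approximant [c'] between [l / 2] and [2 l]; by the second,
   [c * star c] and [c' * star c'] differ by at most [3 l r <= d / 2]. *)
pose r := Num.min (l / 2) (d / 2 / (3 * l)).
have r0 : 0 < r by rewrite lt_min !divr_gt0 // mulr_gt0.
have rl : r <= l / 2 by rewrite ge_min lexx.
have rd : r * (3 * l) <= d / 2 by rewrite -ler_pdivlMr ?mulr_gt0 // ge_min lexx orbT.
have [a ha] := crossed_dense crossed c r0.
set c' := \sum_g _ in ha; pose a0 := \sum_g a g * star (a g).
have nc' : l / 2 <= cnorm c'.
  have := cnormD (c - c') c'; rewrite subrK -/l => h.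
  have := ltW ha; lra.
have c'l : cnorm c' <= 2 * l.
  have := cnormB c (c - c'); rewrite subKr -/l => h.
  have := ltW ha; lra.
have cc' : cnorm (c * star c - c' * star c') <= d / 2.
  have -> : c * star c - c' * star c' = (c - c') * star c + c' * star (c - c').
    by rewrite starB; alg.
  apply: le_trans rd; apply: le_trans (cnormD _ _) _.
  have h1 : cnorm ((c - c') * star c) <= r * l.
    by apply: cnormM_le; [exact: ltW|rewrite cnorm_star].
  have h2 : cnorm (c' * star (c - c')) <= 2 * l * r.
    by apply: cnormM_le; [|rewrite cnorm_star; exact: ltW].
  by apply: le_trans (lerD h1 h2) _; lra.
have pa0 : pos a0 by apply: pos_sum => g _; exact: pos_starMr.
have na0 : 16 * d <= cnorm a0.
  have [g hg] : exists g, l / (2 * K) <= cnorm (a g).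
    apply: contrapT => h.
    have {}h g : cnorm (a g) < l / (2 * K).
      by rewrite ltNge; apply/negP => hg; apply: h; exists g.
    have : cnorm c' < \sum_(g : G) l / (2 * K).
      apply: (@le_lt_trans _ _ (\sum_g cnorm (a g))).
        apply: le_trans (cnorm_sum _ _ _) _; apply: ler_sum => g _.
        rewrite -[leRHS]mulr1; apply: cnormM_le; first exact: hom_norm.
        by rewrite (cnorm_unitary crossed).
      apply: ltr_sum => // ; apply/hasP; exists 1%g => //; exact: mem_index_enum.
    rewrite sumr_const -(mulr_natl (l / _)) -/K.
    have -> : K * (l / (2 * K)) = l / 2 by field; rewrite gt_eqF.
    by rewrite ltNge nc'.
  apply: (@le_trans _ _ (cnorm (a g * star (a g)))).
    rewrite cnorm_starMr; apply: (@le_trans _ _ ((l / (2 * K)) ^+ 2)).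
      by rewrite le_eqVlt; apply/orP; left; apply/eqP; rewrite /d; field; rewrite gt_eqF.
    by rewrite ler_pXn2r ?nnegrE // divr_ge0 ?mulr_ge0 // ltW.
  apply: pos_le_norm; first exact: pos_starMr.
  rewrite /a0 (bigD1 g) //= addrC addrK.
  by apply: pos_sum => h _; exact: pos_starMr.
have a00 : a0 != 0 by rewrite -cnorm_gt0; apply: lt_le_trans na0; rewrite mulr_gt0.
have [s hs] := compression_lower_bound simpleA pa0 a00.
have [e [he es ce]] := corner_expectation a s.
have [N1 h1] := hs e he es.
have d2 : 0 < d / 2 by rewrite divr_gt0.
have [N2 h2] := null_lt ce d2; pose m := maxn N1 N2.
have {}h1 := h1 m (leq_maxl _ _); have {}h2 := h2 m (leq_maxr _ _).
have [pe e1] := he m; have se := pos_sa pe.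
set y := e m * a0 * e m in h1 h2.
have py : pos y by exact: pos_conj_sa.
have sy := pos_sa py.
have [q [q' [pq pq' yq qq' _]]] := pos_parts (saB sy (saZ (2 * d) (sa1 A))).
exists q; split=> //.
  apply/eqP => q0; have : cnorm y <= 2 * d.
    apply: pos_norm_le => //; first by rewrite mulr_ge0 // ltW.
    by rewrite -opprB yq q0 sub0r opprK.
  by move: h1 na0 d0; lra.
apply: cuntz_trans (_ : cuntz_sub (iota (e m) * (c * star c) * star (iota (e m))) _).
  have sie : sa (iota (e m)) by exact: hom_sa.
  apply: (cuntz_perturb (d := iota y) (q' := iota q') d0).
  - by apply: pos_conjr; exact: pos_starMr.
  - exact: hom_sa.
  - rewrite sie; have -> : iota (e m) * (c * star c) * iota (e m) - iota y =
      iota (e m) * (c * star c - c' * star c') * iota (e m) +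
      (iota (e m) * (c' * star c') * iota (e m) - iota y) by alg.
    apply: le_trans (cnormD _ _) _; rewrite [d]splitr; apply: lerD; last exact: ltW.
    have ie : cnorm (iota (e m)) <= 1 by rewrite -e1; exact: hom_norm.
    by rewrite -[leRHS]mul1r -[leRHS]mulr1; apply: cnormM_le => //; exact: cnormM_le.
  - exact: hom_pos.
  - exact: hom_pos.
  - by rewrite -rmorphM qq' rmorph0.
  - by rewrite -(hom_scalar iota) -!rmorphB yq.
exact: cuntz_conj.
Qed.

Lemma cuntz_copies N a a' (r : nat -> A) (I : finType) (w : I -> B) (idx : I -> nat) :
  (forall i j, (i < 2 ^ N)%N -> (j < 2 ^ N)%N -> star (r i) * a * r j = a' *+ (i == j)) ->
  injective idx -> (forall i, (idx i < 2 ^ N)%N) ->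
  cuntz_sub (\sum_i w i * iota a' * star (w i)) (iota a).
Proof.
move=> hr idx_inj idxN; pose z := \sum_i w i * star (iota (r (idx i))).
suff -> : \sum_i w i * iota a' * star (w i) = z * iota a * star z by exact: cuntz_conj.
rewrite /z star_sum !mulr_suml; apply: eq_bigr => i _.
rewrite mulr_sumr (bigD1 i) //= big1 => [|j ji].
  rewrite addr0 starM starK -iota_star.
  have -> : w i * iota (star (r (idx i))) * iota a * (iota (r (idx i)) * star (w i)) =
      w i * iota (star (r (idx i)) * a * r (idx i)) * star (w i) by rewrite !rmorphM !mulrA.
  by rewrite hr // eqxx.
rewrite starM starK -iota_star.
have -> : w i * iota (star (r (idx i))) * iota a * (iota (r (idx j)) * star (w j)) =
    w i * iota (star (r (idx i)) * a * r (idx j)) * star (w j) by rewrite !rmorphM !mulrA.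
by rewrite hr // (inj_eq idx_inj) eq_sym (negbTE ji) rmorph0 mulr0 mul0r.
Qed.

(* A defect below [a'] on the complement of the tower and on each level of the tower is
   below [a], because the [u g] move all levels to mutually orthogonal copies of [a']. *)
Lemma tower_defect_cuntz N a a' (r : nat -> A) (e : G -> A) x y :
  (forall i j, (i < 2 ^ N)%N -> (j < 2 ^ N)%N -> star (r i) * a * r j = a' *+ (i == j)) ->
  (#|G| < 2 ^ N)%N -> (forall g, pos (e g) /\ cnorm (e g) = 1) ->
  cuntz_sub x a' -> cuntz_sub y a' ->
  cuntz_sub (iota (x + \sum_g e g * alpha g y * e g)) (iota a).
Proof.
move=> hr GN he /cuntzP hx /cuntzP hy; apply/cuntzP => d d0.
pose K : R := 1 + #|G|%:R; have K0 : 0 < K by rewrite ltr_pwDl.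
have dK : 0 < d / 2 / K by rewrite !divr_gt0.
have [v hv] := hx _ dK; have [w hw] := hy _ dK.
have ew g : iota (e g) * u g * iota w * iota a' * star (iota (e g) * u g * iota w) =
    iota (e g * alpha g (w * a' * star w) * e g).
  have seg : star (iota (e g)) = iota (e g) by apply: hom_sa => //; apply: pos_sa; case: (he g).
  rewrite !starM seg -iota_star !rmorphM /= -!(unitary_conj crossed) !mulrA.
  have uu t t' : t * star (u g) * u g * t' = t * t' :> B.
    by rewrite -(mulrA t) (unitary_starM crossed) mulr1.
  by rewrite !uu.
pose W (o : option G) := if o is Some g then iota (e g) * u g * iota w else iota v.
(* One copy for the complement of the tower and one for each level, hence the strict inequality
   between [#|G|] and [2 ^ N]. *)
pose idx (o : option G) : nat := if o is Some g then (enum_rank g).+1 else 0%N.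
have idx_inj : injective idx.
  by move=> [g|] [h|] //= [] /ord_inj /enum_rank_inj ->.
have idxN o : (idx o < 2 ^ N)%N.
  case: o => [g|] /=; last by rewrite expn_gt0.
  by apply: leq_trans GN; rewrite ltnS; exact: ltn_ord.
have /cuntzP /(_ (d / 2)) [] := cuntz_copies W hr idx_inj idxN; first by rewrite divr_gt0.
move=> z hz; exists z.
have Wsum : \sum_o W o * iota a' * star (W o) =
    iota (v * a' * star v + \sum_g e g * alpha g (w * a' * star w) * e g).
  have -> : \sum_o W o * iota a' * star (W o) =
     W None * iota a' * star (W None) + \sum_g W (Some g) * iota a' * star (W (Some g)).
    rewrite (bigD1 None) //=; congr (_ + _).
    rewrite (reindex_omap Some id) /=; last by case.
    by apply: eq_bigl => g; rewrite eqxx.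
  rewrite rmorphD rmorph_sum; congr (_ + _); first by rewrite !rmorphM /= iota_star.
  by apply: eq_bigr => g _; exact: ew.
rewrite Wsum in hz; set X := iota (v * _ * _ + _) in hz.
have -> : iota (x + \sum_g e g * alpha g y * e g) - z * iota a * star z =
    (iota (x + \sum_g e g * alpha g y * e g) - X) + (X - z * iota a * star z) by alg.
apply: le_lt_trans (cnormD _ _) _; rewrite [d]splitr; apply: ler_ltD => //.
rewrite /X -rmorphB; apply: le_trans (hom_norm iota_star _) _.
have -> : x + \sum_g e g * alpha g y * e g -
    (v * a' * star v + \sum_g e g * alpha g (w * a' * star w) * e g) =
    (x - v * a' * star v) + \sum_g e g * alpha g (y - w * a' * star w) * e g.
  have -> : \sum_g e g * alpha g (y - w * a' * star w) * e g =
     \sum_g e g * alpha g y * e g - \sum_g e g * alpha g (w * a' * star w) * e g.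
    by rewrite -sumrB; apply: eq_bigr => g _; rewrite rmorphB mulrBr mulrBl.
  by alg.
apply: le_trans (cnormD _ _) _.
apply: (@le_trans _ _ (d / 2 / K + \sum_(g : G) d / 2 / K)).
  apply: lerD; first exact: ltW.
  apply: le_trans (cnorm_sum _ _ _) _; apply: ler_sum => g _; have [_ e1] := he g.
  rewrite -[leRHS]mulr1 -[X in X * 1]mul1r.
  apply: cnormM_le; rewrite ?e1 //; apply: cnormM_le; rewrite ?e1 //.
  by apply: le_trans (hom_norm (alpha_hom alpha_action g) _) _; exact: ltW.
rewrite sumr_const -(mulr_natl (d / 2 / K)) -[X in X + _]mul1r -mulrDl -/K mulrC.
by rewrite divfK // gt_eqF.
Qed.

End CrossedProductAbsorbing.

(** * Estimates for the map of a row *)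

Section RowEstimates.
Variables (R : realType) (A : cstarAlgType R) (n : nat).
Implicit Types (a p : A) (x : 'M[R[i]]_n.+1).

(** The row map yields the squares of the tower sum and of [phi 1], whereas the hypotheses control
    [1 - p] for these elements. *)
Lemma cuntz_one_sub_sq p : pos p -> cuntz_sub (1 - p * p) (1 - p).
Proof.
move=> pp; have [w [pw ww wc]] := pos_sqrt_ex (posD (pos1 A) pp).
suff -> : 1 - p * p = w * (1 - p) * star w by exact: cuntz_conj.
have pw' : GRing.comm p w by apply: wc; apply: commrD; [exact: commr1|].
rewrite (pos_sa pw) -mulrA.
have -> : (1 - p) * w = w * (1 - p) by rewrite mulrBl mulrBr pw'; alg.
by rewrite mulrA ww; alg.
Qed.

Lemma commutator_opnorm (phi : {linear 'M[R[i]]_n.+1 -> A}) a (d : R) x :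
  (forall z, opnorm z = 1 -> cnorm (phi z * a - a * phi z) < d) ->
  cnorm (phi x * a - a * phi x) <= opnorm x * d.
Proof.
move=> h; have [->|x0] := eqVneq x 0.
  by rewrite linear0 mul0r mulr0 subrr cnorm0 opnorm_mxnorm cnorm0 mul0r.
have o0 := opnorm_gt0 x0; pose z := ((opnorm x)^-1)%:C *: x.
have z1 : opnorm z = 1.
  by rewrite opnormZ normcR ger0_norm ?invr_ge0 ?(ltW o0) // mulVf // gt_eqF.
have xz : x = (opnorm x)%:C *: z by rewrite scalerA -rmorphM mulfV ?gt_eqF // scale1r.
rewrite {1 2}xz linearZ /= -scalerAl -scalerAr -scalerBr cnormZr gtr0_norm //.
by rewrite ler_pM2l //; apply/ltW/h.
Qed.

Lemma rowmap1 (y : 'I_n.+1 -> A) : rowmap y 1 = \sum_i y i * star (y i).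
Proof.
rewrite rowmapE; apply: eq_bigr => i _; rewrite (bigD1 i) //= big1 => [|j ji].
  by rewrite mxE eqxx scale1r addr0.
by rewrite mxE eq_sym (negbTE ji) scale0r.
Qed.

(** [L] is a bare function with a linearity hypothesis, so that it can be either a commutator or
    [w - alpha g w]. *)
Lemma rowmap_bound (y : 'I_n.+1 -> A) x (L : A -> A) (d : R) : opnorm x = 1 ->
  (forall (c : R[i]) a b, L (c *: a + b) = c *: L a + L b) ->
  (forall i j, cnorm (L (y i * star (y j))) <= d) ->
  cnorm (L (rowmap y x)) <= n.+1%:R ^+ 2 * d.
Proof.
move=> x1 Llin hL.
have L0 : L 0 = 0 by have := Llin (-1) 0 0; rewrite scaler0 addr0 scaleN1r addNr.
have Lsum (F : 'I_n.+1 -> A) : L (\sum_i F i) = \sum_i L (F i).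
  elim/big_rec2: _ => [//|i a b _ <-].
  by have := Llin 1 (F i) b; rewrite !scale1r.
have d0 : 0 <= d by exact: le_trans (hL 0 0).
rewrite rowmapE Lsum; apply: le_trans (cnorm_sum _ _ _) _.
apply: (@le_trans _ _ (\sum_(i < n.+1) \sum_(j < n.+1) d)); last first.
  by rewrite !sumr_const !card_ord -mulrnA -natrX mulr_natl expnS expn1.
apply: ler_sum => i _; rewrite Lsum; apply: le_trans (cnorm_sum _ _ _) _.
apply: ler_sum => j _.
have := Llin (x i j) (y i * star (y j)) 0; rewrite addr0 L0 addr0 => ->.
rewrite cnormZ -[leRHS]mul1r; apply: ler_pM => //; first exact: normc_ge0.
by rewrite -x1; exact: entry_le_opnorm.
Qed.

Lemma commutator_product_bound (y z : A) a (d : R) : cnorm y <= 1 -> cnorm z <= 1 ->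
  cnorm (y * a - a * y) <= d -> cnorm (z * star a - star a * z) <= d ->
  cnorm (y * star z * a - a * (y * star z)) <= 2 * d.
Proof.
move=> y1 z1 hy hz.
have -> : y * star z * a - a * (y * star z) =
    (y * a - a * y) * star z - y * star (z * star a - star a * z).
  by rewrite starB !starM !starK; alg.
apply: le_trans (cnormB _ _) _; rewrite mulr_natl mulr2n; apply: lerD.
  by rewrite -[leRHS]mulr1; apply: cnormM_le; rewrite ?cnorm_star.
by rewrite -[leRHS]mul1r; apply: cnormM_le; rewrite ?cnorm_star.
Qed.

End RowEstimates.

Theorem theorem5p6 (R : realType) (A : cstarAlgType R) (G : finGroupType)
    (alpha : G -> {lrmorphism A -> A})
    (B : cstarAlgType R) (iota : {lrmorphism A -> B}) (u : G -> B) :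
  simple_cstar A ->
  is_action alpha ->
  is_crossed_product alpha iota u ->
  gen_tracial_Rokhlin alpha ->
  tracially_Z_absorbing A ->
  tracially_Z_absorbing B.
Proof.
move=> simpleA action crossed rokhlin absA; have iota_star := crossed_hom crossed.
case: (pickP [pred g : G | g != 1%g]) => [g0 /= g01|G1]; last first.
  have [|rho rho_star [iotaK rhoK]] := crossed_trivial action crossed.
    by move=> g; apply/eqP; have := G1 g; rewrite /= => /negbFE.
  exact: (isomorphic_tracially_Z_absorbing iota_star rho_star iotaK rhoK).
have [notC absorb] := absA; split; first exact: crossed_not_complex simpleA crossed notC.
move=> F eps b n finF eps0 pb b0.
have [a [pa a0 ab]] := cuntz_below simpleA action crossed rokhlin pb b0.
(* The exponent [#|G|] suffices because [#|G| < 2 ^ #|G|]. *)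
have [a' [r [pa' a'0 hr]]] := copies rokhlin simpleA #|G| g01 pa a0.
have /finite_seqP [sF FE] := finF.
have eta0 : 0 < eps / 8 by rewrite divr_gt0.
have [co hco] := choice (fun y => crossed_dense crossed y eta0).
pose nn : R := n.+1%:R ^+ 2; have nn0 : 0 < nn by rewrite exprn_gt0.
pose K : R := #|G|%:R.
have K1 : 1 <= K by rewrite ler1n; apply/card_gt0P; exists 1%g.
have K0 : 0 < K by exact: lt_le_trans K1.
pose M : R := 1 + \sum_(y <- sF) \sum_g (1 + cnorm (co y g)).
have M_sum y : y \in sF -> \sum_g (1 + cnorm (co y g)) <= M.
  move=> ys; rewrite /M (big_rem y) //= addrCA lerDl addr_ge0 //.
  by apply: sumr_ge0 => z _; apply: sumr_ge0 => g _; rewrite addr_ge0.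
have M_co y g : y \in sF -> cnorm (co y g) <= M.
  move=> ys; apply: le_trans (M_sum y ys); rewrite (bigD1 g) //=.
  rewrite [1 + _]addrC -addrA lerDl addr_ge0 //.
  by apply: sumr_ge0 => h _; rewrite addr_ge0.
have M1 : 1 <= M.
  by rewrite lerDl; apply: sumr_ge0 => z _; apply: sumr_ge0 => g _; rewrite addr_ge0.
have M0 : 0 < M by exact: lt_le_trans M1.
(* The tolerances are chosen backwards. [gam] bounds the errors of the exact row, and
   [M * (nn * (2 * gam)) = eps / 4]. The distance from [c] to [y] is [k + sqrt (2 e2)], where each
   term is at most [om]. [k0] also keeps the error that [k] causes in the defect below [e2 / 8], and
   [(k0 / 4) ^ 2] bounds [t] because [k <= 4 sqrt t]. *)
pose gam := eps / (8 * nn * M).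
have gam0 : 0 < gam by rewrite divr_gt0 // !mulr_gt0.
pose om := gam / (8 * M); have om0 : 0 < om by rewrite divr_gt0 // mulr_gt0.
pose e2 := Num.min (2^-1) (om ^+ 2 / 2).
have e20 : 0 < e2 by rewrite lt_min invr_gt0 divr_gt0 ?exprn_gt0 // ltr0n.
pose k0 := Num.min om (e2 / (8 * (n.+1%:R * (1 + K)))).
have nK0 : 0 < n.+1%:R * (1 + K) by rewrite mulr_gt0 // ltr_pwDl // ltW.
have k00 : 0 < k0 by rewrite lt_min om0 divr_gt0 // mulr_gt0.
pose t := Num.min (gam / 4) (Num.min (e2 / 8) ((k0 / 4) ^+ 2)).
have t0 : 0 < t.
  by rewrite !lt_min (divr_gt0 gam0) // (divr_gt0 e20) // exprn_gt0 // divr_gt0.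
have tgam : t <= gam / 4 by rewrite ge_min lexx.
have te2 : t <= e2 / 8 by rewrite !ge_min lexx orbT.
pose k := Num.sqrt (2 * t) + Num.sqrt (3 * t).
have kk0 : k <= k0.
  have st : Num.sqrt t <= k0 / 4.
    rewrite -[leRHS]ger0_norm ?divr_ge0 ?(ltW k00) // -sqrtr_sqr ler_wsqrtr //.
    by rewrite !ge_min lexx !orbT.
  have h (c : R) : 0 <= c <= 4 -> Num.sqrt (c * t) <= 2 * Num.sqrt t.
    move=> /andP[c0 c4]; have -> : 2 * Num.sqrt t = Num.sqrt (2 ^+ 2 * t).
      by rewrite sqrtrM ?sqr_ge0 // sqrtr_sqr ger0_norm.
    by rewrite ler_wsqrtr // ler_pM2r //; lra.
  have h2 := h 2; have h3 := h 3; rewrite /k; lra.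
have kom : k <= om by apply: le_trans kk0 _; rewrite ge_min lexx.
have kge0 : 0 <= k by rewrite addr_ge0 ?sqrtr_ge0.
have ke2 : n.+1%:R * (1 + K) * k <= e2 / 8.
  rewrite mulrC -ler_pdivlMr //; apply: le_trans kk0 _.
  have -> : e2 / 8 / (n.+1%:R * (1 + K)) = e2 / (8 * (n.+1%:R * (1 + K))) by rewrite -mulrA -invfM.
  by rewrite ge_min lexx orbT.
have s2e : Num.sqrt (2 * e2) <= om.
  rewrite -[leRHS]ger0_norm ?(ltW om0) // -sqrtr_sqr ler_wsqrtr //.
  by rewrite mulrC -ler_pdivlMr // ge_min lexx orbT.
pose co_seq := [seq co y g | y <- sF, g <- enum G].
(* The adjoints are included because [y i * star (y j)] commutes with [q] only as far as [y j]
   commutes with [star q]. *)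
pose FA := co_seq ++ map star co_seq.
(* All translates are needed: the commutator of [alpha g (phi x)] with [q] is the image under
   [alpha g] of that of [phi x] with [alpha g^-1 q]. *)
pose sA := [seq alpha h q | h <- enum G, q <- FA].
pose d := gam / (4 * K); have d0 : 0 < d by rewrite divr_gt0 // mulr_gt0.
have [phi [phi_oz phi_cz phi_comm]] :=
  absorb _ d a' n (finite_seq sA) d0 ((positiveP a').2 pa') a'0.
have phi_row g i y : y \in FA -> cnorm (alpha g (mxunit phi i 0) * y -
    y * alpha g (mxunit phi i 0)) <= d.
  move=> yF; have -> : y = alpha g (alpha g^-1%g y).
    by rewrite -(alphaM action) mulgV (alpha1 action).
  rewrite -!rmorphM -rmorphB; apply: le_trans (hom_norm (alpha_hom action g) _) _.
  apply: le_trans (commutator_opnorm (d := d) _ _) _.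
    move=> z z1; apply: phi_comm => //; apply/allpairsP.
    by exists (g^-1%g, y); rewrite mem_enum.
  by rewrite ler_piMl ?(ltW d0) // opnorm_delta.
have [e [c [[he e0] ea [hgram hd] [nc [c_alpha c_comm]] c_range]]] :=
  approximate_row action rokhlin phi_oz pa' a'0 t0 phi_row.
have e2h : e2 <= 2^-1 by rewrite ge_min lexx.
have [y [q [yq q1 cy y_cuntz]]] := exact_row t0 e20 e2h hgram hd.
have y1 i : cnorm (y i) <= 1.
  by rewrite -(@ler_pXn2r _ 2) ?nnegrE // -cnorm_starM yq eqxx mulr1n expr1n.
have {}cy i : cnorm (c i - y i) <= 2 * om.
  by apply: le_trans (cy i) _; rewrite [leRHS]mulr_natl [leRHS]mulr2n; exact: lerD.
have y_alpha g i : cnorm (alpha g (y i) - y i) <= gam.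
  have -> : alpha g (y i) - y i = alpha g (y i - c i) + (alpha g (c i) - c i) + (c i - y i).
    by rewrite homB; alg.
  have h1 : cnorm (alpha g (y i - c i)) <= 2 * om.
    by apply: le_trans (hom_norm (alpha_hom action g) _) _; rewrite cnormBC.
  apply: le_trans (cnormD _ _) _; apply: le_trans (lerD (cnormD _ _) (cy i)) _.
  have h2 := le_trans (c_alpha g i) tgam.
  apply: le_trans (lerD (lerD h1 h2) (lexx _)) _.
  suff : om <= gam / 8 by lra.
  by rewrite /om invfM mulrA ler_pdivrMr // ler_peMr // divr_ge0 // ltW.
have y_comm i z : z \in FA -> cnorm z <= M -> cnorm (y i * z - z * y i) <= gam.
  move=> zF zM.
  have -> : y i * z - z * y i = (c i * z - z * c i) - ((c i - y i) * z - z * (c i - y i)) by alg.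
  apply: le_trans (cnormB _ _) _; apply: le_trans (lerD (c_comm i z zF) (cnormB _ _)) _.
  have h1 : cnorm ((c i - y i) * z) <= 2 * om * M by exact: cnormM_le.
  have h2 : cnorm (z * (c i - y i)) <= M * (2 * om) by exact: cnormM_le.
  apply: le_trans (lerD (lexx _) (lerD h1 h2)) _.
  have -> : #|G|%:R * d = gam / 4 by rewrite /d -/K; field; rewrite gt_eqF.
  have : om * M = gam / 8 by rewrite /om; field; rewrite gt_eqF.
  by move=> h; lra.
have row_oz := rowmap_cpc_order_zero yq q1.
exists [the {linear 'M[R[i]]_n.+1 -> B} of iota \o rowmap y]; split.
- exact: hom_cpc_order_zero.
- apply: cuntz_trans ab; rewrite /= -(rmorph1 iota) -rmorphB rowmap1.
  pose p := \sum_g e g; pose h := phi 1.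
  have pp : pos p by apply: pos_sum => g _; case: (he g).
  have np : cnorm p <= 1 by exact: orthogonal_sum_norm.
  have [phi_cp phi_le phi0] := phi_oz.
  have ph : pos h.
    rewrite /h mxunit_sum; apply: pos_sum => i _; exact: mxunit_pos.
  have nh : cnorm h <= 1 by rewrite -(opnorm1 R n); exact: phi_le.
  have pos1sq (z : A) : pos z -> cnorm z <= 1 -> pos (1 - z * z).
    move=> pz z1; have := @pos_norm_sub R A 1 (z * z); rewrite scale1r; apply.
      exact/sa_sq/pos_sa.
    by rewrite -(mulr1 1); exact: cnormM_le.
  have xcz : cuntz_sub (1 - p * p) a' by exact: cuntz_trans (cuntz_one_sub_sq pp) ea.
  have ycz : cuntz_sub (1 - h * h) a' by exact: cuntz_trans (cuntz_one_sub_sq ph) phi_cz.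
  apply: cuntz_trans (tower_defect_cuntz action crossed hr _ he xcz ycz); last first.
    exact: ltn_expl.
  apply: hom_cuntz => //; apply: y_cuntz.
    apply: posD; first exact: pos1sq.
    apply: pos_sum => g _; apply: pos_conj_sa; first by apply: pos_sa; case: (he g).
    by apply: hom_pos; [exact: alpha_hom|exact: pos1sq].
  (* By orthogonality [p * p] is the sum of the squares of the [e g], so the two defects together
     make up [1 - \sum_g e g * alpha g (h * h) * e g]. *)
  have -> : 1 - \sum_i c i * star (c i) -
      (1 - p * p + \sum_g e g * alpha g (1 - h * h) * e g) =
      - (\sum_i c i * star (c i) - \sum_g e g * alpha g (h * h) * e g).
    have -> : \sum_g e g * alpha g (1 - h * h) * e g =
        p * p - \sum_g e g * alpha g (h * h) * e g.
      rewrite orthogonal_sum_sq // -sumrB; apply: eq_bigr => g _.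
      by rewrite rmorphB rmorph1 mulrBr mulrBl mulr1.
    by alg.
  rewrite cnormN -/k; apply: le_trans (lerD c_range (_ : _ <= n.+1%:R * (1 + K) * k)) _.
    apply: (@le_trans _ _ (\sum_(i < n.+1) (1 + K) * k)).
      by apply: ler_sum => i _; rewrite ler_wpM2r // lerD2l.
    by rewrite sumr_const card_ord -[leLHS]mulr_natl [leLHS]mulrA.
  by lra.
- move=> x z x1; rewrite FE /= => zF; pose Z := \sum_g iota (co z g) * u g.
  set P := rowmap y x.
  have P1 : cnorm P <= 1 by have [_ h _] := row_oz; rewrite -x1; exact: h.
  have iP : cnorm (iota P) <= 1 by exact: le_trans (hom_norm iota_star _) P1.
  have coF g : co z g \in FA.
    by rewrite mem_cat; apply/orP; left; apply/allpairsP; exists (z, g); rewrite mem_enum.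
  have coF' g : star (co z g) \in FA.
    rewrite mem_cat; apply/orP; right; apply: map_f.
    by apply/allpairsP; exists (z, g); rewrite mem_enum.
  have P_comm g : cnorm (P * co z g - co z g * P) <= nn * (2 * gam).
    apply: (@rowmap_bound _ _ _ y x (fun w => w * co z g - co z g * w)) => //.
      by move=> v w w'; alg.
    move=> i j; apply: commutator_product_bound => //; apply: y_comm => //.
      exact: M_co.
    by rewrite cnorm_star; exact: M_co.
  have P_alpha g : cnorm (P - alpha g P) <= nn * (2 * gam).
    apply: (@rowmap_bound _ _ _ y x (fun w => w - alpha g w)) => //.
      by move=> v w w'; rewrite hom_linear; alg.
    move=> i j; rewrite homM (alpha_hom action).
    have -> : y i * star (y j) - alpha g (y i) * star (alpha g (y j)) =
       - (y i * star (alpha g (y j) - y j) + (alpha g (y i) - y i) * star (alpha g (y j))).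
      by rewrite starB; alg.
    rewrite cnormN; apply: le_trans (cnormD _ _) _; rewrite mulr_natl mulr2n; apply: lerD.
      by rewrite -[leRHS]mul1r; apply: cnormM_le; rewrite ?cnorm_star.
    rewrite -[leRHS]mulr1; apply: cnormM_le; rewrite ?cnorm_star //.
    exact: le_trans (hom_norm (alpha_hom action g) _) (y1 j).
  have PZ : cnorm (iota P * Z - Z * iota P) <= eps / 4.
    (* Moving [P] past [u g] replaces it by [alpha g P], so almost invariance of [P] and its almost
       commutation with the coefficients are both used. *)
    have -> : iota P * Z - Z * iota P = \sum_g (iota (P * co z g - co z g * P) * u g +
       iota (co z g * (P - alpha g P)) * u g).
      rewrite /Z mulr_sumr mulr_suml -sumrB; apply: eq_bigr => g _.
      by rewrite -[iota (co z g) * u g * _]mulrA (unitary_comm crossed) mulrBr !homB !homM; alg.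
    apply: (@le_trans _ _ (\sum_g (1 + cnorm (co z g)) * (nn * (2 * gam)))).
      apply: le_trans (cnorm_sum _ _ _) _; apply: ler_sum => g _.
      have nu w : cnorm (iota w * u g) <= cnorm w.
        rewrite -[leRHS]mulr1; apply: cnormM_le; first exact: hom_norm.
        by rewrite (cnorm_unitary crossed).
      apply: le_trans (cnormD _ _) _; rewrite mulrDl mul1r; apply: lerD.
        exact: le_trans (nu _) (P_comm g).
      by apply: le_trans (nu _) _; exact: cnormM_le.
    rewrite -mulr_suml; apply: (@le_trans _ _ (M * (nn * (2 * gam)))).
      have ng : 0 <= nn * (2 * gam) by apply: mulr_ge0; [exact: ltW|apply: mulr_ge0 => //; exact: ltW].
      by rewrite ler_wpM2r // M_sum.
    rewrite le_eqVlt; apply/orP; left; apply/eqP; rewrite /gam.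
    by field; rewrite !gt_eqF.
  have -> : iota P * z - z * iota P =
      (iota P * Z - Z * iota P) + (iota P * (z - Z) - (z - Z) * iota P) by alg.
  have h1 : cnorm (iota P * (z - Z)) <= 1 * (eps / 8).
    by apply: cnormM_le => //; exact/ltW/hco.
  have h2 : cnorm ((z - Z) * iota P) <= eps / 8 * 1.
    by apply: cnormM_le => //; exact/ltW/hco.
  apply: le_lt_trans (cnormD _ _) _.
  apply: le_lt_trans (lerD PZ (cnormB _ _)) _.
  apply: le_lt_trans (lerD (lexx _) (lerD h1 h2)) _.
  by lra.
Qed.
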